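(* Let $s\ge 0$ be an integer, let $e_1,\dots,e_s\ge 2$ be integers, and let $\Gamma$ be the one-relator group $$\Gamma=\langle y_1,\dots,y_s\mid y_1^{e_1}y_2^{e_2}\cdots y_s^{e_s}=1\rangle .$$ Put $\mu(\Gamma)=s-2$ and $\alpha(\Gamma)=-2+\sum_{j=1}^s\frac2{e_j}$, and suppose that $\alpha(\Gamma)<0$. Then, as $n$ tends to infinity, the number $s_n(\Gamma)$ of index $n$ subgroups of $\Gamma$ satisfies $$s_n(\Gamma)\sim K\,(n!)^{\mu(\Gamma)-\alpha(\Gamma)/2}\exp\Bigg(\sum_{j=1}^s\ \sum_{\nu\mid e_j,\ \nu<e_j}\frac{n^{\nu/e_j}}{\nu}+\frac{\alpha(\Gamma)-2\mu(\Gamma)+2}{4}\log n\Bigg),$$ where $$K=\frac{\exp\big(-\sum_{j:\,2\mid e_j}(2e_j)^{-1}\big)}{(2\pi)^{\frac{2+2\mu(\Gamma)-\alpha(\Gamma)}{4}}\sqrt{e_1e_2\cdots e_s}} .$$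
   Context: $f(n)\sim g(n)$ means $f(n)=(1+o(1))g(n)$ as $n\to\infty$.
   Formalization: The formal theorem assumes s ≥ 2; for s = 0 and s = 1 the group is trivial or cyclic of order e_1, so s_n = 0 for all large n while the right-hand side is positive, and the asymptotic fails although α < 0. *)

(* Defs.v *)
From HB Require Import structures.
From mathcomp Require Import all_boot all_order all_algebra generic_quotient finmap.
From mathcomp Require Import all_classical all_reals all_analysis.

Set Implicit Arguments.
Unset Strict Implicit.
Unset Printing Implicit Defensive.

Import Order.TTheory GRing.Theory Num.Theory.
Import numFieldNormedType.Exports.

Local Open Scope classical_set_scope.

Section Presentation.
Local Open Scope quotient_scope.
Variable X : choiceType.

(* The letter (x, true) stands for x and (x, false) for x^-1. *)
Definition word := seq (X * bool).

Definition flip (a : X * bool) : X * bool := (a.1, ~~ a.2).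

Definition word_inv (u : word) : word := rev (map flip u).

Variable rels : set word.

(* The least congruence on words that cancels adjacent inverse letters and
   trivialises every relator.  Its quotient is the quotient of the free group
   on X by the normal closure of rels. *)
Inductive word_cong : word -> word -> Prop :=
| word_cong_refl u : word_cong u u
| word_cong_sym u v : word_cong u v -> word_cong v u
| word_cong_trans v u w : word_cong u v -> word_cong v w -> word_cong u w
| word_cong_cat u u' v v' :
    word_cong u u' -> word_cong v v' -> word_cong (u ++ v) (u' ++ v')
| word_cong_cancel a : word_cong [:: a; flip a] [::]
| word_cong_rel r : rels r -> word_cong r [::].

Definition word_eqb : rel word := fun u v => `[< word_cong u v >].

Lemma word_eqb_equiv : equiv_class_of word_eqb.
Proof.
split.
- by move=> u; apply/asboolP; exact: word_cong_refl.
- by move=> u v; apply/asboolP/asboolP; exact: word_cong_sym.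
- move=> v u w /asboolP uv /asboolP vw; apply/asboolP.
  exact: word_cong_trans uv vw.
Qed.

Canonical word_equiv := EquivRelPack word_eqb_equiv.

Definition presented : Type := {eq_quot word_equiv}.

HB.instance Definition _ := Choice.on presented.
HB.instance Definition _ := EqQuotient.on presented.

Definition pclass (u : word) : presented := \pi_presented u.

Lemma pclassP u v : pclass u = pclass v <-> word_cong u v.
Proof. by split=> [/eqmodP/asboolP|?]; last exact/eqmodP/asboolP. Qed.

Lemma pclass_reprK (x : presented) : pclass (repr x) = x.
Proof. exact: reprK. Qed.

Lemma flipK : involutive flip.
Proof. by case=> x b; rewrite /flip /= negbK. Qed.

Lemma word_invK : involutive word_inv.
Proof. by move=> u; rewrite /word_inv map_rev revK (mapK flipK). Qed.

Lemma word_cong_mulV u : word_cong (u ++ word_inv u) [::].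
Proof.
elim: u => [|a u IH]; first exact: word_cong_refl.
have -> : (a :: u) ++ word_inv (a :: u)
        = [:: a] ++ ((u ++ word_inv u) ++ [:: flip a]).
  by rewrite /word_inv map_cons rev_cons -cats1 /= catA.
apply: (word_cong_trans (v := [:: a] ++ ([::] ++ [:: flip a]))).
  by do !apply: word_cong_cat => //; exact: word_cong_refl.
exact: word_cong_cancel.
Qed.

Lemma word_cong_Vmul u : word_cong (word_inv u ++ u) [::].
Proof. by rewrite -{2}(word_invK u); exact: word_cong_mulV. Qed.

Lemma word_cong_inv u v : word_cong u v -> word_cong (word_inv u) (word_inv v).
Proof.
move=> uv.
apply: (word_cong_trans (v := word_inv u ++ (v ++ word_inv v))).
  rewrite -{1}(cats0 (word_inv u)); apply: word_cong_cat.
    exact: word_cong_refl.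
  exact/word_cong_sym/word_cong_mulV.
rewrite catA; apply: (word_cong_trans (v := [::] ++ word_inv v)); last first.
  exact: word_cong_refl.
apply: word_cong_cat; last exact: word_cong_refl.
apply: word_cong_trans (word_cong_Vmul u).
by apply: word_cong_cat; [exact: word_cong_refl | exact: word_cong_sym].
Qed.

Definition pmul (x y : presented) : presented := pclass (repr x ++ repr y).
Definition pinv (x : presented) : presented := pclass (word_inv (repr x)).

Lemma repr_pclass u : word_cong (repr (pclass u)) u.
Proof. by apply/pclassP; rewrite pclass_reprK. Qed.

Lemma pmulE u v : pmul (pclass u) (pclass v) = pclass (u ++ v).
Proof. by apply/pclassP/word_cong_cat; exact: repr_pclass. Qed.

Lemma pinvE u : pinv (pclass u) = pclass (word_inv u).
Proof. by apply/pclassP/word_cong_inv/repr_pclass. Qed.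

Lemma pmulA : associative pmul.
Proof.
move=> x y z; rewrite -(pclass_reprK x) -(pclass_reprK y) -(pclass_reprK z).
by rewrite !pmulE catA.
Qed.

Lemma pmul1 : left_id (pclass [::]) pmul.
Proof. by move=> x; rewrite -(pclass_reprK x) pmulE. Qed.

Lemma pmulr1 : right_id (pclass [::]) pmul.
Proof. by move=> x; rewrite -(pclass_reprK x) pmulE cats0. Qed.

Lemma pmulV : left_inverse (pclass [::]) pinv pmul.
Proof.
move=> x; rewrite -(pclass_reprK x) pinvE pmulE.
exact/pclassP/word_cong_Vmul.
Qed.

Lemma pmulrV : right_inverse (pclass [::]) pinv pmul.
Proof.
move=> x; rewrite -(pclass_reprK x) pinvE pmulE.
exact/pclassP/word_cong_mulV.
Qed.

HB.instance Definition _ :=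
  isGroup.Build presented pmulA pmul1 pmulr1 pmulV pmulrV.

End Presentation.

Section SubgroupGrowth.
Variable G : groupType.
Local Open Scope group_scope.

Definition lcoset_set (x : G) (H : set G) : set G := [set x * h | h in H].

Definition lcosets_set (H : set G) : set (set G) :=
  [set lcoset_set x H | x in [set: G]].

Definition index_subgroups (n : nat) : set (set G) :=
  [set H | group_closed (mem H) /\ (lcosets_set H #= `I_n)%card].

(* fset_set sends an infinite set to the empty one; this does not occur for a
   finitely generated G. *)
Definition subgroup_number (n : nat) : nat := #|` fset_set (index_subgroups n)|.

End SubgroupGrowth.

Section OneRelator.
Variables (s : nat) (e : 'I_s -> nat).

Definition relator : word 'I_s := \big[cat/[::]]_(j < s) nseq (e j) (j, true).

Definition Gamma : groupType := presented [set relator].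

Local Open Scope ring_scope.
Variable R : realType.

Definition mu : R := s%:R - 2.

Definition alpha : R := - 2 + \sum_(j < s) 2 / (e j)%:R.

Definition Kconst : R :=
  expR (- \sum_(j < s | (2 %| e j)%N) (2 * (e j)%:R)^-1)
  / ((2 * pi) `^ ((2 + 2 * mu - alpha) / 4) * Num.sqrt (\prod_(j < s) (e j)%:R)).

Definition growth (n : nat) : R :=
  Kconst * n`!%:R `^ (mu - alpha / 2)
  * expR (\sum_(j < s) \sum_(nu <- divisors (e j) | (nu < e j)%N)
            n%:R `^ (nu%:R / (e j)%:R) / nu%:R
          + (alpha - 2 * mu + 2) / 4 * ln n%:R).

End OneRelator.

(* Main.v *)
(* A subgroup of index n is the stabiliser of a point in (n - 1)! transitive
   actions of Gamma on n points, i.e. transitive tuples of permutations x_j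
   with \prod_j x_j ^+ e_j = 1.  Among all such tuples

   - those with x_j ^+ e_j = 1 for every j dominate.  Summing the numbers
     r_j(z) of e_j-th roots over the tuples z with product 1, Young's
     inequality, that is a weighted AM-GM with weights lam_j summing to 1,
     reduces this to
     \sum_(z != 1) (r_j(z) / r_j(1)) ^ (1 / (1 - lam_j)) --> 0.
     As \sum_j e_j^-1 < 1, one can take lam_j > e_j^-1, and then the limit
     follows from r_j(z) <= 2 ^ b * r_j(1 on n - b points)
     * r_j(1 on N points), where z moves b points in N nontrivial cycles;
   - those that are not transitive are negligible, since the number of tuples
     grows like a power of n! with exponent greater than 1.

   The number of x with x ^+ m = 1, divided by n! and multiplied by r ^+ n, is
   up to an explicit factor the probability that \sum_(d | m) d * P_d = n for
   independent Poisson variables P_d of mean r ^ d / d.  For r ^ m close to n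
   this probability follows from the local behaviour of P_m together with the
   equidistribution modulo m of the other terms. *)
Require Import Defs.
From mathcomp Require Import all_boot all_order all_algebra all_fingroup.
From mathcomp Require Import lra zify.

Set Implicit Arguments.
Unset Strict Implicit.
Unset Printing Implicit Defensive.

Import Order.TTheory GRing.Theory Num.Theory.

(** * Permutations of order dividing m *)

(** Quantitative estimates are logarithmic, relative to [n!]. For [m = e_j] the number of torsion
    elements is about [n! ^ (1 - 1/m)], and [r_j(z) / r_j(1)] is at most, up to a factor exponential
    in b, the power -(1 - 1/m) of [n ^_ b / N!], which also governs the number of z with the same b
    and N. Sums of q-th powers over z != 1 thus vanish in the limit once [q * (1 - 1/m) > 1]. With
    [q = 1 / (1 - lam)] this says [lam > 1/m], whence the condition on the weights.

    The delicate constant is [exp (- 1 / (2 m))] for even m. The Poisson sum has mean [r ^ m] plus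
    the sum of [r ^ d] over the proper divisors d, and this must equal n up to o(sqrt n). For even m
    the divisor m / 2 contributes about sqrt n, so that [r ^ m] is taken to be n - sqrt n; for odd m
    it is n, all other terms being smaller. The shift leaves a constant in the exponent.

    Counting and probability are linked by a recursion: removing the cycle through a point gives for
    the torsion numbers the recursion that the law of the Poisson sum satisfies. *)

Section Torsion.
Local Open Scope group_scope.
Implicit Types (T U : finType) (m : nat).

Definition torsion m T (A : {set T}) : {set {perm T}} :=
  [set x | perm_on A x && (x ^+ m == 1)].

Definition ntorsion m n : nat := #|torsion m [set: 'I_n]|.

Lemma torsionP m T (A : {set T}) (x : {perm T}) :
  reflect (perm_on A x /\ x ^+ m = 1) (x \in torsion m A).
Proof. by rewrite inE; apply: (iffP andP) => -[? /eqP]. Qed.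

Lemma torsionT m T (x : {perm T}) : (x \in torsion m [set: T]) = (x ^+ m == 1).
Proof.
have xT : perm_on [set: T] x by apply/subsetP => y; rewrite inE.
by rewrite inE xT.
Qed.

Lemma perm_onX T (A : {set T}) (x : {perm T}) k : perm_on A x -> perm_on A (x ^+ k).
Proof.
by move=> xA; elim: k => [|k IH]; rewrite ?expg0 ?perm_on1// expgS perm_onM.
Qed.

(** Permutations are transported along a bijection of [A] with [B] and extended by the identity off
    [B]. By symmetry the inequality is enough for [card_torsion]. *)
Lemma leq_card_torsion m T U (A : {set T}) (B : {set U}) :
  #|A| = #|B| -> #|torsion m A| <= #|torsion m B|.
Proof.
case: (set_0Vmem A) => [->|[x0 Ax0]] AB.
  rewrite [leqLHS](_ : _ = #|[set (1 : {perm T})]|); last first.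
    apply: eq_card => x; rewrite !inE; apply/andP/eqP => [[/perm_on_id->]|->] //.
      by rewrite cards0.
    by rewrite expg1n perm_on1.
  rewrite cards1 card_gt0; apply/set0Pn; exists 1.
  by rewrite inE perm_on1 expg1n eqxx.
have /set0Pn[u0 Bu0] : B != set0.
  by rewrite -card_gt0 -AB card_gt0; apply/set0Pn; exists x0.
pose f x := nth u0 (enum B) (index x (enum A)).
pose g u := nth x0 (enum A) (index u (enum B)).
have Af x : x \in A -> f x \in B.
  by move=> Ax; rewrite -mem_enum mem_nth// -cardE -AB cardE index_mem mem_enum.
have Bg u : u \in B -> g u \in A.
  by move=> Bu; rewrite -mem_enum mem_nth// -cardE AB cardE index_mem mem_enum.
have fK : {in A, cancel f g}.
  move=> x Ax; rewrite /g /f index_uniq ?enum_uniq ?nth_index ?mem_enum//.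
  by rewrite -cardE -AB cardE index_mem mem_enum.
have gK : {in B, cancel g f}.
  move=> x Ax; rewrite /g /f index_uniq ?enum_uniq ?nth_index ?mem_enum//.
  by rewrite -cardE AB cardE index_mem mem_enum.
pose h (x : {perm T}) u := if (u \in B) && perm_on A x then f (x (g u)) else u.
have h_inj x : injective (h x).
  move=> u v; rewrite /h; case: (boolP (perm_on A x)) => [xA|_]; last by rewrite !andbF.
  have xg w : w \in B -> x (g w) \in A by move=> Bw; rewrite perm_closed// Bg.
  rewrite !andbT; case: ifPn => Bu; case: ifPn => Bv // e.
  - by move/(can_in_inj fK): e => /(_ (xg _ Bu) (xg _ Bv)) /perm_inj /(can_in_inj gK)->.
  - by move: Bv; rewrite -e Af// xg.
  - by move: Bu; rewrite e Af// xg.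
pose H x := perm (@h_inj x).
have HE x u : perm_on A x -> u \in B -> H x u = f (x (g u)).
  by move=> xA Bu; rewrite permE /h Bu xA.
rewrite -(@card_in_imset _ _ H); last first.
  move=> x y /torsionP[xA _] /torsionP[yA _] xy; apply/permP => z.
  case: (boolP (z \in A)) => Az; last by rewrite !(out_perm _ Az).
  have := HE x (f z) xA (Af _ Az); rewrite xy HE ?Af// !fK//.
  by move/(can_in_inj fK) => ->//; rewrite perm_closed.
apply/subset_leq_card/subsetP => _ /imsetP[x /torsionP[xA xm] ->].
apply/torsionP; split.
  apply/subsetP => u; rewrite inE permE /h; case: (boolP (u \in B)) => //.
  by rewrite eqxx.
have Hk k u : u \in B -> (H x ^+ k) u = f ((x ^+ k) (g u)).
  move=> Bu; elim: k => [|k IH]; first by rewrite !expg0 !perm1 gK.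
  by rewrite !expgSr !permM IH HE ?Af ?fK// ?perm_closed ?Bg//; apply: perm_onX.
apply/permP => u; rewrite perm1.
case: (boolP (u \in B)) => Bu; first by rewrite Hk// xm perm1 gK.
rewrite permX; elim: (m) => //= k ->.
by rewrite permE /h (negbTE Bu).
Qed.


Lemma card_torsion m T (A : {set T}) : #|torsion m A| = ntorsion m #|A|.
Proof.
by apply/eqP; rewrite eqn_leq !leq_card_torsion// cardsT card_ord.
Qed.

Lemma orbit_order_dvd T (x : {perm T}) a m :
  x ^+ m = 1 -> fingraph.order x a %| m.
Proof.
move=> xm; set d := fingraph.order x a.
have d0 : 0 < d by exact: fingraph.order_gt0.
have xd k : iter (k * d) x a = a.
  elim: k => // k IH; rewrite mulSn iterD IH.
  exact: (iter_order (@perm_inj _ x)).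
have e : iter (m %% d) x a = a.
  have : iter m x a = a by rewrite -permX xm perm1.
  by rewrite {1}(divn_eq m d) addnC iterD xd.
have := findex_iter (ltn_pmod m d0); rewrite e findex0 => /esym/eqP.
by [].
Qed.

(* The permutations of order dividing m whose cycle through a is c are the
   products of the cycle c with the torsion elements supported off c. *)
Lemma card_torsion_orbit m T (a : T) (t : seq T) :
  uniq (a :: t) -> size (a :: t) %| m ->
  #|[set x in torsion m [set: T] | fingraph.orbit x a == a :: t]|
  = ntorsion m (#|T| - size (a :: t)).
Proof.
set c := a :: t => uc dm.
pose S := [set z in c].
have cS : #|S| = size c by rewrite cardsE; apply/card_uniqP.
have nout w : w \notin c -> next c w = w by move=> h; rewrite next_nth (negbTE h).
have g_inj : injective (next c).
  move=> u v; case: (boolP (u \in c)) => uc'; case: (boolP (v \in c)) => vc e.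
  - by rewrite -(prev_next uc u) e prev_next.
  - by move: (vc); rewrite -(nout v vc) -e mem_next uc'.
  - by move: (uc'); rewrite -(nout u uc') e mem_next vc.
  - by move: e; rewrite !nout.
pose g := perm g_inj.
have gE u : g u = next c u by rewrite permE.
have gout u : u \notin c -> g u = u by move=> h; rewrite gE nout.
have gS : perm_on S g.
  apply/subsetP => u; rewrite !inE; apply: contraR => /gout ->; exact: eqxx.
have gm : g ^+ m = 1.
  apply/permP => u; rewrite perm1 permX.
  case: (boolP (u \in c)) => uc'; last by elim: (m) => //= k ->; exact: gout.
  have gd : iter (size c) g u = u.
    have fc : fcycle g c by rewrite (eq_cycle (e' := frel (next c))) ?cycle_next// => ? ? /=; rewrite gE.
    by rewrite -{1}(order_cycle fc uc uc') (iter_order_cycle fc).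
  case/dvdnP: dm => k ->; elim: k => // k IH.
  by rewrite mulSn iterD IH gd.
have -> : #|T| - size c = #|~: S| by rewrite cardsCs setCK cS.
rewrite -card_torsion -[RHS](card_imset _ (mulgI g)); apply: eq_card => x.
rewrite [LHS]inE. apply/idP/imsetP => [/andP[/torsionP[_ xm] /eqP oc]|[y /torsionP[yA ym] ->]].
- exists (g^-1 * x); last by rewrite mulKVg.
  have fc : fcycle x c by rewrite -oc; apply: cycle_orbit; exact: perm_inj.
  have xg u : u \in c -> x u = g u.
    by move=> uc'; rewrite gE; apply/eqP; have := next_cycle fc uc'.
  have yA : perm_on (~: S) (g^-1 * x).
    apply/subsetP => u; rewrite !inE permM; apply: contraNN => uc'.
    by rewrite xg ?permKV// -(mem_next c) -gE permKV.
  apply/torsionP; split=> //.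
  have cgx : commute g (g^-1 * x).
    by apply: perm_onC gS yA _; rewrite -setI_eq0 setICr.
  by rewrite -[LHS]mul1g -{1}gm -expgMn// mulKVg.
- have cgy : commute g y.
    by apply: perm_onC gS yA _; rewrite -setI_eq0 setICr.
  apply/andP; split.
    by rewrite torsionT expgMn// gm ym mul1g.
  have fc : fcycle (g * y) c.
    apply: cycle_from_next => // u uc'; rewrite /= permM gE (out_perm yA)//.
    by rewrite in_setC negbK inE mem_next.
  have ac : a \in c by rewrite inE eqxx.
  have so := order_cycle fc uc ac.
  rewrite /fingraph.orbit so.
  have : path (frel (g * y)) a t by move: fc; rewrite /= rcons_path => /andP[].
  by case/fpathP => k tk; rewrite /c /= tk size_traject eqxx.
Qed.

Lemma ntorsion0 m : ntorsion m 0 = 1%N.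
Proof.
rewrite /ntorsion (_ : torsion m [set: 'I_0] = [set 1]) ?cards1//.
apply/setP => x; rewrite torsionT inE.
have -> : x = 1 by apply/permP => -[].
by rewrite expg1n eqxx.
Qed.

(** Torsion elements are sorted by the cycle through [ord0]. Its length d divides m, the points
    following [ord0] can be listed in [n ^_ d.-1] ways, and a torsion element of the remaining
    points is left over. *)
Lemma ntorsionS m n : 0 < m ->
  ntorsion m n.+1 = (\sum_(d <- divisors m) n ^_ d.-1 * ntorsion m (n.+1 - d))%N.
Proof.
move=> m0; rewrite /ntorsion -sum1_card.
pose a : 'I_n.+1 := ord0.
pose X := torsion m [set: 'I_n.+1].
transitivity (\sum_(x in X) \sum_(d <- divisors m) (fingraph.order x a == d)).
  apply: eq_bigr => x /torsionP[_ /(@orbit_order_dvd _ x a) dx].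
  rewrite (bigD1_seq (fingraph.order x a)) ?divisors_uniq -?dvdn_divisors//= eqxx.
  by rewrite big1// => d; rewrite eq_sym => /negbTE->.
rewrite exchange_big /= big_seq [RHS]big_seq; apply: eq_bigr => d.
rewrite -dvdn_divisors// => dm; have d0 : 0 < d by exact: dvdn_gt0 dm.
pose D := [set t : d.-1.-tuple 'I_n.+1 | all (predC1 a) t & uniq t].
have -> : n ^_ d.-1 = #|D|.
  by rewrite card_uniq_tuples cardC1 card_ord.
transitivity (\sum_(x in X) \sum_(t in D) (fingraph.orbit x a == a :: t)).
  apply: eq_bigr => x _.
  have uo := orbit_uniq x a.
  have so := size_orbit x a.
  case: eqP => [od|nod].
    have oE : fingraph.orbit x a = a :: behead (fingraph.orbit x a).
      by rewrite /fingraph.orbit; case: (fingraph.order x a) (fingraph.order_gt0 x a).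
    have sz : size (behead (fingraph.orbit x a)) == d.-1 by rewrite size_behead so od.
    rewrite (bigD1 (Tuple sz)) /=; last first.
      move: uo; rewrite {1}oE inE /= => /andP[h ->]; rewrite andbT.
      by apply/allP => z zo /=; apply: contraNneq h => za; move: zo; rewrite za.
    rewrite -oE eqxx big1 // => t /andP[_ tn].
    apply/eqP; rewrite eqb0; apply: contraNneq tn => e.
    by apply/eqP/val_inj; rewrite /= e.
  rewrite big1// => t _; apply/eqP; rewrite eqb0; apply/eqP => e; apply: nod.
  by rewrite -so e /= size_tuple prednK.
rewrite exchange_big /= -sum_nat_const; apply: eq_bigr => t.
rewrite inE => /andP[ta ut].
rewrite -[RHS](_ : #|[set x in X | fingraph.orbit x a == a :: t]| = _).
  rewrite -sum1_card [RHS]big_mkcond [LHS]big_mkcond; apply: eq_bigr => x _.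
  by rewrite !inE; case: (_ && _) => //=; case: eqP.
have sd : size (a :: t) = d by rewrite /= size_tuple prednK.
rewrite card_torsion_orbit ?sd ?card_ord//.
by rewrite /= ut andbT; apply/negP => /(allP ta) /=; rewrite ?eqxx.
Qed.

End Torsion.

(** * Supports and roots of permutations *)

Section PermSupport.
Local Open Scope group_scope.
Variable T : finType.
Implicit Types (x y z : {perm T}) (O A : {set T}).

Definition supp z : {set T} := [set u | z u != u].

Definition suppcycles z : {set {set T}} := [set porbit z u | u in supp z].

(** The choice depends on the set alone, so that all points of a cycle designate the same
    representative; [supptrans] collects these, one for each nontrivial cycle. *)
Definition cyclerep O : option T := [pick u in O].

Definition supptrans z : {set T} :=
  [set u in supp z | cyclerep (porbit z u) == Some u].

Lemma mem_porbit_eq z u v : v \in porbit z u -> porbit z v = porbit z u.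
Proof. by move=> h; apply/eqP; rewrite eq_porbit_mem. Qed.

Lemma supptrans_inj z u v : u \in supptrans z -> v \in supptrans z ->
  porbit z u = porbit z v -> u = v.
Proof.
rewrite !inE => /andP[_ /eqP hu] /andP[_ /eqP hv] e.
by apply: Some_inj; rewrite -hu -hv e.
Qed.

Lemma supptrans_sub z : supptrans z \subset supp z.
Proof. by apply/subsetP => u; rewrite inE => /andP[]. Qed.

Lemma mem_supp_iter z u k : ((z ^+ k) u \in supp z) = (u \in supp z).
Proof. by rewrite !inE -permM -expgSr expgS permM (inj_eq perm_inj). Qed.

Lemma mem_supp_porbit z u v : v \in porbit z u -> (v \in supp z) = (u \in supp z).
Proof. by case/porbitP => k ->; rewrite mem_supp_iter. Qed.

Lemma supptrans_exists z u : u \in supp z ->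
  exists2 l, l \in supptrans z & l \in porbit z u.
Proof.
move=> uB; have : cyclerep (porbit z u) != None.
  by rewrite /cyclerep; case: pickP => // /(_ u); rewrite porbit_id.
case e : cyclerep => [l|//] _.
have lu : l \in porbit z u by move: e; rewrite /cyclerep; case: pickP => // v vu [<-].
exists l => //.
by rewrite inE (mem_supp_porbit lu) uB (mem_porbit_eq lu) e /=.
Qed.

Lemma card_supptrans z : #|supptrans z| = #|suppcycles z|.
Proof.
rewrite -(card_in_imset (f := porbit z)); last by move=> u v ? ?; exact: supptrans_inj.
apply: eq_card => O; apply/imsetP/imsetP => -[u].
  by move=> /(subsetP (supptrans_sub z)) uB ->; exists u.
by case/supptrans_exists => l lL lu ->; exists l => //; rewrite (mem_porbit_eq lu).
Qed.

(** The transversal and its image under [z] are disjoint subsets of the support. *)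
Lemma card_suppcycles z : (2 * #|suppcycles z| <= #|supp z|)%N.
Proof.
rewrite -card_supptrans -(cardsID (supptrans z) (supp z)).
rewrite (setIidPr (supptrans_sub z)) mul2n -addnn leq_add2l.
rewrite -(card_imset (supptrans z) (@perm_inj _ z)).
apply/subset_leq_card/subsetP => _ /imsetP[l lL ->].
have lB := subsetP (supptrans_sub z) _ lL.
have zl : z l \in porbit z l by have := mem_porbit z 1 l; rewrite expg1.
rewrite inE (mem_supp_porbit zl) lB andbT.
apply/negP => zL; have := supptrans_inj zL lL (mem_porbit_eq zl).
by move: lB; rewrite inE => /eqP.
Qed.

End PermSupport.

Section RootCount.
Local Open Scope group_scope.
Variable T : finType.
Implicit Types (x y z : {perm T}).

Definition nroots m z : nat := #|[set x : {perm T} | x ^+ m == z]|.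

Lemma restr_torsion (U : finType) (S : {set U}) (p : {perm U}) m :
  (forall u, (p u \in S) = (u \in S)) ->
  (forall u, u \in S -> (p ^+ m) u = u) -> restr_perm S p \in torsion m S.
Proof.
move=> pS pm; have pN : p \in 'N(S | 'P) by apply/astabsP => u /=; rewrite apermE.
apply/torsionP; split; first exact: restr_perm_on.
rewrite -morphX//; apply/permP => u; rewrite perm1.
case: (boolP (u \in S)) => uS; last first.
  by apply: (out_perm _ uS); exact: restr_perm_on.
by rewrite restr_permE ?groupX// pm.
Qed.

Lemma restr_perm_val (U : finType) (S : {set U}) (p : {perm U}) u :
  (forall u, (p u \in S) = (u \in S)) -> u \in S -> restr_perm S p u = p u.
Proof.
move=> pS uS; rewrite restr_permE//.
by apply/astabsP => v /=; rewrite apermE.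
Qed.

(** The action on subsets, through which a root of [z] permutes the cycles of [z]. *)
Definition imperm x : {perm {set T}} := perm (imset_inj (@perm_inj _ x)).

Lemma impermE x (O : {set T}) : imperm x O = x @: O.
Proof. by rewrite permE. Qed.

Lemma impermX x k (O : {set T}) : (imperm x ^+ k) O = (x ^+ k) @: O.
Proof.
elim: k => [|k IH]; first by rewrite !expg0 perm1 (eq_imset (g := id)) ?imset_id// => u; rewrite perm1.
rewrite !expgSr permM IH impermE -imset_comp; apply: eq_imset => u /=.
by rewrite permM.
Qed.

(** A root [x] of [z] commutes with [z], hence preserves the support and permutes the nontrivial
    cycles. Off the support, and on the set of cycles, its m-th power is trivial: this gives two
    torsion elements. The third datum is the image of the transversal, a subset of the support. It
    determines [x]: a point of the transversal goes to the only point of that image lying on the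
    image cycle, and commutation with [z] gives the values on the rest of the cycle. *)
Lemma leq_nroots m z :
  (nroots m z <= ntorsion m (#|T| - #|supp z|) *
     (ntorsion m #|suppcycles z| * 2 ^ #|supp z|))%N.
Proof.
set B := supp z; set P := suppcycles z; set L := supptrans z.
pose X := [set x : {perm T} | x ^+ m == z].
have comm x k u : x \in X -> x ((z ^+ k) u) = (z ^+ k) (x u).
  rewrite inE => /eqP <-; rewrite -!permM; congr (fun_of_perm _ u).
  by rewrite -expgM -expgS -expgSr.
have xB x u : x \in X -> (x u \in B) = (u \in B).
  by move=> xX; rewrite !inE -[in LHS](expg1 z) -comm// expg1 (inj_eq perm_inj).
have xO x u : x \in X -> x @: porbit z u = porbit z (x u).
  move=> xX; apply/setP => v; apply/imsetP/porbitP => [[w /porbitP[k ->] ->]|[k ->]].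
    by exists k; rewrite comm.
  by exists ((z ^+ k) u); rewrite ?mem_porbit// comm.
have xP x O : x \in X -> (imperm x O \in P) = (O \in P).
  move=> xX; rewrite impermE; apply/imsetP/imsetP => -[u uB e].
    have hu : x ((x^-1) u) = u by rewrite permKV.
    exists (x^-1 u); first by rewrite -(xB x) ?hu.
    by apply: (imset_inj (@perm_inj _ x)); rewrite xO// hu.
  by exists (x u); rewrite ?xB// e xO.
pose F x := (restr_perm (~: B) x, (restr_perm P (imperm x), x @: L)).
have FX : F @: X \subset setX (torsion m (~: B)) (setX (torsion m P) (powerset B)).
  apply/subsetP => _ /imsetP[x xX ->]; rewrite !in_setX; apply/and3P; split.
  - apply: restr_torsion => u; first by rewrite !in_setC xB.
    rewrite in_setC !inE negbK => /eqP; by move: xX; rewrite inE => /eqP->.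
  - apply: restr_torsion => O; first exact: xP.
    case/imsetP => u uB ->; rewrite impermX.
    move: (xX); rewrite inE => /eqP->.
    apply/setP => v; apply/imsetP/porbitP => [[w /porbitP[k ->] ->]|[k ->]].
      by exists k.+1; rewrite expgSr permM.
    exists ((z ^+ k) ((z^-1) u)); last by rewrite -permM -expgSr expgS permM permKV.
    by have := porbit_perm z 1 (z^-1 u); rewrite expg1 permKV => ->; exact: mem_porbit.
  - rewrite inE; apply/subsetP => _ /imsetP[l /(subsetP (supptrans_sub z)) lB ->].
    by rewrite xB.
have -> : nroots m z = #|F @: X|.
  rewrite card_in_imset// => x y xX yX [e1 e2 e3].
  have xl l : l \in L -> x l = y l.
    move=> lL; have lB := subsetP (supptrans_sub z) _ lL.
    have lP : porbit z l \in P by apply/imsetP; exists l.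
    have : imperm x (porbit z l) = imperm y (porbit z l).
      rewrite -(restr_perm_val (S := P) (p := imperm x)) => [|O|]; rewrite ?xP//.
      by rewrite e2 restr_perm_val// => O; rewrite xP.
    rewrite !impermE => e.
    have : x l \in y @: L by rewrite -e3; apply: imset_f.
    case/imsetP => l' lL' xl.
    have : x l \in y @: porbit z l by rewrite -e; apply: imset_f; exact: porbit_id.
    rewrite xl mem_imset; last exact: perm_inj.
    by move/mem_porbit_eq/(supptrans_inj lL' lL) ->.
  apply/permP => u; case: (boolP (u \in B)) => uB.
    have [l lL lu] := supptrans_exists uB.
    move: lu; rewrite porbit_sym => /porbitP[k ->].
    by rewrite !comm// xl.
  rewrite -(restr_perm_val (S := ~: B) (p := x)) => [|v|]; rewrite ?in_setC ?xB//.
  by rewrite e1 restr_perm_val => [|v|]; rewrite ?in_setC ?xB.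
apply: leq_trans (subset_leq_card FX) _.
by rewrite !cardsX !card_torsion card_powerset cardsCs setCK.
Qed.

End RootCount.

Section SupportCount.
Variable T : finType.
Local Open Scope group_scope.
Implicit Types (z : {perm T}) (B L : {set T}).

(* A permutation is recovered from its values off a transversal L of its
   nontrivial cycles: following the cycle from any point leads back to L. *)
Lemma eq_supptrans z z' : supp z = supp z' -> supptrans z = supptrans z' ->
  {in supp z :\: supptrans z, z =1 z'} -> z = z'.
Proof.
set B := supp z; set L := supptrans z => eB eL eo.
have LB l : l \in L -> l \in B by exact/subsetP/supptrans_sub.
have Bz u : (z u \in B) = (u \in B) by have := mem_supp_iter z u 1; rewrite expg1.
have Bz' u : (z' u \in B) = (u \in B).
  by have := mem_supp_iter z' u 1; rewrite expg1 -eB.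
suff zl l : l \in L -> z l = z' l.
  apply/permP => u; case: (boolP (u \in B)) => uB; last first.
    move: (uB) (uB); rewrite {1}eB !inE !negbK => /eqP-> /eqP->; exact: erefl.
  by case: (boolP (u \in L)) => uL; [exact: zl | apply: eo; rewrite inE uL].
move=> lL; set v := z l.
(* v lies outside the image of B \ L, hence is z' of some point of L *)
have [l' lL' vl'] : exists2 l', l' \in L & v = z' l'.
  have vz : z' (z'^-1 v) = v by rewrite permKV.
  have wB : z'^-1 v \in B by rewrite -Bz' vz Bz LB.
  exists (z'^-1 v); last by rewrite vz.
  apply/negPn/negP => wL.
  have := eo (z'^-1 v); rewrite inE wL wB vz => /(_ isT) /perm_inj e.
  by move: wL; rewrite e lL.
have ex : exists k, (z ^+ k) v \in L.
  exists #[z].-1; rewrite /v -permM -expgS prednK ?order_gt0// expg_order perm1.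
  exact: lL.
have hk := ex_minnP ex; case: hk => k kL kmin.
(* Before time [k] the orbit of [v] avoids [L], where [z] and [z'] agree. Both therefore reach the
   same point of [L], which is [l] according to [z] and [l'] according to [z']. *)
have vzz' j : (j <= k)%N -> (z' ^+ j) v = (z ^+ j) v.
  elim: j => [|j IH] jk; first by rewrite !expg0.
  rewrite !expgSr !permM IH ?(ltnW jk)//; apply/esym/eo.
  rewrite inE mem_supp_iter Bz LB// andbT.
  by apply/negP => /kmin; rewrite leqNgt jk.
have e1 : (z ^+ k) v = l.
  apply: (supptrans_inj kL lL).
  by rewrite /v -permM -expgS porbit_perm.
have e2 : (z ^+ k) v = l'.
  rewrite eL in kL lL'; apply: (supptrans_inj kL lL').
  by rewrite -vzz'// vl' -permM -expgS porbit_perm.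
by rewrite vl' -e2 e1.
Qed.

(** By [eq_supptrans] such a permutation is encoded by an injection of [B] minus [L] into [B]. *)
Lemma card_fixed_supptrans B L :
  (#|[set z : {perm T} | (supp z == B) && (supptrans z == L)]|
   <= #|B| ^_ (#|B| - #|L|))%N.
Proof.
set Z := [set z | _].
have [->|[z0 z0Z]] := set_0Vmem Z; first by rewrite cards0.
have [LB] : L \subset B.
  by move: z0Z; rewrite inE => /andP[/eqP<- /eqP<-]; exact: supptrans_sub.
pose D : finType := {x : T | x \in B :\: L}; pose C : finType := {x : T | x \in B}.
have zB z u : z \in Z -> u \in B :\: L -> z u \in B.
  rewrite !inE => /andP[/eqP<- _] /andP[_ uB].
  by have := mem_supp_iter z u 1; rewrite expg1 uB.
have c0 : z0 \in Z -> D -> C.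
  by move=> h d; exists (z0 (val d)); apply: zB => //; exact: valP.
pose f z : {ffun D -> C} := [ffun d => insubd (c0 z0Z d) (z (val d))].
have fE z d : z \in Z -> val (f z d) = z (val d).
  by move=> zZ; rewrite ffunE val_insubd zB// (valP d).
rewrite -[leqRHS](_ : #|[set g : {ffun D -> C} | injectiveb g]| = _); last first.
  have -> : (#|B| - #|L| = #|D|)%N by rewrite card_sig cardsD (setIidPr LB).
  have -> : #|B| = #|C| by rewrite card_sig; apply: eq_card.
  by rewrite -card_inj_ffuns; apply: eq_card => g; rewrite !inE.
rewrite -(card_in_imset (f := f)).
  apply/subset_leq_card/subsetP => _ /imsetP[z zZ ->]; rewrite inE.
  apply/injectiveP => d d' /(congr1 val); rewrite !fE// => /perm_inj.
  exact: val_inj.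
move=> z z' zZ zZ' e; move: (zZ) (zZ').
rewrite !inE => /andP[/eqP eB /eqP eL] /andP[/eqP eB' /eqP eL'].
apply: eq_supptrans; rewrite ?eB ?eL// => u uD.
have := congr1 (fun g : {ffun D -> C} => val (g (Sub u uD))) e.
by rewrite !fE.
Qed.

(** Choosing the support, the transversal inside it and the values off the transversal gives at most
    ['C(n, b) * 'C(b, N) * b ^_ (b - N)], where n is the cardinal of [T]. This product times [N!] is
    [n ^_ b * 'C(b, N)], and ['C(b, N)] is at most [2 ^ b]. *)
Lemma card_supp_cycles b N :
  (#|[set z : {perm T} | (#|supp z| == b) && (#|suppcycles z| == N)]| * N`!
    <= #|T| ^_ b * 2 ^ b)%N.
Proof.
case: (leqP N b) => Nb; last first.
  rewrite [X in (X * _)%N](_ : _ = 0%N) //; apply/eqP; rewrite cards_eq0.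
  apply/eqP/setP => z; rewrite !inE; apply/negP => /andP[/eqP zb /eqP zN].
  by have := card_suppcycles z; rewrite zb zN; lia.
rewrite -sum1_card.
pose Q := [set q : {set T} * {set T} | [&& #|q.1| == b, q.2 \subset q.1 & #|q.2| == N]].
rewrite (partition_big (fun z => (supp z, supptrans z)) (mem Q)) /=; last first.
  by move=> z; rewrite !inE /= supptrans_sub card_supptrans.
apply: (@leq_trans ((\sum_(q in Q) b ^_ (b - N)) * N`!)).
  rewrite leq_mul2r; apply/orP; right; apply: leq_sum => -[B L].
  rewrite inE /= => /and3P[/eqP Bb LB /eqP LN].
  rewrite sum1dep_card -[in leqRHS]Bb -[in leqRHS]LN.
  apply: leq_trans (card_fixed_supptrans B L); apply/subset_leq_card/subsetP => z.
  by rewrite !inE => /andP[_]; rewrite xpair_eqE.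
rewrite sum_nat_const.
have -> : #|Q| = ('C(#|T|, b) * 'C(b, N))%N.
  rewrite -sum1_card.
  rewrite (partition_big (fun q => q.1) (mem [set B : {set T} | #|B| == b])) /=; last first.
    by move=> q; rewrite !inE => /and3P[].
  rewrite -card_draws -sum_nat_const; apply: eq_bigr => B; rewrite inE => /eqP Bb.
  rewrite -Bb -cards_draws -sum1_card.
  rewrite (reindex_onto (fun L => (B, L)) (fun q => q.2)) /=; last first.
    by move=> [B' L]; rewrite !inE /= => /andP[_ /eqP ->].
  by apply: eq_bigl => L; rewrite !inE /= !eqxx !andbT Bb eqxx.
have -> : ('C(#|T|, b) * 'C(b, N) * b ^_ (b - N) * N`! = #|T| ^_ b * 'C(b, N))%N.
  have := ffact_fact (leq_subr N b); rewrite subKn// => e.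
  by rewrite -mulnA e mulnAC bin_ffact.
rewrite leq_mul2l; apply/orP; right.
rewrite -[b in leqLHS]card_ord -[b in leqRHS]card_ord -card_draws -cardsT -card_powerset.
by apply/subset_leq_card/subsetP => A _; rewrite inE subsetT.
Qed.

End SupportCount.

(** * Tuples of permutations *)

Section BlockAction.
Local Open Scope group_scope.
Variables (T : finType) (A : {set T}).
Implicit Types x y : {perm T}.

Definition stab_set x := [forall u, (x u \in A) == (u \in A)].

Lemma stab_setP x : reflect (forall u, (x u \in A) = (u \in A)) (stab_set x).
Proof. by apply: (iffP forallP) => h u; apply/eqP. Qed.

(** The restriction to [A] with the points renumbered, so that restricted tuples are counted by
    [nhom #|A|]. *)
Definition block_fun x : {ffun 'I_#|A| -> 'I_#|A|} :=
  [ffun i => enum_rank_in (enum_valP i) (x (enum_val i))].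

(* Junk value: the identity when x does not preserve A. *)
Definition block x : {perm 'I_#|A|} := insubd (1 : {perm 'I_#|A|}) (block_fun x).

Lemma blockE x i : stab_set x -> enum_val (block x i) = x (enum_val i).
Proof.
move/stab_setP => xA.
have fE j : enum_val (block_fun x j) = x (enum_val j).
  by rewrite ffunE enum_rankK_in// xA enum_valP.
rewrite -fE /block; congr enum_val.
have inj : injectiveb (block_fun x).
  by apply/injectiveP => j k /(congr1 enum_val); rewrite !fE => /perm_inj /enum_val_inj.
by rewrite -[in LHS]pvalE val_insubd inj.
Qed.

Lemma stab_setM x y : stab_set x -> stab_set y -> stab_set (x * y).
Proof. by move=> /stab_setP hx /stab_setP hy; apply/stab_setP => u; rewrite permM hy. Qed.

Lemma stab_set1 : stab_set 1.
Proof. by apply/stab_setP => u; rewrite perm1. Qed.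

Lemma stab_setX x k : stab_set x -> stab_set (x ^+ k).
Proof. by move=> hx; elim: k => [|k IH]; rewrite ?stab_set1// expgS stab_setM. Qed.

Lemma blockM x y : stab_set x -> stab_set y -> block (x * y) = block x * block y.
Proof.
move=> hx hy; apply/permP => i; apply: enum_val_inj.
by rewrite permM !blockE ?stab_setM// permM.
Qed.

Lemma block1 : block 1 = 1.
Proof. by apply/permP => i; apply: enum_val_inj; rewrite blockE ?stab_set1// !perm1. Qed.

Lemma blockX x k : stab_set x -> block (x ^+ k) = block x ^+ k.
Proof.
by move=> hx; elim: k => [|k IH]; rewrite ?block1// !expgS blockM ?IH// stab_setX.
Qed.

Lemma block_prod s (f : 'I_s -> {perm T}) : (forall j, stab_set (f j)) ->
  stab_set (\prod_(j < s) f j) /\ block (\prod_(j < s) f j) = \prod_(j < s) block (f j).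
Proof.
move=> hf; elim/big_ind2: _ => [|x u y v [hx <-] [hy <-]|j _] //.
- by rewrite block1 stab_set1.
- by rewrite blockM// stab_setM.
Qed.

End BlockAction.

Section HomTuples.
Local Open Scope group_scope.
Variables (s : nat) (e : 'I_s -> nat).

Definition homs (T : finType) : {set {ffun 'I_s -> {perm T}}} :=
  [set x : {ffun 'I_s -> {perm T}} | \prod_(j < s) x j ^+ e j == 1].

Definition nhom n : nat := #|homs 'I_n|.

Definition invar (T : finType) (x : {ffun 'I_s -> {perm T}}) (A : {set T}) :=
  [forall j, stab_set A (x j)].

(** Transitivity is expressed by invariant sets because a proper one splits the tuple into two
    smaller tuples. *)
Definition trans_homs (T : finType) : {set {ffun 'I_s -> {perm T}}} :=
  [set x in homs T | [forall A : {set T}, invar x A ==> (A == set0) || (A == setT)]].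

Definition ntrans n : nat := #|trans_homs 'I_n|.

Definition prod1 (T : finType) : {set {ffun 'I_s -> {perm T}}} :=
  [set z : {ffun 'I_s -> {perm T}} | \prod_(j < s) z j == 1].

Lemma nhomE n : nhom n = (\sum_(z in prod1 'I_n)
   \prod_(j < s) nroots (e j) (z j))%N.
Proof.
rewrite /nhom -sum1_card.
pose F (x : {ffun 'I_s -> {perm 'I_n}}) := [ffun j => x j ^+ e j].
rewrite (partition_big F (mem (prod1 'I_n))) /=; last first.
  by move=> x; rewrite !inE => /eqP h; apply/eqP; rewrite -[RHS]h; apply: eq_bigr => j _; rewrite ffunE.
apply: eq_bigr => z /[!inE] /eqP z1; rewrite sum1dep_card.
transitivity #|family (fun j => mem [set x : {perm 'I_n} | x ^+ e j == z j])|; last first.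
  by rewrite card_family foldrE big_map big_enum; apply: eq_bigr => j _; apply: eq_card.
apply: eq_card => x; rewrite !inE; apply/andP/familyP => [[_ /eqP xz] j|xz].
  by rewrite inE -xz ffunE.
have xzE : F x = z by apply/ffunP => j; rewrite ffunE; apply/eqP; have := xz j; rewrite !inE.
split; last by rewrite xzE.
by apply/eqP; rewrite -[RHS]z1 -xzE; apply: eq_bigr => j _; rewrite ffunE.
Qed.

(** The restrictions to [A] and to its complement satisfy the same relation, and together they
    determine the tuple. *)
Lemma card_homs_block n (A : {set 'I_n}) :
  (#|[set x in homs 'I_n | invar x A]| <= nhom #|A| * nhom (n - #|A|))%N.
Proof.
have -> : (n - #|A| = #|~: A|)%N by rewrite [in RHS]cardsCs setCK card_ord.
pose F (x : {ffun 'I_s -> {perm 'I_n}}) :=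
  ([ffun j => block A (x j)], [ffun j => block (~: A) (x j)]).
have stC y : stab_set A y -> stab_set (~: A) y.
  by move/stab_setP => h; apply/stab_setP => u; rewrite !in_setC h.
rewrite -cardsX -(card_in_imset (f := F)).
  apply/subset_leq_card/subsetP => _ /imsetP[x + ->].
  rewrite !inE => /andP[/eqP x1 /forallP xA]; rewrite /F /=; apply/andP; split.
    have [_] := block_prod (f := fun j => x j ^+ e j) (fun j => stab_setX (e j) (xA j)).
    rewrite x1 block1 => h; apply/eqP; rewrite [RHS]h; apply: eq_bigr => j _.
    by rewrite ffunE blockX.
  have [_] := block_prod (f := fun j => x j ^+ e j) (fun j => stab_setX (e j) (stC _ (xA j))).
  rewrite x1 block1 => h; apply/eqP; rewrite [RHS]h; apply: eq_bigr => j _.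
  by rewrite ffunE blockX// stC.
move=> x y; rewrite !inE => /andP[_ /forallP xA] /andP[_ /forallP yA] [e1 e2].
apply/ffunP => j; apply/permP => u.
have e1j : block A (x j) = block A (y j) by move/ffunP/(_ j): e1; rewrite !ffunE.
have e2j : block (~: A) (x j) = block (~: A) (y j) by move/ffunP/(_ j): e2; rewrite !ffunE.
case: (boolP (u \in A)) => uA.
  by rewrite -(enum_rankK_in uA uA) -!blockE// e1j.
rewrite -in_setC in uA.
by rewrite -(enum_rankK_in uA uA) -!blockE ?stC// e2j.
Qed.

(** A tuple that is not transitive preserves some [A] with [0 < #|A| < n]; a union bound over these
    sets, grouped by size, gives the sum. *)
Lemma leq_nhom_trans n :
  (nhom n <= ntrans n + \sum_(1 <= k < n) 'C(n, k) * (nhom k * nhom (n - k)))%N.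
Proof.
rewrite /nhom -(cardsID (trans_homs 'I_n)) leq_add//.
  by apply/subset_leq_card/subsetP => x; rewrite inE => /andP[].
rewrite -/(nhom n).
have sub : homs 'I_n :\: trans_homs 'I_n \subset
  \bigcup_(A : {set 'I_n} | (A != set0) && (A != setT)) [set x in homs 'I_n | invar x A].
  apply/subsetP => x; rewrite !inE => /andP[+ xh]; rewrite xh /= negb_forall.
  case/existsP => A; rewrite negb_imply negb_or => /andP[xA AT].
  by apply/bigcupP; exists A => //; rewrite inE xA andbT inE.
apply: leq_trans (subset_leq_card sub) _.
apply: (@leq_trans (\sum_(A : {set 'I_n} | (A != set0) && (A != setT))
          nhom #|A| * nhom (n - #|A|))%N).
  elim/big_ind2: _ => [|B1 n1 B2 n2 h1 h2|A _]; first by rewrite cards0.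
    by apply: leq_trans (leq_card_setU _ _) _; exact: leq_add.
  exact: card_homs_block.
pose g k := (nhom k * nhom (n - k))%N.
apply: (@leq_trans (\sum_(A : {set 'I_n} | (A != set0) && (A != setT))
          \sum_(1 <= k < n) (#|A| == k) * g k)%N).
  apply: leq_sum => A /andP[A0 AT].
  rewrite (bigD1_seq #|A|) ?iota_uniq//=; first by rewrite eqxx mul1n leq_addr.
  rewrite mem_index_iota card_gt0 A0 /=.
  by have := proper_card (_ : A \proper setT); rewrite cardsT card_ord => -> //; rewrite properT.
rewrite exchange_big /=; apply: leq_sum => k _.
rewrite -big_distrl /= leq_mul2r -[n in 'C(n, _)]card_ord -card_draws -sum1dep_card; apply/orP; right.
rewrite big_mkcond /= [leqRHS]big_mkcond; apply: leq_sum => A _.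
by case: (_ && _); case: (_ == _).
Qed.

End HomTuples.

From mathcomp Require Import finmap generic_quotient.
From mathcomp Require Import all_classical all_reals all_analysis.

Import numFieldNormedType.Exports.
Local Open Scope classical_set_scope.
Local Open Scope ring_scope.

(** * Subgroups and transitive actions *)

Section SubgroupsAndActions.
Local Open Scope group_scope.
Variables (s : nat) (e : 'I_s -> nat) (n : nat).
Notation G := (Gamma e).
Notation tup := {ffun 'I_s -> {perm 'I_n.+1}}.
Implicit Types (x y : tup) (u v w : word 'I_s) (g h : G) (H : set G).

Definition gen (a : 'I_s * bool) : G := pclass [set relator e] [:: a].

Definition eval_letter x (a : 'I_s * bool) : {perm 'I_n.+1} :=
  if a.2 then x a.1 else (x a.1)^-1.

(** Products of permutations are applied from left to right, so that words act on the right. *)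
Definition eval x w : {perm 'I_n.+1} := \prod_(a <- w) eval_letter x a.

Lemma eval_cat x u v : eval x (u ++ v) = eval x u * eval x v.
Proof. exact: big_cat. Qed.

Lemma eval_relator x : eval x (relator e) = \prod_(j < s) x j ^+ e j.
Proof.
rewrite /relator.
have h : forall r : seq 'I_s, eval x (\big[cat/[::]]_(j <- r) nseq (e j) (j, true))
    = \prod_(j <- r) x j ^+ e j.
  elim=> [|j r IH]; first by rewrite /eval !big_nil.
  rewrite !big_cons eval_cat IH; congr (_ * _).
  by rewrite /eval big_nseq; elim: (e j) => //= k ->; rewrite expgS.
exact: h.
Qed.

Lemma eval_cong x u v : x \in homs e 'I_n.+1 ->
  word_cong [set relator e] u v -> eval x u = eval x v.
Proof.
rewrite finset.inE => /eqP x1; elim=> {u v} [//|u v _ -> //|v u w _ -> _ -> //|||].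
- by move=> u u' v v' _ hu _ hv; rewrite !eval_cat hu hv.
- move=> [j b]; rewrite /eval big_cons big_seq1 big_nil /eval_letter /flip /=.
  by case: b => /=; rewrite ?mulgV ?mulVg.
- by move=> r ->; rewrite eval_relator x1 /eval big_nil.
Qed.

Definition ev x g : {perm 'I_n.+1} := eval x (repr g).

Lemma ev_pclass x w : x \in homs e 'I_n.+1 -> ev x (pclass _ w) = eval x w.
Proof. by move=> hx; apply: eval_cong => //; exact: repr_pclass. Qed.

Lemma evM x g h : x \in homs e 'I_n.+1 -> ev x (g * h) = ev x g * ev x h.
Proof. by move=> hx; rewrite -eval_cat -ev_pclass. Qed.

Lemma ev1 x : x \in homs e 'I_n.+1 -> ev x 1 = 1.
Proof. by move=> hx; rewrite (ev_pclass _ hx) /eval big_nil. Qed.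

Lemma evV x g : x \in homs e 'I_n.+1 -> ev x g^-1 = (ev x g)^-1.
Proof.
by move=> hx; apply/eqP; rewrite eq_sym eq_invg_mul -evM// mulgV ev1.
Qed.

Lemma ev_gen x j : x \in homs e 'I_n.+1 -> ev x (gen (j, true)) = x j.
Proof. by move=> hx; rewrite ev_pclass// /eval big_seq1. Qed.

(** The orbit of [ord0] is invariant and nonempty, hence everything. *)
Lemma trans_homs_ev x : x \in trans_homs e 'I_n.+1 ->
  forall i, exists g, ev x g ord0 = i.
Proof.
rewrite finset.inE => /andP[hx /forallP hA] i.
pose A : {set 'I_n.+1} := [set i | `[< exists g, ev x g ord0 = i >]]%SET.
have /implyP := hA A; rewrite (_ : invar x A); last first.
  apply/forallP => j; apply/stab_setP => k; rewrite !finset.inE.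
  apply/asboolP/asboolP => -[g gk].
    by exists (g * (gen (j, true))^-1); rewrite evM// evV// ev_gen// permM gk permK.
  by exists (g * gen (j, true)); rewrite evM// ev_gen// permM gk.
move=> /(_ isT) /orP[] /eqP h.
  have : ord0 \in A by rewrite finset.inE; apply/asboolP; exists 1; rewrite ev1// perm1.
  by rewrite h finset.inE.
have : i \in A by rewrite h finset.inE.
by rewrite finset.inE => /asboolP.
Qed.

Definition stabilizer x : set G := [set g | ev x g ord0 = ord0].

Lemma stabilizer_index x : x \in trans_homs e 'I_n.+1 ->
  index_subgroups n.+1 (stabilizer x).
Proof.
move=> xt; have xh : x \in homs e 'I_n.+1 by move: xt; rewrite finset.inE => /andP[].
have tr := trans_homs_ev xt; split.
  split; first by rewrite inE /stabilizer /= ev1// perm1.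
  move=> g h; rewrite !inE /stabilizer /= => hg hh.
  by rewrite evM// evV// permM hg -{1}hh permK.
(* Since the action is on the right, the left coset of [g] is recognised by the point to which the
   inverse of [g] sends [ord0]. *)
pose F (i : 'I_n.+1) : set G := [set g | ev x g^-1 ord0 = i].
have -> : lcosets_set (stabilizer x) = F @` [set: 'I_n.+1].
  have cosE g : lcoset_set g (stabilizer x) = F (ev x g^-1 ord0).
    apply/seteqP; split=> h /=.
      case=> k; rewrite /stabilizer /F /= => hk <-.
      by rewrite invMg evM// permM (evV k)// -{1}hk permK.
    rewrite /F /= => hh; exists (g^-1 * h); last by rewrite mulVKg.
    rewrite /stabilizer /= evM// permM -hh -permM -evM// mulVg ev1// perm1//.
  apply/seteqP; split=> C /=.
    by case=> g _ <-; exists (ev x g^-1 ord0); rewrite ?cosE.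
  case=> i _ <-; have [g gi] := tr i; exists g^-1 => //.
  by rewrite cosE invgK gi.
apply: (card_eq_trans (B := [set: 'I_n.+1])).
  apply: inj_card_eq => i j _ _ ij.
  have [g gi] := tr i.
  have : F i g^-1 by rewrite /F /= invgK.
  by rewrite ij /F /= invgK gi.
have -> : `I_n.+1 = (@nat_of_ord n.+1) @` [set: 'I_n.+1].
  by apply/seteqP; split=> [k /= kn|k /= [i _ <-]//]; exists (Ordinal kn).
apply: card_esym; apply: inj_card_eq => i j _ _; exact: ord_inj.
Qed.


Lemma homs_ev_trans x : x \in homs e 'I_n.+1 ->
  (forall i, exists g, ev x g ord0 = i) -> x \in trans_homs e 'I_n.+1.
Proof.
move=> hx tr; rewrite finset.inE hx /=; apply/forallP => A; apply/implyP => /forallP hA.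
have hev w i : (eval x w i \in A) = (i \in A).
  elim: w i => [|[j b] w IH] i; first by rewrite /eval big_nil perm1.
  rewrite /eval big_cons permM IH /eval_letter /=; have /stab_setP h := hA j.
  by case: b => //; rewrite -[in RHS](permKV (x j) i) h.
case: (finset.set_0Vmem A) => [->|[i iA]]; first by rewrite eqxx.
apply/orP; right; apply/eqP/finset.setP => k; rewrite finset.inE.
have [g gi] := tr i; have [h hk] := tr k.
by rewrite -hk /ev hev -(hev (repr g)) -/(ev x g) gi.
Qed.

Definition conjtup x (t : {perm 'I_n.+1}) : tup := [ffun j => x j ^ t].

Lemma eval_conjtup x t w : eval (conjtup x t) w = eval x w ^ t.
Proof.
elim: w => [|[j b] w IH]; first by rewrite /eval !big_nil conj1g.
rewrite /eval !big_cons -!/(eval _ w) IH conjMg; congr (_ * _).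
by rewrite /eval_letter /= ffunE; case: b => //; rewrite conjVg.
Qed.

Lemma conjtup_homs x t : x \in homs e 'I_n.+1 -> conjtup x t \in homs e 'I_n.+1.
Proof. by rewrite !finset.inE -!eval_relator eval_conjtup => /eqP->; rewrite conj1g. Qed.

(** The tuples with the same stabiliser of [ord0] are the conjugates of [x] by the [n!] permutations
    fixing [ord0]. Transitivity makes these conjugates distinct. *)
Lemma card_stabilizer_fiber x : x \in trans_homs e 'I_n.+1 ->
  #|[set y in trans_homs e 'I_n.+1 | `[< stabilizer y = stabilizer x >]]%SET| = n`!.
Proof.
move=> xt; have xh : x \in homs e 'I_n.+1 by move: xt; rewrite finset.inE => /andP[].
have tr := trans_homs_ev xt.
pose S0 : {set {perm 'I_n.+1}} := [set t : {perm 'I_n.+1} | t ord0 == ord0]%SET.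
have S0P t : (t \in S0) = (t ord0 == ord0) by rewrite finset.in_set.
have <- : #|S0| = n`!.
  transitivity ((#|[set~ (ord0 : 'I_n.+1)]%SET|) `!); last by rewrite finset.cardsC1 card_ord.
  rewrite -card_perm; apply: eq_card => t; rewrite S0P unfold_in.
  apply/eqP/fintype.subsetP => [t0 u|tA]; rewrite ?finset.inE.
    by apply: contraNneq => ->; rewrite t0.
  by apply/eqP/negPn/negP => h; have := tA _ h; rewrite !finset.inE eqxx.
rewrite -[RHS](card_in_imset (f := conjtup x)); last first.
  move=> t r; rewrite !S0P => /eqP t0 /eqP r0 tr_eq.
  apply/permP => i; have [g <-] := tr i.
  have := congr1 (fun z => eval z (repr g) ord0) tr_eq.
  rewrite !eval_conjtup -{1}t0 -{2}r0 !permJ -/(ev x g).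
  exact.
apply: eq_card => y; apply/idP/imsetP; last first.
  case=> t; rewrite S0P => /eqP t0 ->.
  have ch := conjtup_homs t xh.
  have evt g : ev (conjtup x t) g ord0 = t (ev x g ord0).
    by rewrite /ev eval_conjtup -{1}t0 permJ.
  rewrite finset.inE; apply/andP; split.
    apply: homs_ev_trans => // i; have [g gi] := tr (t^-1 i).
    by exists g; rewrite evt gi permKV.
  apply/asboolP/seteqP; split=> g; rewrite /stabilizer /= evt -{2}t0.
    by move/perm_inj.
  by move->; rewrite t0.
rewrite finset.inE => /andP[yt /asboolP yx].
have yh : y \in homs e 'I_n.+1 by move: yt; rewrite finset.inE => /andP[].
(* Either equality says that [g * h^-1] lies in the common stabiliser. Hence sending [ev x g ord0]
   to [ev y g ord0] is a well-defined bijection, and this is the conjugating permutation. *)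
have same g h : (ev x g ord0 = ev x h ord0) <-> (ev y g ord0 = ev y h ord0).
  have red z : z \in homs e 'I_n.+1 ->
      (ev z g ord0 = ev z h ord0) <-> stabilizer z (g * h^-1).
    move=> zh; rewrite /stabilizer /= evM// evV// permM; split=> [->|e1].
      by rewrite permK.
    by rewrite -[LHS](permKV (ev z h)) e1.
  by rewrite !red// yx.
pose c i := projT1 (cid (tr i)).
have cE i : ev x (c i) ord0 = i by rewrite /c; case: cid.
have sE g : ev y (c (ev x g ord0)) ord0 = ev y g ord0.
  by apply/same; rewrite cE.
have s_inj : injective (fun i => ev y (c i) ord0).
  by move=> i j /same; rewrite !cE.
pose t := perm s_inj.
have tE g : t (ev x g ord0) = ev y g ord0 by rewrite permE sE.
have t0 : t ord0 = ord0.
  by have := tE 1; rewrite !ev1// !perm1.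
exists t; first by rewrite S0P t0.
apply/ffunP => j; apply/permP => u; rewrite ffunE.
rewrite -[u](permKV t); have [g <-] := tr (t^-1 u).
rewrite permJ tE -(ev_gen j yh) -(ev_gen j xh).
by rewrite -[LHS]permM -evM// -tE evM// permM.
Qed.

(** The group acts on the numbered left cosets of [H], an element [g] acting as left multiplication
    by its inverse, which is a right action as [eval] requires. The stabiliser of the coset [H] is
    [H]. *)
Lemma stabilizer_surj H : index_subgroups n.+1 H ->
  exists2 x, x \in trans_homs e 'I_n.+1 & stabilizer x = H.
Proof.
move=> [[]]; rewrite inE => H1 Hdiv Hcard.
have HV g : H g -> H g^-1.
  by move=> Hg; have := Hdiv 1 g; rewrite !inE div1g; apply.
have HM g h : H g -> H h -> H (g * h).
  by move=> Hg Hh; have := Hdiv g h^-1; rewrite !inE invgK; apply=> //; apply: HV.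
have lcM g h (C : set G) : lcoset_set g (lcoset_set h C) = lcoset_set (g * h) C.
  apply/seteqP; split=> k /=.
    by case=> _ [l lC <-] <-; exists l => //; rewrite mulgA.
  by case=> l lC <-; exists (h * l); rewrite ?mulgA//; exists l.
have lc1 (C : set G) : lcoset_set 1 C = C.
  apply/seteqP; split=> k /=; first by case=> l lC <-; rewrite mul1g.
  by move=> kC; exists k; rewrite ?mul1g.
have /card_set_bijP[f [f_fun f_inj f_surj]] := card_esym Hcard.
have [k0 k0n fk0] : exists2 k, (k < n.+1)%N & f k = H.
  by have [|k kn fk] := f_surj H; [exists 1 => //; rewrite lc1 | exists k].
(* The transposition renumbers the cosets so that [H] itself has number 0. *)
pose c (i : 'I_n.+1) := f (tperm (Ordinal k0n) ord0 i).
have c0 : c ord0 = H by rewrite /c tpermR.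
have c_inj : injective c.
  move=> i j ij; apply: (@perm_inj _ (tperm (Ordinal k0n) ord0)); apply: ord_inj.
  by apply: f_inj ij; rewrite inE /=.
have c_surj g : exists i, c i = lcoset_set g H.
  have [|k kn fk] := f_surj (lcoset_set g H); first by exists g.
  by exists (tperm (Ordinal k0n) ord0 (Ordinal kn)); rewrite /c tpermK.
have cP i : exists g, c i = lcoset_set g H.
  have [g _ gi] : lcosets_set H (c i) by apply: f_fun => /=.
  by exists g.
have ex g i : exists k, c k = lcoset_set g^-1 (c i).
  by have [h ->] := cP i; rewrite lcM.
pose a g i := projT1 (cid (ex g i)).
have aE g i : c (a g i) = lcoset_set g^-1 (c i) by rewrite /a; case: cid.
have aM g h i : a (g * h) i = a h (a g i).
  by apply: c_inj; rewrite !aE lcM invMg.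
have a1 i : a 1 i = i by apply: c_inj; rewrite aE invg1 lc1.
have a_inj g : injective (a g).
  by move=> i j ij; rewrite -(a1 i) -(a1 j) -(mulgV g) !aM ij.
pose pa g := perm (a_inj g).
have paM g h : pa (g * h) = pa g * pa h.
  by apply/permP => i; rewrite permM !permE aM.
have pa1 : pa 1 = 1 by apply/permP => i; rewrite permE perm1 a1.
have paV g : pa g^-1 = (pa g)^-1.
  by apply/eqP; rewrite eq_sym eq_invg_mul -paM mulgV pa1.
pose x : tup := [ffun j => pa (gen (j, true))].
have evx w : eval x w = pa (pclass _ w).
  elim: w => [|[j b] w IH]; first by rewrite /eval big_nil; symmetry; exact: pa1.
  rewrite /eval big_cons -/(eval x w) IH.
  have -> : pclass [set relator e] ((j, b) :: w) = gen (j, b) * pclass _ w.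
    by symmetry; exact: pmulE.
  rewrite paM; congr (_ * _); rewrite /eval_letter /= ffunE.
  case: b => //; rewrite -paV; congr pa; exact: pinvE.
have xh : x \in homs e 'I_n.+1.
  rewrite finset.inE -eval_relator evx.
  have -> : pclass [set relator e] (relator e) = 1.
    by apply/pclassP; exact: word_cong_rel.
  by rewrite pa1.
have evE g : ev x g = pa g by rewrite /ev evx pclass_reprK.
exists x.
  apply: homs_ev_trans => // i; have [g ci] := cP i; exists g^-1.
  by apply: c_inj; rewrite evE permE aE invgK c0 ci.
apply/seteqP; split=> g; rewrite /stabilizer /= evE permE.
  move=> /(congr1 c); rewrite aE c0 => e1.
  have : lcoset_set g^-1 H g^-1 by exists 1; rewrite ?mulg1.
  by rewrite e1 => /HV; rewrite invgK.
move=> Hg; apply: c_inj; rewrite aE c0; apply/seteqP; split=> k /=.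
  by case=> l Hl <-; apply: HM => //; apply: HV.
by move=> Hk; exists (g * k); rewrite ?mulKg//; exact: HM.
Qed.

Lemma ntrans_subgroup_number : ntrans e n.+1 = (n`! * subgroup_number G n.+1)%N.
Proof.
rewrite /subgroup_number; set S := index_subgroups n.+1.
(* Finiteness, without which [fset_set] would return the empty set, holds because every such
   subgroup is the stabiliser of one of finitely many tuples. *)
have finS : finite_set S.
  apply: (@sub_finite_set _ S (stabilizer @` [set: tup])).
    by move=> H /stabilizer_surj[x _ xH]; exists x.
  by apply: finite_image; exact: finite_finset.
rewrite /ntrans -sum1_card.
transitivity (\sum_(x in trans_homs e 'I_n.+1)
   \sum_(H <- fset_set S) (`[< stabilizer x = H >] : nat))%N.
  apply: eq_bigr => x xt.
  rewrite (bigD1_seq (stabilizer x)) ?fset_uniq//=; last first.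
    by rewrite in_fset_set// inE; exact: stabilizer_index.
  rewrite asboolT// big1// => H Hx; apply/eqP; rewrite eqb0.
  by apply/negP => /asboolP h; rewrite h eqxx in Hx.
rewrite exchange_big /= big_seq.
transitivity (\sum_(H <- fset_set S | H \in fset_set S) n`!)%N.
  apply: eq_bigr => H; rewrite in_fset_set// inE => /stabilizer_surj[x xt <-].
  rewrite -(card_stabilizer_fiber xt) -sum1dep_card big_mkcondr; apply: eq_bigr => y _.
  by case: asboolP.
by rewrite -big_seq big_const_seq count_predT iter_addn_0.
Qed.

End SubgroupsAndActions.

(** * Stirling's formula *)

Section LogBounds.
Variable R : realType.
Implicit Types (a b t x : R).

Lemma is_derive_ge0_le (f df : R -> R) a b : a <= b ->
  (forall x, a <= x <= b -> is_derive x 1 f (df x)) ->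
  (forall x, a <= x <= b -> 0 <= df x) -> f a <= f b.
Proof.
move=> ab fdf df0; rewrite -subr_ge0.
have fd x : x \in `]a, b[ -> is_derive x 1 f (df x).
  by rewrite in_itv /= => /andP[ax xb]; apply: fdf; rewrite !ltW.
have fc : {within `[a, b], continuous f}.
  apply: derivable_within_continuous => x /[!in_itv]/= xab.
  by case: (fdf x xab).
have [c] := MVT_segment ab fd fc.
by rewrite in_itv /= => cab ->; rewrite mulr_ge0 ?subr_ge0// df0.
Qed.

Lemma ln_le_subr1 x : 0 < x -> ln x <= x - 1.
Proof.
by move=> x0; rewrite -{1}(subrKC 1 x) le_ln1Dx// ltrBrDr addNr.
Qed.

(** At [t = 1 / n] the middle expression is 2 / n times the one-step decrease
    [(n + 1/2) * ln (1 + 1/n) - 1] of the remainder in Stirling's formula. *)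
Lemma ln1D_bounds t : 0 <= t -> t <= 1 ->
  0 <= (2 + t) * ln (1 + t) - 2 * t <= t ^+ 3 / 2.
Proof.
move=> t0 t1.
have d1 x : 0 <= x <= t -> is_derive x 1 (fun x => (2 + x) * ln (1 + x) - 2 * x)
   (ln (1 + x) - 1 + (1 + x)^-1).
  move=> /andP[x0 xt]; have x1 : 0 < 1 + x by lra.
  have := is_derive1_ln x1 => H1.
  apply: is_derive_eq; rewrite /GRing.scale /=.
  have := divff (lt0r_neq0 x1); set y := (1 + x)^-1 => xy.
  by lra.
have e0 : (2 + 0) * ln (1 + 0) - 2 * 0 = 0 :> R by rewrite !addr0 ln1; lra.
apply/andP; split.
  rewrite -e0.
  apply: (is_derive_ge0_le t0 d1) => x /andP[x0 xt].
  have x1 : 0 < (1 + x)^-1 by rewrite invr_gt0; lra.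
  have := ln_le_subr1 x1; rewrite lnV ?posrE; lra.
rewrite -subr_ge0.
have -> : 0 = 0 ^+ 3 / 2 - ((2 + 0) * ln (1 + 0) - 2 * 0) :> R.
  by rewrite e0; lra.
apply: (@is_derive_ge0_le (fun x => x ^+ 3 / 2 - ((2 + x) * ln (1 + x) - 2 * x))
   (fun x => 3 / 2 * x ^+ 2 - (ln (1 + x) - 1 + (1 + x)^-1)) 0 t t0).
  move=> x xt; have := d1 x xt => H.
  apply: is_derive_eq; rewrite /GRing.scale /=; lra.
move=> x /andP[x0 xt].
have x1 : 0 < 1 + x by lra.
have l1 := ln_le_subr1 x1.
have : (1 + x)^-1 <= 1 - x + x ^+ 2.
  rewrite -[leLHS]mul1r ler_pdivrMr//.
  have : 0 <= x ^+ 3 by rewrite exprn_ge0.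
  lra.
have : 0 <= x ^+ 2 by rewrite exprn_ge0.
lra.
Qed.

(** Used at [x] equal to the inverse square root of n and multiplied by n, whence the second-order
    term: only the cubic error becomes negligible. *)
Lemma lnN1B_bounds x : 0 <= x -> x <= 1 / 2 ->
  0 <= - ln (1 - x) - x - x ^+ 2 / 2 <= x ^+ 3.
Proof.
move=> x0 xh.
have d1 t : 0 <= t <= x -> is_derive t 1 (fun t => - ln (1 - t) - t - t ^+ 2 / 2)
   ((1 - t)^-1 - 1 - t).
  move=> /andP[t0 tx]; have t1 : 0 < 1 - t by lra.
  have := is_derive1_ln t1 => H1.
  apply: is_derive_eq; rewrite /GRing.scale /=; lra.
have inv t : 0 <= t <= x -> 1 + t <= (1 - t)^-1 <= 1 + t + 2 * t ^+ 2.
  move=> /andP[t0 tx].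
  have t1 : 0 < 1 - t by lra.
  have t2 : 0 <= t ^+ 2 by rewrite exprn_ge0.
  have t3 : t ^+ 3 <= t ^+ 2 / 2.
    by rewrite exprSr ler_wpM2l//; lra.
  rewrite -[in X in X && _](mul1r (1 - t)^-1) -[in X in _ && X](mul1r (1 - t)^-1).
  rewrite ler_pdivlMr// ler_pdivrMr//; apply/andP; split; lra.
have e0 : - ln (1 - 0) - 0 - 0 ^+ 2 / 2 = 0 :> R by rewrite !subr0 ln1; lra.
apply/andP; split.
  rewrite -[leLHS]e0.
  apply: (is_derive_ge0_le x0 d1) => t tx.
  have /andP[] := inv _ tx; lra.
rewrite -subr_ge0.
have -> : 0 = 0 ^+ 3 - (- ln (1 - 0) - 0 - 0 ^+ 2 / 2) :> R.
  by rewrite e0; lra.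
apply: (@is_derive_ge0_le (fun x => x ^+ 3 - (- ln (1 - x) - x - x ^+ 2 / 2))
   (fun t => 3 * t ^+ 2 - ((1 - t)^-1 - 1 - t)) 0 x x0).
  move=> t tx; have := d1 t tx => H.
  apply: is_derive_eq; rewrite /GRing.scale /=; lra.
move=> t tx; have /andP[] := inv _ tx.
have : 0 <= t ^+ 2 by case/andP: tx => t0 _; rewrite exprn_ge0.
lra.
Qed.

(** Negative [t] is included because it will be [l / j - 1], where a Poisson value [j] lies on
    either side of the mean [l]. *)
Lemma ln1D_quad t : - (1 / 2) <= t -> t - t ^+ 2 <= ln (1 + t) <= t.
Proof.
move=> th; have t1 : 0 < 1 + t by lra.
apply/andP; split; last by rewrite le_ln1Dx//; lra.
have := @is_derive_ge0_le (fun x => ln (1 + x) - x + x ^+ 2) 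
   (fun x => (1 + x)^-1 - 1 + 2 * x) .
have d1 x : - (1/2) <= x -> is_derive x 1 (fun x => ln (1 + x) - x + x ^+ 2)
   ((1 + x)^-1 - 1 + 2 * x).
  move=> x0; have x1 : 0 < 1 + x by lra.
  have := is_derive1_ln x1 => H1.
  apply: is_derive_eq; rewrite /GRing.scale /=; lra.
have e0 : ln (1 + 0) - 0 + 0 ^+ 2 = 0 :> R by rewrite !addr0 ln1; lra.
have inv x : - (1 / 2) <= x -> (1 + x)^-1 - 1 + 2 * x = x * (1 + 2 * x) / (1 + x).
  move=> x0; have x1 : 0 < 1 + x by lra.
  by have := divff (lt0r_neq0 x1); set y := (1 + x)^-1; nra.
case: (leP 0 t) => t0 H.
  have := H 0 t t0 _ _; rewrite e0 => H1.
  have : 0 <= ln (1 + t) - t + t ^+ 2; last lra.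
  apply: H1 => [x /andP[x0 _]|x /andP[x0 _]]; first by apply: d1; lra.
  rewrite inv; last lra.
  by rewrite divr_ge0// ?mulr_ge0//; lra.
have d2 x : t <= x <= 0 -> is_derive x 1 (fun x => - (ln (1 + x) - x + x ^+ 2))
   (- ((1 + x)^-1 - 1 + 2 * x)).
  move=> /andP[x0 _]; have := d1 x (le_trans th x0) => H1.
  apply: is_derive_eq; lra.
have := is_derive_ge0_le (ltW t0) d2; rewrite e0 => H1.
have : - (ln (1 + t) - t + t ^+ 2) <= - 0; last lra.
apply: H1 => x /andP[x0 x0'].
rewrite inv; last lra.
rewrite -mulNr divr_ge0//; last lra.
rewrite -mulNr mulr_ge0//; lra.
Qed.

End LogBounds.

Section Stirling.
Variable R : realType.

(* An explicit antiderivative of sin ^+ k, so that the Wallis integral is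
   sinX_prim k (pi / 2) - sinX_prim k 0. *)
Fixpoint sinX_prim (k : nat) (x : R) : R :=
  match k with
  | 0 => x
  | 1 => - cos x
  | (k'.+1 as k'').+1 =>
      (k''%:R * sinX_prim k' x - cos x * sin x ^+ k'') / k''.+1%:R
  end.

Lemma is_derive_sinX_prim k (x : R) : is_derive x 1 (sinX_prim k) (sin x ^+ k).
Proof.
suff [] : is_derive x 1 (sinX_prim k) (sin x ^+ k) /\
       is_derive x 1 (sinX_prim k.+1) (sin x ^+ k.+1) by [].
elim: k => [|k [IH1 IH2]].
  split; first by rewrite expr0; exact: is_derive_id.
  by apply: is_derive_eq; rewrite opprK expr1.
split=> //=.
have k2 : k.+2%:R != 0 :> R by rewrite pnatr_eq0.
have -> : (fun t => (k.+1%:R * sinX_prim k t - cos t * sin t ^+ k.+1) / k.+2%:R)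
   = k.+2%:R^-1 *: (k.+1%:R *: sinX_prim k - cos * sin ^+ k.+1).
  by apply/funext => t; rewrite mulrC !fctE.
apply: is_derive_eq; rewrite /GRing.scale /= exprfctE.
apply: (mulfI k2); rewrite mulVKf// -[in RHS]natr1 !exprSr.
have sc : sin x ^+ k * (cos x ^+ 2 + sin x ^+ 2) = sin x ^+ k.
  by rewrite cos2Dsin2 mulr1.
have := congr1 (fun u => k.+1%:R * u) sc.
lra.
Qed.


Definition wallis (k : nat) : R := sinX_prim k (pi / 2) - sinX_prim k 0.

Lemma wallis0 : wallis 0 = pi / 2.
Proof. by rewrite /wallis /= subr0. Qed.

Lemma wallis1 : wallis 1 = 1.
Proof. by rewrite /wallis /= cos_pihalf cos0; lra. Qed.

Lemma wallisSS k : wallis k.+2 = k.+1%:R / k.+2%:R * wallis k.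
Proof.
rewrite /wallis /= cos_pihalf sin0 mul0r expr0n /= mulr0 !subr0.
by rewrite -mulrBl -mulrBr mulrAC.
Qed.

Lemma wallis_nincr k : wallis k.+1 <= wallis k.
Proof.
have pi0 : 0 <= pi / 2 :> R by rewrite divr_ge0// pi_ge0.
rewrite -subr_ge0.
have -> : wallis k - wallis k.+1 =
  (sinX_prim k (pi / 2) - sinX_prim k.+1 (pi / 2))
  - (sinX_prim k 0 - sinX_prim k.+1 0) by rewrite /wallis; lra.
rewrite subr_ge0.
apply: (@is_derive_ge0_le R (fun x => sinX_prim k x - sinX_prim k.+1 x)
  (fun x => sin x ^+ k - sin x ^+ k.+1) _ _ pi0).
  by move=> x _; apply: is_deriveB; exact: is_derive_sinX_prim.
move=> x /andP[x0 xpi].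
have s0 : 0 <= sin x by apply: sin_ge0_pi; rewrite x0/=; have := pi_ge0 R; lra.
by rewrite subr_ge0 exprS ler_piMl ?exprn_ge0 ?sin_le1.
Qed.

(* The central binomial coefficient 'C(2n, n) / 4 ^ n. *)
Definition cbin (n : nat) : R := n.*2`!%:R / (4 ^+ n * n`!%:R ^+ 2).

Lemma cbin_gt0 n : 0 < cbin n.
Proof. by rewrite divr_gt0// ?mulr_gt0// ?exprn_gt0// ltr0n fact_gt0. Qed.

Lemma cbinS n : cbin n.+1 = n.*2.+1%:R / n.*2.+2%:R * cbin n.
Proof.
rewrite /cbin doubleS !factS !natrM exprS.
have n0 : n.+1%:R != 0 :> R by rewrite pnatr_eq0.
have -> : n.*2.+2%:R = 2 * n.+1%:R :> R by rewrite -natrM mul2n.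
have f0 : n`!%:R != 0 :> R by rewrite pnatr_eq0 -lt0n fact_gt0.
have p0 : (4 : R) ^+ n != 0 by rewrite expf_neq0.
rewrite mulf_div; apply/eqP; rewrite eqr_div; last 2 first.
- by rewrite !mulf_neq0 ?expf_neq0 ?mulf_neq0.
- by rewrite !mulf_neq0 ?expf_neq0.
by apply/eqP; lra.
Qed.

Lemma wallis_even n : wallis n.*2 = pi / 2 * cbin n.
Proof.
elim: n => [|n IH]; first by rewrite wallis0 /cbin /= !fact0; lra.
by rewrite doubleS wallisSS IH cbinS mulrCA.
Qed.

Lemma wallis_odd n : wallis n.*2.+1 = (n.*2.+1%:R * cbin n)^-1.
Proof.
elim: n => [|n IH]; first by rewrite wallis1 /cbin /= !fact0 expr0 expr1n mulr1 divr1 mulr1 invr1.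
rewrite doubleS wallisSS IH cbinS.
move: (cbin n) => c; rewrite !invfM invrK.
by move: (n.*2.+1%:R^-1) (n.*2.+3%:R^-1) (n.*2.+2%:R) => u v w; lra.
Qed.

(** Wallis's argument: of the integrals of index 2n, 2n + 1 and 2n + 2, which decrease, the outer
    two are multiples of [cbin n] and the middle one is a multiple of its inverse. *)
Lemma cbin2_bounds n :
  2 / (pi * n.*2.+1%:R) <= cbin n ^+ 2 <= 2 * n.*2.+2%:R / (pi * n.*2.+1%:R ^+ 2).
Proof.
have c0 := cbin_gt0 n; have p0 := pi_gt0 R.
have m0 : 0 < n.*2.+1%:R :> R by rewrite ltr0n.
have h1 := wallis_nincr n.*2.+1; have h2 := wallis_nincr n.*2.
rewrite -doubleS wallis_even cbinS wallis_odd -[leRHS]mul1r in h1.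
rewrite wallis_even wallis_odd -[leLHS]mul1r in h2.
rewrite ler_pdivlMr ?mulr_gt0// in h1; rewrite ler_pdivrMr ?mulr_gt0// in h2.
have m2 : 0 < n.*2.+2%:R :> R by rewrite ltr0n.
move: (n.*2.+1%:R : R) (n.*2.+2%:R : R) (cbin n) m0 m2 c0 h1 h2 => m k c m0 k0 c0 h1 h2.
rewrite ler_pdivrMr ?mulr_gt0// ler_pdivlMr ?mulr_gt0 ?exprn_gt0//.
apply/andP; split; first by lra.
have : pi / 2 * (m * c) * (m * c) <= k.
  rewrite -[leRHS]mul1r -ler_pdivrMr//; apply: le_trans h1.
  by rewrite le_eqVlt; apply/orP; left; apply/eqP; lra.
lra.
Qed.

End Stirling.

Section StirlingLimit.
Variable R : realType.

Definition stirling_rem (n : nat) : R :=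
  ln n`!%:R - (n%:R + 1 / 2) * ln n%:R + n%:R.

Lemma stirling_rem_step n : (0 < n)%N ->
  0 <= stirling_rem n - stirling_rem n.+1
    <= (2 * n%:R)^-1 - (2 * n.+1%:R)^-1.
Proof.
move=> n0; rewrite /stirling_rem factS natrM !invfM.
have N0 : 0 < n%:R :> R by rewrite ltr0n.
have N1 : 1 <= n%:R :> R by rewrite ler1n.
have F0 : 0 < n`!%:R :> R by rewrite ltr0n fact_gt0.
rewrite lnM ?posrE// -(natr1 n).
have t0 : 0 < n%:R^-1 :> R by rewrite invr_gt0.
have t1 : n%:R^-1 <= 1 :> R by rewrite invf_le1.
have -> : n%:R + 1 = n%:R * (1 + n%:R^-1) :> R.
  by rewrite mulrDr divff ?mulr1// gt_eqF.
rewrite lnM ?posrE//.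
have /andP[] := ln1D_bounds (ltW t0) t1.
have := divff (lt0r_neq0 N0).
have s0 : 0 < 1 + n%:R^-1 :> R by rewrite addr_gt0.
have := divff (lt0r_neq0 s0).
have ss0 : 0 < (1 + n%:R^-1)^-1 :> R by rewrite invr_gt0.
rewrite invfM.
move: (n%:R : R) (ln n%:R) (ln n`!%:R) (n%:R^-1) (1 + n%:R^-1)^-1 (ln (1 + n%:R^-1)) N0 N1 t0 t1 s0 ss0.
move=> N l f t s L N0 N1 t0 t1 s0 ss0 st Nt b1 b2.
have Nt' x : N * (t * x) = x by rewrite mulrA Nt mul1r.
have b1' : 0 <= N * ((2 + t) * L - 2 * t) by rewrite mulr_ge0// ltW.
have b2' : N * ((2 + t) * L - 2 * t) <= N * (t ^+ 3 / 2) by rewrite ler_wpM2l// ltW.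
have e0 := Nt' l; have e1 := Nt' L; have e2 := Nt' t; have e3 := Nt' (t ^+ 2).
have s2 : 0 <= s - 1 / 2.
  have : 0 <= (1 - t) * s by rewrite mulr_ge0 ?subr_ge0// ltW.
  lra.
have := mulr_ge0 (sqr_ge0 t) s2.
have := congr1 (fun x => t * x) st.
move=> e4 e5.
apply/andP; split; lra.
Qed.

Lemma stirling_rem_is_cvg : cvgn stirling_rem.
Proof.
suff /cvg_ex[l Hl] : cvgn [sequence stirling_rem n.+1]_n.
  by apply/cvg_ex; exists l; rewrite -cvg_shiftS.
apply: nonincreasing_is_cvgn.
  apply/nonincreasing_seqP => n /=.
  by have /andP[] := stirling_rem_step (ltn0Sn n); rewrite subr_ge0.
(* The upper bound on the decrease telescopes, so that [w] increases; being smaller than the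
   remainder, it bounds it from below by [w 0]. *)
pose w n : R := stirling_rem n.+1 - (2 * n.+1%:R)^-1.
have winc : nondecreasing_seq w.
  apply/nondecreasing_seqP => n; rewrite /w.
  by have /andP[_] := stirling_rem_step (ltn0Sn n); move: (_^-1) (_^-1) => a b; lra.
exists (w 0%N) => _ [n _ <-] /=.
apply: le_trans (winc 0%N n (leq0n n)) _; rewrite /w lerBlDr lerDl.
by rewrite invr_ge0 mulr_ge0.
Qed.

(** In this combination of the remainders at 2n and at n the unknown growth of [n!] is reduced to a
    central binomial coefficient. In the limit U it reads [exp (- 2 U + ln 2) = 1 / pi], which
    identifies U. *)
Lemma expR_stirling_rem n : (0 < n)%N ->
  expR (2 * stirling_rem n.*2 - 4 * stirling_rem n + ln 2) = n%:R * cbin R n ^+ 2.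
Proof.
move=> n0; rewrite -[RHS]lnK; last first.
  by rewrite posrE mulr_gt0 ?ltr0n// exprn_gt0// cbin_gt0.
have N0 : 0 < n%:R :> R by rewrite ltr0n.
have F0 : 0 < n`!%:R :> R by rewrite ltr0n fact_gt0.
have F2 : 0 < n.*2`!%:R :> R by rewrite ltr0n fact_gt0.
have p4 : 0 < (4 : R) ^+ n by rewrite exprn_gt0.
congr expR; rewrite lnM ?posrE ?exprn_gt0 ?cbin_gt0// lnXn ?cbin_gt0//.
rewrite /cbin ln_div ?posrE ?mulr_gt0 ?exprn_gt0// lnM ?posrE ?exprn_gt0//.
rewrite !lnXn// /stirling_rem -muln2 natrM lnM ?posrE//.
have -> : ln 4 = 2 * ln 2 :> R.
  by rewrite (_ : 4 = 2 ^+ 2) ?lnXn//; last lra; rewrite mulr2n; lra.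
rewrite -(mulr_natl _ n); lra.
Qed.

Lemma cvg_natr_cbin2 : n%:R * cbin R n ^+ 2 @[n --> \oo] --> pi^-1.
Proof.
have p0 := pi_gt0 R.
suff H : pi * (n%:R * cbin R n ^+ 2) @[n --> \oo] --> (1 : R).
  have : pi^-1 * (pi * (n%:R * cbin R n ^+ 2)) @[n --> \oo] --> pi^-1 * 1.
    by apply: cvgM => //; exact: cvg_cst.
  by rewrite mulr1; under eq_fun do rewrite mulKf ?gt_eqF//.
have h1 : 1 - harmonic n @[n --> \oo] --> (1 : R).
  rewrite -[X in _ --> X]subr0; apply: cvgB; first exact: cvg_cst.
  exact: cvg_harmonic.
apply: (@squeeze_cvgr _ _ _ _ _ (fun=> 1) _ _ _ h1); last exact: cvg_cst.
near=> n.
have /andP[] := cbin2_bounds R n; rewrite /harmonic /=.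
have m0 : 0 < n.*2.+1%:R :> R by rewrite ltr0n.
have n0 : 0 < n.+1%:R :> R by rewrite ltr0n.
rewrite ler_pdivrMr ?mulr_gt0// ler_pdivlMr ?mulr_gt0 ?exprn_gt0//.
have -> : n.*2.+2%:R = n.*2.+1%:R + 1 :> R by rewrite natr1.
have em : n.*2.+1%:R = 2 * n%:R + 1 :> R by rewrite -natr1 -muln2 natrM mulrC.
rewrite em in m0 *; rewrite -natr1 in n0 *.
have N0 : 0 <= n%:R :> R by [].
move: (n%:R : R) (cbin R n ^+ 2) (sqr_ge0 (cbin R n)) m0 n0 N0 => N c c0 m0 n0 N0.
set p := pi in p0 *.
move=> b1 b2; apply/andP; split.
  have := divff (lt0r_neq0 n0); have : 0 < (N + 1)^-1 by rewrite invr_gt0.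
  set s := (N + 1)^-1 => s0 s1.
  have h : 0 <= N * (c * (p * (2 * N + 1)) - 2) by rewrite mulr_ge0 ?subr_ge0.
  have : 0 <= (p * (N * c) - (1 - s)) * (2 * N + 1); last by rewrite pmulr_lge0 ?subr_ge0.
  have : s * N = 1 - s by lra.
  nra.
have : p * (N * c) * (2 * N + 1) ^+ 2 <= 1 * (2 * N + 1) ^+ 2.
  have : N * (c * (p * (2 * N + 1) ^+ 2)) <= N * (2 * (2 * N + 1 + 1)) by rewrite ler_wpM2l.
  lra.
by rewrite ler_pM2r// exprn_gt0.
Unshelve. all: by end_near. Qed.

Lemma cvg_stirling_rem : stirling_rem @ \oo --> ln (2 * pi) / 2.
Proof.
have /cvg_ex[/= U HU] := stirling_rem_is_cvg.
have p0 := pi_gt0 R.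
have dbl : n.*2 @[n --> \oo] --> \oo.
  move=> A [N _ NA]; exists N => // n /= Nn; apply: NA => /=.
  by rewrite -addnn; exact: leq_trans Nn (leq_addr _ _).
have HU2 : stirling_rem n.*2 @[n --> \oo] --> U by exact: cvg_comp dbl HU.
have H : expR (2 * stirling_rem n.*2 - 4 * stirling_rem n + ln 2) @[n --> \oo]
    --> expR (2 * U - 4 * U + ln 2).
  apply: continuous_cvg; first exact: continuous_expR.
  apply: cvgD; last exact: cvg_cst.
  by apply: cvgB; apply: cvgM => //; exact: cvg_cst.
have H' : expR (2 * stirling_rem n.*2 - 4 * stirling_rem n + ln 2) @[n --> \oo] --> pi^-1.
  apply: cvg_trans cvg_natr_cbin2; apply: near_eq_cvg; near=> n.
  by rewrite /= expR_stirling_rem//; near: n; exact: nbhs_infty_gt.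
have e0 : expR (2 * U - 4 * U + ln 2) = pi^-1.
  exact: (cvg_unique (@norm_hausdorff _ _) H H').
have e := congr1 (@ln R) e0; rewrite expRK lnV ?posrE// in e.
suff -> : ln (2 * pi) / 2 = U by [].
by rewrite lnM ?posrE//; lra.
Unshelve. all: by end_near. Qed.

End StirlingLimit.

(** * Poisson laws *)

Section PoissonLocal.
Variable R : realType.
Implicit Types (x y l eps : R).

Lemma expR_sub1_le y : `|y| <= 1 / 2 -> `|expR y - 1| <= 2 * `|y|.
Proof.
move=> yh.
have y1 : - (1 / 2) <= y <= 1 / 2 by rewrite -ler_norml.
have e1 := expR_ge1Dx y; have e2 := expR_ge1Dx (- y).
have e0 := expR_gt0 y; rewrite expRN in e2.
have e3 : (1 - y) * expR y <= 1.
  by rewrite -[leRHS](mulVf (lt0r_neq0 e0)) ler_pM2r.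
have h : expR y <= 2 by nra.
rewrite ler_norml; case: (ger0P y) => y0; apply/andP; split; nra.
Qed.

Definition pois l (k : nat) : R := expR (- l) * l ^+ k / k`!%:R.

Lemma pois_ge0 l k : 0 <= l -> 0 <= pois l k.
Proof. by move=> l0; rewrite !mulr_ge0 ?expR_ge0 ?exprn_ge0 ?invr_ge0. Qed.

Lemma pois_le1 l k : 0 <= l -> pois l k <= 1.
Proof.
move=> l0; rewrite /pois -mulrA expRN mulrC ler_pdivrMr ?expR_gt0// mul1r.
case: k => [|k]; first by rewrite expr0 fact0 divr1 -expR0 ler_expR.
by apply: le_trans (expR_ge1Dxn k l0); rewrite lerDr.
Qed.

Definition stirling_err (j : nat) : R := stirling_rem R j - ln (2 * pi) / 2.

(** An exact rewriting of [j!] by its Stirling remainder. With [q = l / j] the last term is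
    [- j * (q - 1 - ln q)], which is never positive and penalises the distance from [j] to the
    mean. *)
Lemma pois_stirling l j : 0 < l -> (0 < j)%N ->
  Num.sqrt (2 * pi * l) * pois l j =
  expR (- stirling_err j + ln (l / j%:R) / 2
        - j%:R * ((l / j%:R - 1) - ln (l / j%:R))).
Proof.
move=> l0 j0.
have J0 : 0 < j%:R :> R by rewrite ltr0n.
have F0 : 0 < j`!%:R :> R by rewrite ltr0n fact_gt0.
have p0 := pi_gt0 R.
have p2 : 0 < 2 * pi :> R by rewrite mulr_gt0.
have s0 : 0 < Num.sqrt (2 * pi * l) by rewrite sqrtr_gt0 mulr_gt0.
have pj0 : 0 < pois l j by rewrite /pois !mulr_gt0 ?expR_gt0 ?exprn_gt0 ?invr_gt0.
have x0 : 0 < Num.sqrt (2 * pi * l) * pois l j by rewrite mulr_gt0.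
rewrite -[LHS]lnK ?posrE//; congr expR.
have -> : ln (Num.sqrt (2 * pi * l) * pois l j) = ln (Num.sqrt (2 * pi * l)) + ln (pois l j).
  by rewrite lnM ?posrE.
have pl0 : 0 <= 2 * pi * l by rewrite mulr_ge0// ltW.
rewrite -(powR12_sqrt pl0) ln_powR.
have -> : ln (2 * pi * l) = ln (2 * pi) + ln l by rewrite lnM ?posrE.
have -> : ln (pois l j) = - l + j%:R * ln l - ln j`!%:R.
  rewrite /pois ln_div ?posrE ?mulr_gt0 ?expR_gt0 ?exprn_gt0//.
  by rewrite lnM ?posrE ?expR_gt0 ?exprn_gt0// expRK lnXn// mulr_natl.
rewrite ln_div ?posrE// /stirling_err /stirling_rem.
have e : j%:R * (l / j%:R) = l by rewrite mulrC mulfVK// gt_eqF.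
move: (l / j%:R) e => q e.
rewrite !mulrBr e mulr1; lra.
Qed.

Lemma stirling_err_bounded : exists B : R, forall j, (0 < j)%N -> `|stirling_err j| <= B.
Proof.
have h : cvgn stirling_err.
  apply/cvg_ex; exists (ln (2 * pi) / 2 - ln (2 * pi) / 2).
  apply: cvgB; [exact: cvg_stirling_rem | exact: cvg_cst].
have [M hM] := cvg_has_ub h.
by exists M => j _; apply: hM; exists j.
Qed.

Lemma cvg_stirling_err : stirling_err @ \oo --> (0 : R).
Proof.
rewrite -(subrr (ln (2 * pi) / 2 : R)).
apply: cvgB; [exact: cvg_stirling_rem | exact: cvg_cst].
Qed.

Lemma pois_local_near eps : 0 < eps -> exists eta L : R,
  [/\ 0 < eta, 1 <= L & forall l j, L <= l -> `|j%:R - l| <= eta * Num.sqrt l ->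
    `|Num.sqrt (2 * pi * l) * pois l j - 1| <= eps].
Proof.
(* The whole exponent of [pois_stirling] will be at most [d] in absolute value: [d <= 1 / 2] is the
   range of [expR_sub1_le], and [2 * d <= eps] its outcome. *)
move=> eps0; pose d := Num.min (1 / 2) (eps / 2).
have d0 : 0 < d by rewrite lt_min; apply/andP; split; lra.
have [d1 d2] : d <= 1 / 2 /\ d <= eps / 2 by split; rewrite ge_min lexx ?orbT.
have [N _ hN] : \forall j \near \oo, `|0 - stirling_err j| <= d / 3.
  by apply: (cvgr_dist_le _ _ cvg_stirling_err); lra.
exists (d / 3), (2 * N%:R + 2); split; first by lra.
  by have := ler0n R N; lra.
move=> l j Ll jl.
have N0 : 0 <= N%:R :> R by [].
have l0 : 0 < l by lra.
have s0 : 0 < Num.sqrt l by rewrite sqrtr_gt0.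
have s2 : Num.sqrt l ^+ 2 = l by rewrite sqr_sqrtr// ltW.
have s1 : 1 <= Num.sqrt l by rewrite -[leLHS]sqrtr1 ler_sqrt; lra.
set q := Num.sqrt l in jl s0 s2 s1.
have jb : - (d / 3 * q) <= j%:R - l <= d / 3 * q by rewrite -ler_norml.
have jh : l / 2 <= j%:R by nra.
have J0 : 0 < j%:R :> R by lra.
have j0 : (0 < j)%N by rewrite -(ltr_nat R).
have Nj : (N <= j)%N by rewrite -(ler_nat R); lra.
rewrite pois_stirling//.
set x := (X in expR X).
suff hx : `|x| <= d.
  apply: le_trans (expR_sub1_le (le_trans hx d1)) _; lra.
have := hN j Nj; rewrite sub0r normrN => he.
have e : j%:R * (l / j%:R) = l by rewrite mulrC mulfVK// gt_eqF.
have tE : l / j%:R = 1 + (l / j%:R - 1) by rewrite addrC subrK.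
rewrite /x tE [1 + _ - 1]addrAC subrr add0r.
move: (l / j%:R - 1) tE => t tE.
rewrite tE in e.
have jt : j%:R * t = l - j%:R by lra.
have tb : `|t| <= 2 / 3 * d.
  have : j%:R * `|t| <= d / 3 * q.
    suff -> : j%:R * `|t| = `|j%:R - l| by [].
    by rewrite distrC -jt normrM (ger0_norm (ltW J0)).
  have := normr_ge0 t => t0 h.
  rewrite -(ler_pM2l J0); nra.
have tb' : - (2/3 * d) <= t <= 2/3 * d by rewrite -ler_norml.
have /andP[t1 t2] : t - t ^+ 2 <= ln (1 + t) <= t by apply: ln1D_quad; lra.
have jt2 : j%:R * t ^+ 2 <= d / 6.
  have : j%:R * t * (j%:R * t) <= d ^+ 2 / 9 * l.
    by rewrite jt -s2; nra.
  move=> h; rewrite -(ler_pM2l J0).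
  have : d ^+ 2 / 9 * l <= j%:R * (d / 9) by nra.
  have : 0 <= j%:R * d by rewrite mulr_ge0// ltW.
  lra.
have he' : - (d / 3) <= stirling_err j <= d / 3 by rewrite -ler_norml.
rewrite ler_norml; move: (ln (1 + t)) t1 t2 => y t1 t2.
have : 0 <= j%:R * (t - y) by rewrite mulr_ge0 ?subr_ge0// ltW.
have : j%:R * (t - y) <= j%:R * t ^+ 2 by rewrite ler_pM2l//; lra.
have : t ^+ 2 <= d / 3 by nra.
move=> h1 h2 h3; apply/andP; split; lra.
Qed.

(** Close to the mean this is [pois_local_near]; elsewhere the quadratic term is bounded below and
    pays for crude bounds. Its form is chosen so that averaging the error over [j] requires nothing
    but a variance. *)
Lemma pois_local eps : 0 < eps -> exists C L : R,
  [/\ 0 < C, 1 <= L & forall l j, L <= l ->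
    `|Num.sqrt (2 * pi * l) * pois l j - 1| <= eps + C * ((j%:R - l) ^+ 2 / l)].
Proof.
move=> eps0; have [eta [L [eta0 L1 hL]]] := pois_local_near eps0.
have [B hB] := stirling_err_bounded.
pose C0 : R := 2 * expR B + 1.
have C00 : 0 < C0 by rewrite /C0; have := expR_gt0 B; lra.
(* The first term serves [j >= l / 2] at distance over [eta * Num.sqrt l] from [l], where the
   rescaled probability is at most [2 * expR B]. The second serves [j < l / 2], where the quadratic
   term is at least [l / 4] and the probability is only bounded by 1. *)
pose C : R := C0 / eta ^+ 2 + 4 * (1 + Num.sqrt (2 * pi)).
have p0 := pi_gt0 R.
have sp0 := sqrtr_ge0 (2 * pi : R).
have e20 : 0 < eta ^+ 2 by rewrite exprn_gt0.
have D0 : 0 < C0 / eta ^+ 2 by rewrite divr_gt0.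
exists C, L; split=> // [|l j Ll]; first by rewrite /C; lra.
have l0 : 0 < l by lra.
have s0 : 0 < Num.sqrt l by rewrite sqrtr_gt0.
have s2 : Num.sqrt l ^+ 2 = l by rewrite sqr_sqrtr// ltW.
have Q0 : 0 <= (j%:R - l) ^+ 2 / l by rewrite divr_ge0 ?sqr_ge0// ltW.
have pj0 := pois_ge0 j (ltW l0).
set X := Num.sqrt _ * _.
have X0 : 0 <= X by rewrite mulr_ge0// sqrtr_ge0.
have XB : `|X - 1| <= X + 1.
  by apply: le_trans (ler_normB _ _) _; rewrite normr1 ger0_norm.
have [jl|jl] := leP `|j%:R - l| (eta * Num.sqrt l).
  by apply: le_trans (hL l j Ll jl) _; rewrite lerDl mulr_ge0//; rewrite /C; lra.
have [jh|jh] := leP (l / 2) j%:R; last first.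
  have XC : X <= Num.sqrt (2 * pi) * l.
    apply: (@le_trans _ _ (Num.sqrt (2 * pi * l))).
      by rewrite ler_piMr ?sqrtr_ge0 ?pois_le1// ltW.
    have -> : Num.sqrt (2 * pi * l) = Num.sqrt (2 * pi) * Num.sqrt l.
      by rewrite sqrtrM// mulr_ge0// ltW.
    apply: ler_wpM2l => //.
    have : 1 <= Num.sqrt l by rewrite -[leLHS]sqrtr1 ler_sqrt; lra.
    by nra.
  have Ql : l / 4 <= (j%:R - l) ^+ 2 / l.
    by rewrite ler_pdivlMr//; have := ler0n R j; nra.
  have : (4 * (1 + Num.sqrt (2 * pi))) * (l / 4) <= C * ((j%:R - l) ^+ 2 / l).
    by apply: ler_pM => //; rewrite /C; lra.
  lra.
have J0 : 0 < j%:R :> R by lra.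
have j0 : (0 < j)%N by rewrite -(ltr_nat R).
have XC : X <= 2 * expR B.
  rewrite /X pois_stirling//.
  have q0 : 0 < l / j%:R by rewrite divr_gt0.
  have q2 : l / j%:R <= 2 by rewrite ler_pdivrMr//; lra.
  have := hB j j0; rewrite ler_norml => /andP[b1 b2].
  have lq := ln_le_subr1 q0.
  have h1 : 0 <= j%:R * (l / j%:R - 1 - ln (l / j%:R)) by rewrite mulr_ge0 ?subr_ge0// ltW.
  have h2 : ln (l / j%:R) <= ln 2 by rewrite ler_ln ?posrE.
  have h3 : 0 <= ln 2 :> R by rewrite ln_ge0//; lra.
  have -> : 2 * expR B = expR (ln 2 + B) by rewrite expRD lnK ?posrE.
  rewrite ler_expR; lra.
have Qe : eta ^+ 2 <= (j%:R - l) ^+ 2 / l.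
  rewrite ler_pdivlMr//.
  have : (eta * Num.sqrt l) ^+ 2 <= `|j%:R - l| ^+ 2.
    by rewrite ler_sqr ?nnegrE ?normr_ge0 ?ltW// mulr_gt0.
  by rewrite real_normK ?num_real// exprMn s2.
have h : C0 <= C * ((j%:R - l) ^+ 2 / l).
  rewrite -[leLHS](mulfVK (lt0r_neq0 e20)); apply: ler_pM => //; rewrite /C; lra.
move: h; rewrite /C0; lra.
Qed.

End PoissonLocal.

(** * Sums of nonnegative sequences and convolution of laws *)

Section SumsTo.
Variable R : realType.
Implicit Types (f g : nat -> R) (a b c l : R) (d k n : nat).

Definition sums_to f a := series f @ \oo --> a.

Lemma eq_sums_to f g a : f =1 g -> sums_to f a -> sums_to g a.
Proof. by move=> fg; rewrite (_ : f = g)//; apply/funext. Qed.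

Lemma sums_to_uniq f a b : sums_to f a -> sums_to f b -> a = b.
Proof. by move=> fa fb; exact: (cvg_unique (@norm_hausdorff _ _) fa fb). Qed.

Lemma sums_toD f g a b : sums_to f a -> sums_to g b ->
  sums_to (fun k => f k + g k) (a + b).
Proof.
move=> fa gb; rewrite /sums_to (_ : series _ = fun n => series f n + series g n).
  exact: cvgD.
by apply/funext => n; rewrite /series /= big_split.
Qed.

Lemma sums_toZ c f a : sums_to f a -> sums_to (fun k => c * f k) (c * a).
Proof.
move=> fa; rewrite /sums_to (_ : series _ = fun n => c * series f n).
  by apply: cvgM => //; exact: cvg_cst.
by apply/funext => n; rewrite /series /= big_distrr.
Qed.

Arguments sums_toZ c {f a}.

Lemma sums_toB f g a b : sums_to f a -> sums_to g b ->
  sums_to (fun k => f k - g k) (a - b).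
Proof.
move=> fa gb; have := sums_toD fa (sums_toZ (-1) gb).
by rewrite mulN1r; apply: eq_sums_to => k; rewrite mulN1r.
Qed.

Lemma sums_to0 : sums_to (fun=> 0) 0.
Proof.
rewrite /sums_to (_ : series _ = fun=> 0); first exact: cvg_cst.
by apply/funext => n; rewrite /series /= big1.
Qed.

Lemma sums_to_sum (I : eqType) (s : seq I) (F : I -> nat -> R) (a : I -> R) :
  (forall i, i \in s -> sums_to (F i) (a i)) ->
  sums_to (fun k => \sum_(i <- s) F i k) (\sum_(i <- s) a i).
Proof.
elim: s => [|i s IH] h.
  by rewrite big_nil; apply: eq_sums_to sums_to0 => k; rewrite big_nil.
rewrite big_cons; apply: (@eq_sums_to (fun k => F i k + \sum_(i <- s) F i k)).
  by move=> k; rewrite big_cons.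
apply: sums_toD; first by apply: h; rewrite inE eqxx.
by apply: IH => j js; apply: h; rewrite inE js orbT.
Qed.

Lemma sums_to_norm_le f g a b : (forall k, `|f k| <= g k) ->
  sums_to f a -> sums_to g b -> `|a| <= b.
Proof.
move=> fg fa gb; apply: (ler_cvg_to (cvg_norm fa) gb); apply: nearW => n.
by apply: le_trans (ler_norm_sum _ _ _) _; apply: ler_sum.
Qed.

Lemma sums_to_le f g a b : (forall k, f k <= g k) ->
  sums_to f a -> sums_to g b -> a <= b.
Proof.
by move=> fg fa gb; apply: (ler_cvg_to fa gb); apply: nearW => n; apply: ler_sum.
Qed.

Lemma sums_to_dominated f g b : (forall k, `|f k| <= g k) -> sums_to g b ->
  exists a, sums_to f a.
Proof.
move=> fg gb; apply/cvg_ex; apply: normed_cvg.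
apply: (@series_le_cvg _ _ g) => //; last by apply/cvg_ex; exists b.
- by move=> k; exact: normr_ge0.
- by move=> k; exact: le_trans (normr_ge0 (f k)) (fg k).
Qed.

(** If [f] is the law of X, this is the law of X + d. Below, [dilate d f] is the law of d X, and
    [conv] gives the law of an independent sum. *)
Definition shift d f k : R := if (k < d)%N then 0 else f (k - d)%N.

Lemma sums_to_shift d f a : sums_to f a -> sums_to (shift d f) a.
Proof.
move=> fa; rewrite /sums_to -(cvg_shiftn d).
rewrite (_ : [sequence _]_n = series f)//; apply/funext => n /=.
rewrite /series /= (@big_cat_nat _ _ _ d) ?leq_addl//= big_nat_cond big1 ?add0r; last first.
  by move=> k /andP[/andP[_ kd] _]; rewrite /shift kd.
rewrite -{1}[d]add0n big_addn addnK; apply: eq_bigr => k _.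
by rewrite /shift ltnNge leq_addl addnK.
Qed.

Arguments sums_to_shift d {f a}.

Definition dilate d f k : R := if (d %| k)%N then f (k %/ d)%N else 0.

Lemma sums_to_dilate d f a : (0 < d)%N -> sums_to f a -> sums_to (dilate d f) a.
Proof.
(* The quotient n / d rounded up is the number of multiples of [d] below n. *)
move=> d0 fa; pose c n := ((n + d.-1) %/ d)%N.
have cE n : series (dilate d f) n = series f (c n).
  elim: n => [|n IH].
    by rewrite /c add0n divn_small ?prednK// /series /= !big_geq.
  rewrite /series /= big_nat_recr//= -[X in X + _]/(series (dilate d f) n) IH.
  rewrite /dilate; case: ifPn => dn.
    case/dvdnP: dn => q ->; rewrite mulnK//.
    have -> : c (q * d)%N = q by rewrite /c divnMDl// divn_small ?prednK// addn0.
    have -> : c (q * d).+1 = q.+1.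
      by rewrite /c addSnnS prednK// -mulSnr mulnK.
    by rewrite /series /= big_nat_recr.
  rewrite addr0; congr (series f _); rewrite /c.
  have -> : ((n.+1 + d.-1) %/ d = (n %/ d).+1)%N.
    by rewrite addSnnS prednK// divnDr// divnn d0 addn1.
  rewrite {1}(divn_eq n d) -addnA divnMDl// -addn1; congr addn.
  have r0 : (0 < n %% d)%N by rewrite lt0n.
  have rd := ltn_pmod n d0.
  have -> : (n %% d + d.-1 = d + (n %% d).-1)%N by lia.
  by rewrite divnDl// divnn d0 divn_small//; lia.
rewrite /sums_to (_ : series (dilate d f) = series f \o c); last by apply/funext.
apply: cvg_comp fa => A [N _ NA]; exists (N * d)%N => // n /= Nn; apply: NA => /=.
by rewrite /c leq_divRL//; apply: leq_trans Nn _; exact: leq_addr.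
Qed.

Definition conv f g n : R := \sum_(i < n.+1) f i * g (n - i)%N.

Lemma convC f g n : conv f g n = conv g f n.
Proof.
rewrite /conv (reindex_inj rev_ord_inj) /=; apply: eq_bigr => i _.
by rewrite subSS subKn 1?mulrC// -ltnS.
Qed.

Lemma conv_ge0 f g n : (forall k, 0 <= f k) -> (forall k, 0 <= g k) -> 0 <= conv f g n.
Proof. by move=> f0 g0; apply: sumr_ge0 => i _; rewrite mulr_ge0. Qed.

Lemma series_conv f g n :
  series (conv f g) n = \sum_(i < n) f i * series g (n - i)%N.
Proof.
elim: n => [|n IH]; first by rewrite /series /= big_geq// big_ord0.
rewrite /series /= big_nat_recr//= -[X in X + _]/(series (conv f g) n) IH.
rewrite /conv !big_ord_recr /= subnn subSnn addrA; congr (_ + _); last first.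
  by rewrite /series /= big_nat1.
rewrite -big_split /=; apply: eq_bigr => i _.
by rewrite -mulrDr subSn ?(ltnW (ltn_ord i))// /series /= big_nat_recr.
Qed.

(** The index pairs of total below n contain the square of side n / 2 and are contained in the
    square of side n; the terms being nonnegative, both products of partial sums enclose the sum. *)
Lemma sums_to_conv f g a b : (forall k, 0 <= f k) -> (forall k, 0 <= g k) ->
  sums_to f a -> sums_to g b -> sums_to (conv f g) (a * b).
Proof.
move=> f0 g0 fa gb.
have ser_le (h : nat -> R) m n : (forall k, 0 <= h k) -> (m <= n)%N -> series h m <= series h n.
  move=> h0 mn; rewrite /series /= [leRHS](@big_cat_nat _ _ _ m)//=.
  rewrite lerDl.
  by apply: sumr_ge0.
have half : n./2 @[n --> \oo] --> \oo.
  move=> A [N _ NA]; exists N.*2 => // n /= Nn; apply: NA => /=.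
  by rewrite -(doubleK N) half_leq.
have lo : series f n./2 * series g n./2 @[n --> \oo] --> a * b.
  by apply: cvgM; [exact: (cvg_comp _ _ half fa) | exact: (cvg_comp _ _ half gb)].
have hi : series f n * series g n @[n --> \oo] --> a * b by exact: cvgM.
apply: (squeeze_cvgr _ lo hi); apply: nearW => n; rewrite series_conv; apply/andP; split.
  rewrite [X in X * _]/series /= big_mkord big_distrl /=.
  have h2 : (n./2 <= n)%N by rewrite -{2}(odd_double_half n) -addnn addnA leq_addl.
  rewrite -(big_mkord xpredT (fun i => f i * series g (n - i)%N)) (@big_cat_nat _ _ _ n./2)//=.
  rewrite big_mkord -[leLHS]addr0 lerD//.
    apply: ler_sum => i _; apply: ler_wpM2l => //; apply: ser_le => //.
    have := ltn_ord i; rewrite -{2}(odd_double_half n) -addnn; lia.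
  by apply: sumr_ge0 => i _; rewrite mulr_ge0//; apply: sumr_ge0.
rewrite [X in X * _]/series /= big_mkord big_distrl /=.
apply: ler_sum => i _; apply: ler_wpM2l => //; apply: ser_le => //; exact: leq_subr.
Qed.

Lemma shift_conv d f g : conv (shift d f) g =1 shift d (conv f g).
Proof.
move=> n; rewrite /conv /shift; case: ltnP => nd.
  by rewrite big1// => i _; rewrite (leq_trans (ltn_ord i) nd) mul0r.
rewrite -(big_mkord xpredT (fun i => (if (i < d)%N then 0 else f (i - d)%N) * g (n - i)%N)).
rewrite (@big_cat_nat _ _ _ d) ?(leq_trans nd)//= big_nat_cond big1 ?add0r; last first.
  by move=> k /andP[/andP[_ kd] _]; rewrite kd mul0r.
rewrite -{1}[d]add0n big_addn subSn// big_mkord; apply: eq_bigr => i _.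
by rewrite ltnNge leq_addl addnK -subnDA addnC.
Qed.

Lemma sums_to_pois l : sums_to (pois l) 1.
Proof.
rewrite -(expR0 R) -(addNr l) expRD.
have h : sums_to (fun k => l ^+ k / k`!%:R) (expR l) by exact: is_cvg_series_exp_coeff.
by apply: eq_sums_to (sums_toZ (expR (- l)) h) => k; rewrite mulrA.
Qed.

Arguments sums_to_pois l : clear implicits.

Lemma pois_rec l k : k.+1%:R * pois l k.+1 = l * pois l k.
Proof.
rewrite /pois factS natrM exprS invfM.
have : k.+1%:R != 0 :> R by rewrite pnatr_eq0.
move/divff; move: (k.+1%:R : R) (k.+1%:R^-1) (expR (- l)) (k`!%:R^-1) => u v x y uv.
have := congr1 (fun z => z * (x * (l * l ^+ k) * y)) uv; lra.
Qed.

(* Cauchy-Schwarz applied to p (k - 1) = p k * k / l. *)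
Lemma pois_total_variation l : 0 < l -> exists2 t, 
  sums_to (fun k => `|pois l k - shift 1 (pois l) k|) t & t <= (Num.sqrt l)^-1.
Proof.
move=> l0; have p0 k := pois_ge0 k (ltW l0).
have s0 : 0 < Num.sqrt l by rewrite sqrtr_gt0.
have s2 : Num.sqrt l ^+ 2 = l by rewrite sqr_sqrtr// ltW.
have sh k : shift 1 (pois l) k = pois l k * (k%:R / l).
  case: k => [|k]; first by rewrite /shift /= mul0r mulr0.
  rewrite /shift /= subn1 /= mulrA (mulrC (pois l k.+1)) pois_rec.
  by rewrite mulrAC divff ?mul1r// gt_eqF.
have m1 : sums_to (fun k => k%:R * pois l k) l.
  have := sums_toZ l (sums_to_shift 1 (sums_to_pois l)); rewrite mulr1.
  apply: eq_sums_to => -[|k]; first by rewrite /shift /= mulr0 mul0r.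
  by rewrite pois_rec /shift /= subn1.
have m2 : sums_to (fun k => k%:R ^+ 2 * pois l k) (l * l + l).
  have := sums_toD (sums_toZ l (sums_to_shift 1 m1)) (sums_toZ l (sums_to_shift 1 (sums_to_pois l))).
  rewrite mulr1; apply: eq_sums_to => -[|k]; first by rewrite /shift /= expr0n /= !mulr0 mul0r addr0.
  rewrite expr2 -mulrA pois_rec /shift /= subn1 /= -natr1; lra.
have var : sums_to (fun k => pois l k * (k%:R - l) ^+ 2) l.
  have := sums_toD m2 (sums_toD (sums_toZ (- 2 * l) m1) (sums_toZ (l ^+ 2) (sums_to_pois l))).
  rewrite (_ : l * l + l + _ = l); last by lra.
  by apply: eq_sums_to => k; lra.
(* From [2 u <= 1 + u ^ 2] with [u] equal to [|k - l| / sqrt l]; the two terms have the same sum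
   because the variance is [l]. *)
pose G k := (2 * Num.sqrt l)^-1 * (pois l k + l^-1 * (pois l k * (k%:R - l) ^+ 2)).
have Gs : sums_to G (Num.sqrt l)^-1.
  have := sums_toZ (2 * Num.sqrt l)^-1 (sums_toD (sums_to_pois l) (sums_toZ l^-1 var)).
  rewrite mulVf ?gt_eqF// (_ : _ * (1 + 1) = (Num.sqrt l)^-1)//.
  by rewrite invfM; lra.
have le k : `|pois l k - shift 1 (pois l) k| <= G k.
  rewrite sh -{1}[pois l k]mulr1 -mulrBr normrM (ger0_norm (p0 k)) /G.
  have -> : pois l k + l^-1 * (pois l k * (k%:R - l) ^+ 2) = pois l k * (1 + l^-1 * (k%:R - l) ^+ 2) by lra.
  rewrite mulrCA ler_wpM2l//.
  have -> : 1 - k%:R / l = - (k%:R - l) / l by rewrite opprB mulrBl divff ?gt_eqF.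
  rewrite normrM normrN (gtr0_norm (_ : 0 < l^-1)) ?invr_gt0//.
  rewrite -[(k%:R - l) ^+ 2]real_normK ?num_real//.
  have -> : l^-1 = (Num.sqrt l)^-1 ^+ 2 by rewrite exprVn s2.
  have v0 : 0 < (Num.sqrt l)^-1 by rewrite invr_gt0.
  rewrite invfM; move: (`|_|) (Num.sqrt l)^-1 v0 => u v v0.
  by have := mulr_ge0 (ltW v0) (sqr_ge0 (1 - u * v)); lra.
have [t ht] := sums_to_dominated (f := fun k => `|pois l k - shift 1 (pois l) k|)
  (fun k => etrans (congr1 (fun x => x <= G k) (normr_id _)) (le k)) Gs.
exists t => //; exact: sums_to_le le ht Gs.
Qed.

End SumsTo.

Arguments sums_toZ {R} c {f a}.
Arguments sums_to_shift {R} d {f a}.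
Arguments sums_to_pois {R} l.

(** * The recursion for compound Poisson laws; equidistribution modulo m *)

Section SteinRecursion.
Variable R : realType.
Implicit Types (f g w : nat -> R) (r x : R) (ds : seq nat).

(* The law of a sum of independent d * Poisson(r ^ d / d), d in ds, satisfies
   this recursion; it determines the law up to its value at 0, and gives its
   moments. *)
Definition poisson_rec ds r w :=
  forall k, k%:R * w k = \sum_(d <- ds) r ^+ d * shift d w k.

(** Writing k = i + (k - i) is the product rule for the generating functions, and a shift of one
    factor shifts the convolution. *)
Lemma poisson_rec_conv ds1 ds2 r f g : poisson_rec ds1 r f -> poisson_rec ds2 r g ->
  poisson_rec (ds1 ++ ds2) r (conv f g).
Proof.
move=> hf hg k; rewrite big_cat /=.
transitivity (conv (fun k => k%:R * f k) g k + conv f (fun k => k%:R * g k) k).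
  rewrite /conv -big_split /= big_distrr /=; apply: eq_bigr => i _.
  have ik : (i <= k)%N by rewrite -ltnS.
  have -> : k%:R = i%:R + (k - i)%N%:R :> R by rewrite -natrD subnKC.
  lra.
congr (_ + _).
  under [RHS]eq_bigr do rewrite -shift_conv.
  rewrite /conv /=; under eq_bigr do rewrite hf big_distrl /=.
  rewrite exchange_big /=; apply: eq_bigr => d _.
  by rewrite [RHS]big_distrr /=; apply: eq_bigr => i _; rewrite mulrA.
have sh d : shift d (conv f g) k = conv f (shift d g) k.
  by rewrite convC shift_conv /shift; case: ltnP => // _; rewrite convC.
under [RHS]eq_bigr do rewrite sh.
rewrite /conv /=; under eq_bigr do rewrite hg big_distrr /=.
rewrite exchange_big /=; apply: eq_bigr => d _.
by rewrite [RHS]big_distrr /=; apply: eq_bigr => i _; rewrite mulrCA.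
Qed.

Lemma poisson_rec_uniq ds r f g : all (leq 1) ds -> f 0%N = g 0%N ->
  poisson_rec ds r f -> poisson_rec ds r g -> f =1 g.
Proof.
move=> ds1 fg0 hf hg k; elim/ltn_ind: k => -[|k] IH //.
have k0 : k.+1%:R != 0 :> R by rewrite pnatr_eq0.
apply: (mulfI k0); rewrite hf hg big_seq [RHS]big_seq.
apply: eq_bigr => d /(allP ds1) d1; congr (_ * _); rewrite /shift.
by case: ltnP => // dk; apply: IH; lia.
Qed.

Lemma poisson_rec_perm ds ds' r w : perm_eq ds ds' ->
  poisson_rec ds r w -> poisson_rec ds' r w.
Proof. by move=> p h k; rewrite h; exact: perm_big. Qed.

Lemma poisson_rec_dilate d r : (0 < d)%N -> 
  poisson_rec [:: d] r (dilate d (pois (r ^+ d / d%:R))).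
Proof.
move=> d0 k; rewrite big_seq1 /shift /dilate.
have D0 : d%:R != 0 :> R by rewrite pnatr_eq0 -lt0n.
case: ltnP => kd.
  case: k kd => [|k] kd; first by rewrite mul0r mulr0.
  by rewrite gtnNdvd// !mulr0.
have -> : (d %| k)%N = (d %| k - d)%N by rewrite -{1}(subnK kd) dvdn_addl.
case: ifPn => dk; last by rewrite !mulr0.
case/dvdnP: dk => q e; rewrite e mulnK//.
have -> : k = (q.+1 * d)%N by rewrite mulSn addnC -e subnK.
rewrite mulnK// natrM mulrAC pois_rec.
by rewrite mulrAC divfK.
Qed.

Section Moments.
Variables (ds : seq nat) (r : R) (w : nat -> R).
Hypothesis wrec : poisson_rec ds r w.
Hypothesis w1 : sums_to w 1.

Definition pmean : R := \sum_(d <- ds) r ^+ d.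
Definition pvar : R := \sum_(d <- ds) d%:R * r ^+ d.

Lemma sums_to_mean : sums_to (fun k => k%:R * w k) pmean.
Proof.
apply: (@eq_sums_to _ (fun k => \sum_(d <- ds) r ^+ d * shift d w k)).
  by move=> k; rewrite wrec.
apply: sums_to_sum => d _; rewrite -[X in sums_to _ X]mulr1.
by apply: sums_toZ; exact: sums_to_shift.
Qed.

(** Multiplying the recursion by k and using that a shift by d preserves mass and adds d to the mean
    gives the second moment. *)
Lemma sums_to_var : sums_to (fun k => w k * (k%:R - pmean) ^+ 2) pvar.
Proof.
have m1 := sums_to_mean.
have m2 : sums_to (fun k => k%:R ^+ 2 * w k) (\sum_(d <- ds) r ^+ d * (pmean + d%:R)).
  apply: (@eq_sums_to _ (fun k => \sum_(d <- ds)
      r ^+ d * (shift d (fun k => k%:R * w k) k + d%:R * shift d w k))).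
    move=> k; rewrite expr2 -mulrA wrec big_distrr /=; apply: eq_bigr => d _.
    rewrite mulrCA; congr (_ * _); rewrite /shift; case: ltnP => kd; first by rewrite !mulr0 addr0.
    by rewrite -mulrDl -natrD subnK.
  apply: sums_to_sum => d _; apply: sums_toZ; apply: sums_toD; first exact: sums_to_shift.
  by rewrite -[X in sums_to _ X]mulr1; apply: sums_toZ; exact: sums_to_shift.
have := sums_toD m2 (sums_toD (sums_toZ (- 2 * pmean) m1) (sums_toZ (pmean ^+ 2) w1)).
rewrite (_ : _ + _ = pvar); first by apply: eq_sums_to => k; lra.
rewrite (eq_bigr (fun d => pmean * r ^+ d + d%:R * r ^+ d)); last by move=> d _; lra.
rewrite big_split /= -big_distrr /= -/pmean -/pvar; lra.
Qed.

End Moments.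

Definition residue (m c : nat) w (k : nat) : R := if (k == c %[mod m])%N then w k else 0.

(* If w = pois r * v then w has small total variation, so that it gives
   nearly the same mass to k and to k + 1 mod m. *)
Lemma equidistribution m r v : (0 < m)%N -> 0 < r ->
  (forall k, 0 <= v k) -> sums_to v 1 ->
  forall c, exists2 u, sums_to (residue m c (conv (pois r) v)) u &
    `|u - m%:R^-1| <= m%:R / Num.sqrt r.
Proof.
move=> m0 r0 v0 v1; set w := conv _ _.
have p0 k := pois_ge0 k (ltW r0).
have w0 k : 0 <= w k by exact: conv_ge0.
have w1 : sums_to w 1 by rewrite -(mulr1 1); apply: sums_to_conv => //; exact: sums_to_pois.
have [t tP ht] := pois_total_variation r0.
have TV : sums_to (conv (fun k => `|pois r k - shift 1 (pois r) k|) v) t.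
  by rewrite -(mulr1 t); apply: sums_to_conv.
have hres : forall c, exists u, sums_to (residue m c w) u.
  move=> c.
  apply: (sums_to_dominated _ w1) => k; rewrite /residue.
  by case: ifP => _; rewrite ?normr0// ger0_norm.
pose u c := projT1 (cid (hres c)).
have uP c : sums_to (residue m c w) (u c) by rewrite /u; case: cid.
have step c : `|u c.+1 - u c| <= t.
  have h := sums_toB (uP c.+1) (sums_to_shift 1 (uP c)).
  apply: (sums_to_norm_le _ h TV) => k.
  have -> : shift 1 (residue m c w) k =
      if (k == c.+1 %[mod m])%N then shift 1 w k else 0.
    rewrite /shift /residue; case: ltnP => // k1; first by case: ifP.
    have -> : (k == c.+1 %[mod m])%N = (k - 1 == c %[mod m])%N.
      by rewrite -{1}(subnK k1) -(addn1 c) eqn_modDr.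
    by [].
  rewrite {1}/residue; case: ifP => _; last first.
    rewrite subr0 normr0; apply: conv_ge0 => // j.
  rewrite /w -shift_conv /conv -sumrB.
  apply: le_trans (ler_norm_sum _ _ _) _; apply: ler_sum => i _.
  by rewrite -mulrBl normrM (ger0_norm (v0 _)).
have dist c j : `|u (c + j)%N - u c| <= j%:R * t.
  elim: j => [|j IH]; first by rewrite addn0 subrr normr0 mul0r.
  rewrite addnS -natr1 mulrDl mul1r.
  have -> : u (c + j).+1 - u c = (u (c + j)%N - u c) + (u (c + j).+1 - u (c + j)%N) by lra.
  by apply: le_trans (ler_normD _ _) _; exact: lerD.
(* Each k belongs to exactly one of m consecutive classes, so their average mass is exactly 1 /
   m. *)
have tot c : \sum_(j < m) u (c + j)%N = 1.
  have := sums_to_sum (s := index_enum 'I_m) (F := fun j => residue m (c + j) w) (fun j _ => uP (c + j)%N).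
  move=> h; apply: (sums_to_uniq h); apply: eq_sums_to w1 => k.
  pose j0 := ((k + (m - c %% m)) %% m)%N.
  have j0m : (j0 < m)%N by rewrite ltn_mod.
  have j0P : (k = c + j0 %[mod m])%N.
    rewrite /j0 modnDmr addnA (addnC c) -addnA -modnDmr -(modnDml c).
    by rewrite subnKC ?modnn ?addn0// ltnW// ltn_mod.
  rewrite (bigD1 (Ordinal j0m)) //= big1 ?addr0 => [|j /eqP jn].
    by rewrite /residue j0P eqxx.
  rewrite /residue; case: eqP => // kj; case: jn; apply: val_inj => /=.
  move: kj; rewrite j0P => /eqP; rewrite eqn_modDl !modn_small// => /eqP -> //.
have t0 : 0 <= t by exact: le_trans (normr_ge0 _) (step 0%N).
move=> c; exists (u c) => //.
have M0 : 0 < m%:R :> R by rewrite ltr0n.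
apply: (@le_trans _ _ (m%:R * t)); last by rewrite ler_pM2l.
have -> : u c - m%:R^-1 = m%:R^-1 * \sum_(j < m) (u c - u (c + j)%N).
  by rewrite sumrB tot sumr_const card_ord -(mulr_natl (u c) m) mulrBr mulr1 mulKf ?gt_eqF.
rewrite normrM gtr0_norm ?invr_gt0// mulrC ler_pdivrMr//.
apply: le_trans (ler_norm_sum _ _ _) _.
rewrite (_ : m%:R * t * m%:R = \sum_(j < m) (m%:R * t)); last first.
  by rewrite sumr_const card_ord -[RHS]mulr_natr.
apply: ler_sum => j _; rewrite distrC; apply: le_trans (dist c j) _.
by rewrite ler_wpM2r// ler_nat ltnW.
Qed.

End SteinRecursion.

(** * Torsion numbers as values of a compound Poisson law *)

Section TorsionLocal.
Variable R : realType.
Implicit Types (r : R) (ds : seq nat) (m n k : nat).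

Definition expsum r ds : R := \sum_(d <- ds) r ^+ d / d%:R.

Lemma sums_to_finite (f : nat -> R) n : (forall k, (n < k)%N -> f k = 0) ->
  sums_to f (\sum_(k < n.+1) f k).
Proof.
move=> f0; rewrite /sums_to -(cvg_shiftn n.+1).
rewrite (_ : [sequence _]_n0 = fun=> \sum_(k < n.+1) f k); first exact: cvg_cst.
apply/funext => j /=; rewrite /series /= (@big_cat_nat _ _ _ n.+1) ?leq_addl//= big_mkord.
by rewrite big_nat_cond [X in _ + X]big1 ?addr0// => k /andP[/andP[nk _] _]; exact: f0.
Qed.

(** The value at 0 is recorded because, with the recursion, it determines the law. *)
Lemma poisson_sum_exists ds r : all (leq 1) ds -> 0 < r ->
  exists v : nat -> R, [/\ forall k, 0 <= v k, sums_to v 1, poisson_rec ds r v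
     & v 0%N = expR (- expsum r ds)].
Proof.
move=> + r0; elim: ds => [_|d ds IH /= /andP[d1 /IH[v [v0 v1 vrec v00]]]].
  exists (fun k => (k == 0%N)%:R); split=> //.
  - have := @sums_to_finite (fun k => (k == 0%N)%:R) 0.
    by rewrite big_ord1 eqxx; apply; case.
  - by case=> [|k]; rewrite big_nil ?mul0r// mulr0.
  - by rewrite /expsum big_nil oppr0 expR0.
pose l := r ^+ d / d%:R.
have l0 : 0 <= l by rewrite divr_ge0// exprn_ge0// ltW.
have E0 k : 0 <= dilate d (pois l) k.
  by rewrite /dilate; case: ifP => // _; exact: pois_ge0.
exists (conv (dilate d (pois l)) v); split.
- by move=> k; exact: conv_ge0.
- by rewrite -(mulr1 1); apply: sums_to_conv => //; apply: sums_to_dilate => //; exact: sums_to_pois.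
- by apply: (@poisson_rec_conv _ [:: d] ds) => //; exact: poisson_rec_dilate.
- rewrite /conv big_ord1 /= v00 /dilate dvdn0 div0n /pois expr0 fact0 divr1 mulr1.
  by rewrite -expRD /expsum big_cons opprD.
Qed.

(** The terms of the exponential generating function of the torsion numbers at [r], normalised by
    its value [exp (expsum r (divisors m))]. *)
Definition tilted m r k : R :=
  (ntorsion m k)%:R / k`!%:R * r ^+ k * expR (- expsum r (divisors m)).

(** This is [ntorsionS] divided by factorials: [(k + 1) * k ^_ (d - 1) / (k + 1)!] equals
    [1 / (k + 1 - d)!]. *)
Lemma tilted_rec m r : (0 < m)%N -> poisson_rec (divisors m) r (tilted m r).
Proof.
move=> m0 [|k].
  rewrite mul0r big_seq big1// => d; rewrite -dvdn_divisors// => dm.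
  by rewrite /shift (dvdn_gt0 m0 dm) mulr0.
rewrite /tilted ntorsionS// natr_sum; set E := expR _.
have F1 : k.+1`!%:R != 0 :> R by rewrite pnatr_eq0 -lt0n fact_gt0.
rewrite !mulrA mulr_sumr !mulr_suml; apply: eq_big_seq => d.
rewrite -dvdn_divisors// => dm; have d0 := dvdn_gt0 m0 dm.
rewrite /shift; case: ltnP => kd.
  by rewrite ffact_small ?mul0n ?mulr0 ?mul0r//; lia.
have F2 : (k.+1 - d)`!%:R != 0 :> R by rewrite pnatr_eq0 -lt0n fact_gt0.
rewrite -[in LHS](subnKC kd) exprD (subnKC kd) natrM.
have : (k.+1%:R * (k ^_ d.-1)%:R) / k.+1`!%:R = ((k.+1 - d)`!%:R)^-1 :> R.
  rewrite -[RHS]div1r; apply/eqP; rewrite eqr_div//.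
  have hk : (d.-1 <= k)%N by lia.
  have := ffact_fact hk; rewrite (_ : k - d.-1 = k.+1 - d)%N; last lia.
  by move=> e; rewrite mul1r -!natrM -mulnA e -factS.
move: (k.+1%:R) (k ^_ d.-1)%:R (_^-1) (_^-1) => a b c c' e.
by rewrite -[RHS]mulr1 -e; lra.
Qed.

End TorsionLocal.

Section TorsionLocalEstimate.
Variable R : realType.
Implicit Types (r : R) (ds : seq nat) (m n k : nat).

Definition proper_divisors m := [seq d <- divisors m | (d < m)%N].

Lemma proper_divisors_perm m : (1 < m)%N ->
  perm_eq (divisors m) (proper_divisors m ++ [:: m]).
Proof.
move=> m1; have m0 : (0 < m)%N by lia.
apply: uniq_perm; rewrite ?divisors_uniq//.
  rewrite cat_uniq filter_uniq ?divisors_uniq//= andbT orbF.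
  by rewrite mem_filter ltnn.
move=> d; rewrite mem_cat mem_filter inE -dvdn_divisors//.
case: eqP => [->|/eqP dm]; first by rewrite dvdnn orbT.
rewrite orbF; apply/idP/andP => [h|[]//]; split=> //.
by rewrite ltn_neqAle dm dvdn_leq.
Qed.

(** The divisor 1 is split off because its Poisson variable provides the equidistribution modulo
    m. *)
Lemma proper_divisors_perm1 m : (1 < m)%N -> exists2 ds, all (leq 1) ds &
  perm_eq (proper_divisors m) (1%N :: ds).
Proof.
move=> m1; have m0 : (0 < m)%N by lia.
exists (rem 1%N (proper_divisors m)).
  apply/allP => d /mem_rem; rewrite mem_filter => /andP[_].
  by rewrite -dvdn_divisors// => /(dvdn_gt0 m0).
by apply: perm_to_rem; rewrite mem_filter m1 -dvdn_divisors// dvd1n.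
Qed.

(** When [r ^ m] is about n, only the divisor m / 2 gives a term [r ^ d] as large as sqrt n. *)
Lemma proper_divisorsP m d : (1 < m)%N -> d \in proper_divisors m ->
  (0 < d)%N /\ ((d.*2 == m) || (3 * d <= m)%N).
Proof.
move=> m1; have m0 : (0 < m)%N by exact: ltnW.
rewrite mem_filter -dvdn_divisors// => /andP[dm /dvdnP[q mq]].
have d0 : (0 < d)%N by move: m0; rewrite mq muln_gt0 => /andP[].
split=> //; case: (ltngtP q 2) => q2.
- by move: dm q2; rewrite mq; case: (q) => [|[|q']] //; rewrite ?mul0n ?mul1n ltnn.
- by rewrite mq leq_mul2r q2 orbT orbT.
- by rewrite mq q2 mul2n eqxx.
Qed.

Lemma tilted_conv m r : (1 < m)%N -> 0 < r -> exists v : nat -> R,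
  [/\ forall k, 0 <= v k, sums_to v 1,
      poisson_rec (proper_divisors m) r (conv (pois r) v) &
      tilted m r =1 conv (conv (pois r) v) (dilate m (pois (r ^+ m / m%:R)))].
Proof.
move=> m1 r0; have m0 : (0 < m)%N by lia.
have [ds ds1 dsP] := proper_divisors_perm1 m1.
have [v [v0 v1 vrec v00]] := poisson_sum_exists ds1 r0.
have prec : poisson_rec [:: 1%N] r (pois r).
  have := @poisson_rec_dilate R 1 r (ltn0Sn 0).
  rewrite expr1 divr1 => h k; rewrite -[pois r k](_ : dilate 1 (pois r) k = _); last first.
    by rewrite /dilate dvd1n divn1.
  rewrite h; apply: eq_bigr => d _; congr (_ * _); rewrite /shift.
  by case: ifP => // _; rewrite /dilate dvd1n divn1.
have wrec : poisson_rec (proper_divisors m) r (conv (pois r) v).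
  apply: poisson_rec_perm (poisson_rec_conv prec vrec).
  by rewrite perm_sym.
exists v; split=> //.
apply: (@poisson_rec_uniq _ (divisors m) r).
- by apply/allP => d; rewrite -dvdn_divisors// => /(dvdn_gt0 m0).
- rewrite /tilted ntorsion0 fact0 expr0 divr1 !mul1r.
  rewrite /conv !big_ord1 /= v00 /dilate dvdn0 div0n /pois !expr0 fact0 !divr1 !mulr1.
  rewrite -!expRD /expsum (perm_big _ (proper_divisors_perm m1)) big_cat /=.
  rewrite big_seq1 (perm_big _ dsP) big_cons expr1 divr1 /=; congr expR; lra.
- exact: tilted_rec.
- apply: poisson_rec_perm (poisson_rec_conv wrec (poisson_rec_dilate r m0)).
  by rewrite perm_sym; exact: proper_divisors_perm.
Qed.

(** Conditioning on the contribution k of the proper divisors leaves the event [m * P_m = n - k].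
    For k congruent to n its rescaled probability is 1 up to the quadratic error of [pois_local],
    and that class has mass about 1 / m. Here [D] is the distance from n to the mean; the
    fluctuation of k brings in the variance. *)
Lemma tilted_local m eps : (1 < m)%N -> 0 < eps -> exists C L : R,
  [/\ 0 < C, 1 <= L & forall r n, 0 < r -> L <= r ^+ m ->
    let D := n%:R - r ^+ m - pmean (proper_divisors m) r in
    `|D| <= r ^+ m / 2 ->
    `|Num.sqrt (2 * pi * (r ^+ m / m%:R)) * tilted m r n - m%:R^-1|
      <= eps + C * ((D ^+ 2 + pvar (proper_divisors m) r) / r ^+ m)
         + m%:R / Num.sqrt r].
Proof.
move=> m1 eps0; have m0 : (0 < m)%N by lia.
have [C0 [L0 [C00 L01 hloc]]] := @pois_local R eps eps0.
have M0 : 0 < m%:R :> R by rewrite ltr0n.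
have M1 : 1 <= m%:R :> R by rewrite ler1n.
exists (2 * C0 + 4), (m%:R * L0); split; first by lra.
  by rewrite -[leLHS]mulr1 ler_pM// ltW.
move=> r n r0 rL D Dle.
have [v [v0 v1 wrec btil]] := tilted_conv m1 r0.
set w := conv (pois r) v in wrec btil.
have p0 k := pois_ge0 k (ltW r0).
have w0 k : 0 <= w k by exact: conv_ge0.
have w1 : sums_to w 1 by rewrite -(mulr1 1); apply: sums_to_conv => //; exact: sums_to_pois.
have wvar := sums_to_var wrec w1.
set M := pmean _ r in D Dle wvar *; set V := pvar _ r in wvar *.
have [u uP uB] := equidistribution m0 r0 v0 v1 n.
rewrite -/w in uP.
pose l := r ^+ m / m%:R.
have rm0 : 0 < r ^+ m by rewrite exprn_gt0.
have lL : L0 <= l by rewrite ler_pdivlMr// mulrC.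
have l0 : 0 < l by rewrite divr_gt0.
have rml : r ^+ m = m%:R * l by rewrite mulrC divfK// gt_eqF.
pose q k : R := if (k <= n)%N then Num.sqrt (2 * pi * l) * dilate m (pois l) (n - k) else 0.
have qs : sums_to (fun k => w k * q k) (Num.sqrt (2 * pi * l) * tilted m r n).
  have -> : Num.sqrt (2 * pi * l) * tilted m r n = \sum_(k < n.+1) w k * q k.
    rewrite btil /conv big_distrr /=; apply: eq_bigr => k _.
    by rewrite /q -ltnS ltn_ord mulrCA.
  by apply: sums_to_finite => k nk; rewrite /q leqNgt nk mulr0.
pose C := 2 * C0 + 4.
have K1 : 1 <= r ^+ m by rewrite rml; nra.
have key k : `|q k - (if (k == n %[mod m])%N then 1 else 0)| <=
    eps + C * (D ^+ 2 / r ^+ m) + C / r ^+ m * (k%:R - M) ^+ 2.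
  have h1 : 0 <= C * (D ^+ 2 / r ^+ m).
    by rewrite mulr_ge0 ?divr_ge0 ?sqr_ge0 ?ltW//; rewrite /C; lra.
  have h2 : 0 <= C / r ^+ m * (k%:R - M) ^+ 2.
    by rewrite mulr_ge0 ?divr_ge0 ?sqr_ge0 ?ltW//; rewrite /C; lra.
  (* For [k > n] nothing is left for [P_m]. Then [k - M] exceeds [r ^+ m / 2], since [D] is at least
     [- r ^+ m / 2], and as [C >= 4] the quadratic term alone is at least 1. *)
  rewrite /q; case: leqP => kn; last first.
    apply: (@le_trans _ _ 1).
      by rewrite sub0r normrN; case: ifP => _; rewrite ?normr1 ?normr0.
    have kn' : n%:R + 1 <= k%:R :> R by rewrite natr1 ler_nat.
    have : 4^-1 * r ^+ m <= (k%:R - M) ^+ 2 / r ^+ m.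
      rewrite ler_pdivlMr//.
      have hy : r ^+ m / 2 <= k%:R - M by move: Dle; rewrite ler_norml /D => /andP[d1 d2]; lra.
      have hx : 0 <= r ^+ m / 2 by lra.
      have := ler_pM hx hx hy hy; lra.
    move=> h3; have C4 : 4 <= C by rewrite /C; lra.
    have h4 : C * (4^-1 * r ^+ m) <= C * ((k%:R - M) ^+ 2 / r ^+ m).
      by apply: ler_wpM2l => //; lra.
    have h5 : 4 * (4^-1 * 1) <= C * (4^-1 * r ^+ m).
      by apply: ler_pM => //; lra.
    rewrite mulrAC -mulrA; lra.
  rewrite /dilate (_ : (m %| n - k)%N = (k == n %[mod m])%N); last by rewrite eq_sym eqn_mod_dvd.
  case: ifP => kmod; last by rewrite mulr0 subr0 normr0; lra.
  have : (m %| n - k)%N by rewrite -eqn_mod_dvd// eq_sym.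
  case/dvdnP => j jE; rewrite jE mulnK//.
  apply: le_trans (hloc l j lL) _.
  rewrite -addrA lerD2l.
  (* The deviation of [P_m] splits into the offset of n from the mean and the fluctuation of k. *)
  have jm : m%:R * (j%:R - l) = D + (M - k%:R).
    have : (j * m)%:R = n%:R - k%:R :> R by rewrite -jE natrB.
    rewrite natrM /D rml => e; lra.
  have e1 : (j%:R - l) ^+ 2 / l = (m%:R * (j%:R - l)) ^+ 2 / (m%:R * r ^+ m).
    have m20 : m%:R ^+ 2 != 0 :> R by rewrite expf_neq0// gt_eqF.
    by rewrite rml exprMn mulrA -expr2 -[RHS]mulf_div divff// mul1r.
  rewrite e1 jm.
  have e2 : (D + (M - k%:R)) ^+ 2 <= 2 * (D ^+ 2 + (k%:R - M) ^+ 2).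
    by have := sqr_ge0 (D - (M - k%:R)); lra.
  have e3 : (D + (M - k%:R)) ^+ 2 / (m%:R * r ^+ m) <= 2 * (D ^+ 2 + (k%:R - M) ^+ 2) / r ^+ m.
    apply: ler_pM => //; rewrite ?sqr_ge0 ?invr_ge0 ?mulr_ge0 ?(ltW M0) ?(ltW rm0)//.
    by rewrite lef_pV2 ?posrE ?mulr_gt0// ler_peMl// ltW.
  have := ler_wpM2l (ltW C00) e3.
  have h3 : 0 <= D ^+ 2 / r ^+ m by rewrite divr_ge0 ?sqr_ge0 ?ltW.
  have h4 : 0 <= (k%:R - M) ^+ 2 / r ^+ m by rewrite divr_ge0 ?sqr_ge0 ?ltW.
  rewrite /C; lra.
have diff := sums_toB qs uP.
have bnd := sums_toD (sums_toZ (eps + C * (D ^+ 2 / r ^+ m)) w1) (sums_toZ (C / r ^+ m) wvar).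
have main : `|Num.sqrt (2 * pi * l) * tilted m r n - u| <=
    eps + C * (D ^+ 2 / r ^+ m) + C / r ^+ m * V.
  have := sums_to_norm_le _ diff bnd; rewrite mulr1; apply => k.
  have -> : w k * q k - residue m n w k = w k * (q k - (if (k == n %[mod m])%N then 1 else 0)).
    by rewrite /residue mulrBr; case: ifP; rewrite ?mulr1 ?mulr0.
  rewrite normrM (ger0_norm (w0 k)).
  have := ler_wpM2l (w0 k) (key k); lra.
have -> : Num.sqrt (2 * pi * l) * tilted m r n - m%:R^-1 =
  (Num.sqrt (2 * pi * l) * tilted m r n - u) + (u - m%:R^-1) by lra.
apply: le_trans (ler_normD _ _) _; apply: lerD => //.
apply: le_trans main _; rewrite /C; lra.
Qed.

End TorsionLocalEstimate.

(** * Asymptotics of the number of permutations of order dividing m *)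

Section SaddleLimits.
Variable R : realType.
Implicit Types (a : R) (b : bool) (n : nat).

Lemma near_cvg (f g : nat -> R) (l : R) :
  (\forall n \near \oo, f n = g n) -> f @ \oo --> l -> g @ \oo --> l.
Proof. by move=> fg fl; apply: cvg_trans fl; exact: near_eq_cvg. Qed.

Lemma cvg_sub0 (f : nat -> R) (l : R) :
  f n - l @[n --> \oo] --> (0 : R) -> f @ \oo --> l.
Proof.
move=> h; apply: (near_cvg (f := fun n => f n - l + l)).
  by apply: nearW => n; rewrite subrK.
have : f n - l + l @[n --> \oo] --> 0 + l by apply: cvgD => //; exact: cvg_cst.
by rewrite add0r.
Qed.

Lemma cvg0_le (f g : nat -> R) : (\forall n \near \oo, `|f n| <= g n) ->
  g @ \oo --> (0 : R) -> f @ \oo --> (0 : R).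
Proof.
move=> fg g0; apply/cvgrPdist_le => e e0.
near=> n; rewrite sub0r normrN; apply: (@le_trans _ _ (g n)); first by near: n.
apply: le_trans (ler_norm _) _; rewrite -normrN -sub0r; near: n.
exact: (cvgr_dist_le _ _ g0).
Unshelve. all: by end_near. Qed.

Lemma cvg_powRN (u : nat -> R) a : 0 < a -> u @ \oo --> +oo ->
  (u n `^ (- a)) @[n --> \oo] --> (0 : R).
Proof.
move=> a0 uy; apply/cvgrPdist_le => e e0; near=> n.
have ei : 0 < e^-1 `^ (a^-1) by rewrite powR_gt0// invr_gt0.
have hu : e^-1 `^ (a^-1) <= u n by near: n; move/cvgryPge: uy; exact.
have u0 : 0 < u n by exact: lt_le_trans hu.
rewrite sub0r normrN ger0_norm ?powR_ge0// powRN.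
rewrite -[leRHS]invrK lef_pV2 ?posrE ?invr_gt0 ?powR_gt0//.
have -> : e^-1 = (e^-1 `^ (a^-1)) `^ a by rewrite -powRrM mulVf ?gt_eqF// powRr1// invr_ge0 ltW.
by apply: ge0_ler_powR => //; rewrite ?nnegrE ltW.
Unshelve. all: by end_near. Qed.

(** The value given to [r ^ m], with [b] the parity indicator of m: the subtracted square root makes
    room for the term of the divisor m / 2 in the mean. *)
Definition saddle b n : R := n%:R - b%:R * Num.sqrt n%:R.

Lemma saddle_bounds b n : (4 <= n)%N -> n%:R / 2 <= saddle b n <= n%:R.
Proof.
move=> n4; rewrite /saddle.
have N4 : 4 <= n%:R :> R by rewrite (ler_nat R 4).
have s0 : 0 <= Num.sqrt n%:R :> R by exact: sqrtr_ge0.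
have s2 : Num.sqrt n%:R ^+ 2 = n%:R :> R by rewrite sqr_sqrtr.
have s4 : 2 <= Num.sqrt n%:R :> R by nra.
by case: b => /=; apply/andP; split; nra.
Qed.

Lemma cvgy_saddle b : saddle b @ \oo --> +oo.
Proof.
apply/cvgryPge => A; near=> n.
have n4 : (4 <= n)%N by near: n; exact: nbhs_infty_ge.
have /andP[h _] := saddle_bounds b n4.
apply: le_trans h; rewrite ler_pdivlMr//; near: n.
by move/cvgryPge: (@cvgr_idn R); exact.
Unshelve. all: by end_near. Qed.

Definition isqrt n : R := (Num.sqrt n%:R)^-1.

Lemma isqrtE n : (0 < n)%N -> isqrt n = n%:R `^ (- (2^-1)).
Proof. by move=> n0; rewrite powRN powR12_sqrt. Qed.

Lemma cvg_isqrt : isqrt @ \oo --> (0 : R).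
Proof.
have h := @cvg_powRN _ 2^-1 (_ : 0 < 2^-1) (@cvgr_idn R).
apply: cvg_trans (h _); last by rewrite invr_gt0.
apply: near_eq_cvg; near=> n; rewrite isqrtE//; near: n; exact: nbhs_infty_gt.
Unshelve. all: by end_near. Qed.

Lemma saddleE b n : (0 < n)%N -> saddle b n = n%:R * (1 - b%:R * isqrt n).
Proof.
move=> n0; rewrite /saddle /isqrt mulrBr mulr1 mulrCA; congr (_ - _ * _).
have s0 : Num.sqrt n%:R != 0 :> R by rewrite gt_eqF// sqrtr_gt0 ltr0n.
by rewrite -{2}[n%:R](@sqr_sqrtr R)// expr2 mulfK.
Qed.

Lemma isqrt_bounds n : (4 <= n)%N -> 0 <= isqrt n <= 1 / 2.
Proof.
move=> n4.
have s0 : 0 <= Num.sqrt n%:R :> R by exact: sqrtr_ge0.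
have N4 : 4 <= n%:R :> R by rewrite (ler_nat R 4).
have s2 : Num.sqrt n%:R ^+ 2 = n%:R :> R by rewrite sqr_sqrtr.
have s4 : 2 <= Num.sqrt n%:R :> R by nra.
rewrite /isqrt invr_ge0 s0 /= div1r lef_pV2 ?posrE//; lra.
Qed.

Lemma onem_isqrt b n : (4 <= n)%N -> 1 / 2 <= 1 - b%:R * isqrt n <= 1.
Proof. by move=> /isqrt_bounds /andP[h1 h2]; case: b => /=; apply/andP; split; lra. Qed.

Lemma cvg_ln_saddle b : ln n%:R - ln (saddle b n) @[n --> \oo] --> (0 : R).
Proof.
have h : - ln (1 - b%:R * isqrt n) @[n --> \oo] --> - ln (1 : R).
  apply: cvgN; apply: continuous_cvg; first exact: continuous_ln.
  rewrite -[X in _ --> X]subr0 -(mulr0 b%:R); apply: cvgB; first exact: cvg_cst.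
  by apply: cvgM; [exact: cvg_cst|exact: cvg_isqrt].
rewrite ln1 oppr0 in h; apply: cvg_trans h; apply: near_eq_cvg; near=> n.
have n4 : (4 <= n)%N by near: n; exact: nbhs_infty_ge.
have /andP[h _] := onem_isqrt b n4.
by rewrite saddleE ?(ltn_trans _ n4)// lnM ?posrE ?ltr0n ?(ltn_trans _ n4)//; lra.
Unshelve. all: by end_near. Qed.

(** For [b = 1] and [x = isqrt n] the expression is [n * (- ln (1 - x) - x)], that is
    [n * x ^ 2 / 2] up to [n * x ^ 3], and [n * x ^ 2 = 1]. *)
Lemma cvg_saddle_entropy b :
  n%:R * ln n%:R - n%:R - n%:R * ln (saddle b n) + saddle b n @[n --> \oo]
    --> (b%:R / 2 : R).
Proof.
apply: cvg_sub0; apply: (cvg0_le _ cvg_isqrt); near=> n.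
have n4 : (4 <= n)%N by near: n; exact: nbhs_infty_ge.
have n0 : (0 < n)%N by exact: ltn_trans n4.
have /andP[x0 xh] := isqrt_bounds n4.
have /andP[y0 y1] := onem_isqrt b n4.
rewrite saddleE// lnM ?posrE ?ltr0n//; last lra.
have s0 : Num.sqrt n%:R != 0 :> R by rewrite gt_eqF// sqrtr_gt0 ltr0n.
have nx2 : n%:R * isqrt n ^+ 2 = 1.
  by rewrite /isqrt exprVn sqr_sqrtr// divff// pnatr_eq0 -lt0n.
have /andP[l1 l2] := lnN1B_bounds x0 xh.
case: b y0 y1 => /= y0 y1; last by rewrite mul0r subr0 ln1 [X in `|X|](_ : _ = 0) ?normr0//; lra.
rewrite mul1r.
have e : n%:R * ln n%:R - n%:R - n%:R * (ln n%:R + ln (1 - isqrt n)) + n%:R * (1 - isqrt n) - 1 / 2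
  = n%:R * (- ln (1 - isqrt n) - isqrt n - isqrt n ^+ 2 / 2) :> R by lra.
rewrite e ger0_norm ?mulr_ge0//.
apply: le_trans (ler_wpM2l (ler0n R n) l2) _.
by rewrite exprS mulrCA nx2 mulr1.
Unshelve. all: by end_near. Qed.

Lemma cvg_saddle_powR_small b a : 0 < a -> a < 2^-1 ->
  saddle b n `^ a - n%:R `^ a @[n --> \oo] --> (0 : R).
Proof.
move=> a0 ah.
have h : n%:R `^ (- (2^-1 - a)) @[n --> \oo] --> (0 : R).
  by apply: cvg_powRN (@cvgr_idn R); rewrite subr_gt0.
apply: (cvg0_le _ h); near=> n.
have n4 : (4 <= n)%N by near: n; exact: nbhs_infty_ge.
have n0 : (0 < n)%N by exact: ltn_trans n4.
have /andP[x0 xh] := isqrt_bounds n4.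
have /andP[y0 y1] := onem_isqrt b n4.
set x := 1 - _ in y0 y1.
have x1 : 1 - isqrt n <= x by rewrite /x; case: (b) => /=; lra.
rewrite saddleE// -/x powRM//; last lra.
have h1 : x <= x `^ a by apply: ger1_powR; lra.
have h2 : x `^ a <= 1 by rewrite -[leRHS](powRr0 x); apply: ger_powR; lra.
rewrite -[X in _ - X]mulr1 -mulrBr normrM (ger0_norm (powR_ge0 _ _)).
rewrite opprB powRB; last by rewrite pnatr_eq0 -lt0n n0 implybT.
have -> : n%:R `^ a / n%:R `^ 2^-1 = n%:R `^ a * isqrt n by rewrite isqrtE// powRN.
apply: ler_wpM2l; first exact: powR_ge0.
rewrite ler_norml; apply/andP; split; lra.
Unshelve. all: by end_near. Qed.

(** At exponent 1/2 the passage from n to the saddle point costs a constant, while smaller exponents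
    cost o(1). *)
Lemma cvg_saddle_powR_half b :
  saddle b n `^ 2^-1 - n%:R `^ 2^-1 @[n --> \oo] --> (- (b%:R / 2) : R).
Proof.
apply: cvg_sub0; apply: (cvg0_le _ cvg_isqrt); near=> n.
have n4 : (4 <= n)%N by near: n; exact: nbhs_infty_ge.
have n0 : (0 < n)%N by exact: ltn_trans n4.
have /andP[x0 xh] := isqrt_bounds n4.
have /andP[y0 y1] := onem_isqrt b n4.
case: b y0 y1 => /= y0 y1; last by rewrite /saddle !mul0r subr0 [X in `|X|](_ : _ = 0) ?normr0//; lra.
have -> : saddle true n = n%:R * (1 - isqrt n) by rewrite saddleE// mul1r.
rewrite mul1r in y0 y1; rewrite powRM//; last lra.
rewrite !powR12_sqrt//; last lra.
have s0 : 0 < Num.sqrt n%:R :> R by rewrite sqrtr_gt0 ltr0n.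
have sx : Num.sqrt n%:R * isqrt n = 1 :> R by rewrite divff// gt_eqF.
have t0 : 0 <= Num.sqrt (1 - isqrt n) by exact: sqrtr_ge0.
have t2 : Num.sqrt (1 - isqrt n) ^+ 2 = 1 - isqrt n by rewrite sqr_sqrtr; lra.
move: (isqrt n) (Num.sqrt n%:R) (Num.sqrt (1 - isqrt n)) t0 t2 x0 xh s0 sx {y0 y1}.
move=> x s t t0 t2 x0 xh s0 sx.
rewrite opprK ?div1r.
have t1 : t <= 1.
  rewrite leNgt; apply/negP => t1; have := mulr_gt0 (lt_trans ltr01 t1) (_ : 0 < t - 1); rewrite subr_gt0 => /(_ t1); lra.
have e : s * t - s + 2^-1 = - (s * (1 - t) ^+ 2 / 2).
  have : s * (t ^+ 2) = s * (1 - x) by rewrite t2.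
  lra.
have tx : 1 - t <= x.
  have : 0 <= t * (1 - t) by rewrite mulr_ge0 ?subr_ge0.
  lra.
have h : (1 - t) ^+ 2 <= x ^+ 2 by rewrite ler_sqr ?nnegrE ?subr_ge0.
rewrite e normrN ger0_norm; last by rewrite divr_ge0// mulr_ge0 ?sqr_ge0// ltW.
have := ler_wpM2l (ltW s0) h.
have : s * x ^+ 2 = x by rewrite expr2 mulrA sx mul1r.
lra.
Unshelve. all: by end_near. Qed.

End SaddleLimits.

Section TorsionAsymptotics.
Variable R : realType.

Lemma cvg_sum_seq (I : eqType) (s : seq I) (f : I -> nat -> R) (l : I -> R) :
  (forall i, i \in s -> f i @ \oo --> l i) ->
  (fun n => \sum_(i <- s) f i n) @ \oo --> \sum_(i <- s) l i.
Proof.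
elim: s => [|i s IH] h.
  rewrite big_nil; apply: (@near_cvg R (fun=> 0)); last exact: cvg_cst.
  by apply: nearW => n; rewrite big_nil.
rewrite big_cons; apply: (@near_cvg R (fun n => f i n + \sum_(j <- s) f j n)).
  by apply: nearW => n; rewrite big_cons.
apply: cvgD; first by apply: h; rewrite inE eqxx.
by apply: IH => j js; apply: h; rewrite inE js orbT.
Qed.

Variable m : nat.
Hypothesis m1 : (1 < m)%N.
Let m0 : (0 < m)%N := ltnW m1.
Let b : bool := (2 %| m)%N.
Let y n : R := saddle R b n.
Let r n : R := y n `^ m%:R^-1.
Let M0 : 0 < m%:R :> R. Proof. by rewrite ltr0n. Qed.

Lemma saddle_gt0 n : (4 <= n)%N -> 0 < y n.
Proof.
move=> n4; have /andP[h _] := saddle_bounds R b n4.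
by apply: lt_le_trans h; rewrite divr_gt0// ltr0n (leq_trans _ n4).
Qed.

Lemma saddle_rootX n d : (4 <= n)%N -> r n ^+ d = y n `^ (d%:R / m%:R).
Proof.
move=> n4; rewrite -powR_mulrn ?powR_ge0// /r -powRrM; congr (_ `^ _).
exact: mulrC.
Qed.

Lemma saddle_rootXm n : (4 <= n)%N -> r n ^+ m = y n.
Proof. by move=> n4; rewrite saddle_rootX// divff ?gt_eqF// powRr1// ltW// saddle_gt0. Qed.

Lemma sum_half_divisor (c : R) :
  \sum_(d <- proper_divisors m) (if d.*2 == m then c else 0) = b%:R * c.
Proof.
rewrite /b; case: (boolP (2 %| m)%N) => hm.
  have hd : m./2.*2 = m by rewrite -[RHS]odd_double_half; move: hm; rewrite dvdn2 => /negbTE->.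
  rewrite (bigD1_seq m./2) ?filter_uniq ?divisors_uniq//=; last first.
    rewrite mem_filter -dvdn_divisors//; apply/andP; split; first lia.
    by rewrite -{2}hd -muln2 dvdn_mulr.
  rewrite hd eqxx big1 ?addr0 ?mul1r// => d dm; case: eqP => // e.
  by move: dm; rewrite -e doubleK eqxx.
rewrite mul0r big1// => d; case: eqP => // e.
by move: hm; rewrite -e -muln2 dvdn_mull.
Qed.

Lemma cvg_saddle_neg a : 0 < a -> y n `^ (- a) @[n --> \oo] --> (0 : R).
Proof. by move=> a0; apply: cvg_powRN => //; exact: cvgy_saddle. Qed.

Let half_lt d : (3 * d <= m)%N -> d%:R / m%:R < 2^-1 :> R.
Proof.
move=> dm; rewrite ltr_pdivrMr//.
have : 3 * d%:R <= m%:R :> R by rewrite -natrM ler_nat.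
by have := M0; lra.
Qed.

Let double_half d : d.*2 == m -> d%:R / m%:R = 2^-1 :> R.
Proof.
move=> /eqP e; have d0 : d%:R != 0 :> R.
  by rewrite pnatr_eq0; apply/eqP => d0; move: m0; rewrite -e d0.
by rewrite -e -muln2 natrM invfM mulrA divff// mul1r.
Qed.

(** Only [d = m / 2] survives, contributing -1/2 divided by m / 2. *)
Lemma cvg_saddle_diff :
  \sum_(d <- proper_divisors m) (y n `^ (d%:R / m%:R) - n%:R `^ (d%:R / m%:R)) / d%:R
   @[n --> \oo] --> (- (b%:R / m%:R) : R).
Proof.
rewrite -[X in _ --> X](_ : \sum_(d <- proper_divisors m)
   (if d.*2 == m then - m%:R^-1 else 0) = _); last by rewrite sum_half_divisor mulrN.
rewrite (_ : \sum_(d <- _) _ = \sum_(d <- proper_divisors m)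
   (if d.*2 == m then - (b%:R / 2) / d%:R else 0)); last first.
  apply: eq_bigr => d _; case: eqP => // e.
  have -> : b = true by rewrite /b -e -muln2 dvdn_mull.
  by rewrite -e -muln2 natrM invfM /=; lra.
apply: cvg_sum_seq => d /(proper_divisorsP m1)[d0 dm].
have D0 : 0 < d%:R :> R by rewrite ltr0n.
case: ifP dm => [e _|_ /= dm].
  apply: cvgM; last exact: cvg_cst.
  by rewrite double_half//; exact: cvg_saddle_powR_half.
rewrite -[X in _ --> X](mul0r d%:R^-1); apply: cvgM; last exact: cvg_cst.
by apply: cvg_saddle_powR_small; [rewrite divr_gt0 | exact: half_lt].
Qed.

Let D n : R := n%:R - y n - \sum_(d <- proper_divisors m) y n `^ (d%:R / m%:R).

(** The difference between n and [y n] is [b * sqrt n], which cancels the term of the divisor m / 2;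
    the other proper divisors have exponent below 1/2. *)
Lemma cvg_saddle_dev : D n * y n `^ (- 2^-1) @[n --> \oo] --> (0 : R).
Proof.
have h1 : b%:R - b%:R * ((y n `^ 2^-1 - n%:R `^ 2^-1) * y n `^ (- 2^-1))
   @[n --> \oo] --> (b%:R - b%:R * (- (b%:R / 2) * 0) : R).
  apply: cvgB; first exact: cvg_cst.
  apply: cvgM; first exact: cvg_cst.
  apply: cvgM; first exact: cvg_saddle_powR_half.
  by apply: cvg_saddle_neg; rewrite invr_gt0.
have h2 : \sum_(d <- proper_divisors m) y n `^ (d%:R / m%:R) * y n `^ (- 2^-1)
   @[n --> \oo] --> (\sum_(d <- proper_divisors m) (if d.*2 == m then 1 else 0) : R).
  apply: cvg_sum_seq => d /(proper_divisorsP m1)[d0 dm].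
  case: ifP dm => [e _|_ /= dm].
    apply: (@near_cvg R (fun=> 1)); last exact: cvg_cst.
    near=> n; have n4 : (4 <= n)%N by near: n; exact: nbhs_infty_ge.
    by rewrite double_half// powRN divff// gt_eqF// powR_gt0// saddle_gt0.
  apply: (@near_cvg R (fun n => y n `^ (- (2^-1 - d%:R / m%:R)))); last first.
    by apply: cvg_saddle_neg; rewrite subr_gt0 half_lt.
  near=> n; have n4 : (4 <= n)%N by near: n; exact: nbhs_infty_ge.
  by rewrite opprB powRD// (lt0r_neq0 (saddle_gt0 n4)) implybT.
rewrite sum_half_divisor mulr1 in h2.
pose proof (cvgB h1 h2) as h; rewrite !mulr0 subr0 subrr in h.
apply: near_cvg h; near=> n.
have n4 : (4 <= n)%N by near: n; exact: nbhs_infty_ge.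
have y0 := saddle_gt0 n4.
rewrite /= /D mulrBl big_distrl /=; congr (_ - _).
have yy : y n `^ 2^-1 * y n `^ (- 2^-1) = 1.
  by rewrite powRN divff// gt_eqF// powR_gt0.
have -> : n%:R - y n = b%:R * n%:R `^ 2^-1 by rewrite /y /saddle powR12_sqrt//; lra.
have := congr1 (fun z => b%:R * z) yy; lra.
Unshelve. all: by end_near. Qed.


(** In [tilted_local] at [r ^ m = y n] the offset from the mean is o(sqrt (y n)), the variance is a
    sum of powers of [y n] with exponents below 1, and [r] tends to infinity, so all errors except
    [eps] vanish. *)
Lemma cvg_tilted :
  Num.sqrt (2 * pi * (y n / m%:R)) * tilted m (r n) n @[n --> \oo] --> (m%:R^-1 : R).
Proof.
apply/cvgrPdist_le => e e0.
have [C [L [C0 L1 hloc]]] := tilted_local m1 (divr_gt0 e0 (ltr0n R 2)).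
pose V n := \sum_(d <- proper_divisors m) d%:R * y n `^ (d%:R / m%:R).
have Vlim : V n / y n @[n --> \oo] --> (0 : R).
  apply: (@near_cvg R (fun n => \sum_(d <- proper_divisors m)
      d%:R * y n `^ (- (1 - d%:R / m%:R)))).
    near=> n; have n4 : (4 <= n)%N by near: n; exact: nbhs_infty_ge.
    have y0 := saddle_gt0 n4.
    rewrite /V big_distrl /=; apply: eq_bigr => d _; rewrite -mulrA; congr (_ * _).
    by rewrite opprB powRD ?(lt0r_neq0 y0) ?implybT// powR_inv1// ltW.
  rewrite -[X in _ --> X](_ : \sum_(d <- proper_divisors m) d%:R * 0 = _); last first.
    by rewrite big1// => d _; rewrite mulr0.
  apply: cvg_sum_seq => d; rewrite mem_filter => /andP[dm _].
  apply: cvgM; first exact: cvg_cst.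
  by apply: cvg_saddle_neg; rewrite subr_gt0 ltr_pdivrMr// mul1r ltr_nat.
pose g n := C * ((D n * y n `^ (- 2^-1)) * (D n * y n `^ (- 2^-1)) + V n / y n)
   + m%:R * y n `^ (- (m%:R^-1 / 2)).
have glim : g n @[n --> \oo] --> (C * (0 * 0 + 0) + m%:R * 0 : R).
  apply: cvgD; apply: cvgM; try exact: cvg_cst.
    by apply: cvgD => //; apply: cvgM; exact: cvg_saddle_dev.
  by apply: cvg_saddle_neg; rewrite !divr_gt0// invr_gt0.
rewrite mulr0 addr0 !mulr0 addr0 in glim.
near=> n; have n4 : (4 <= n)%N by near: n; exact: nbhs_infty_ge.
have y0 := saddle_gt0 n4.
have yL : L <= y n by near: n; move/cvgryPge: (@cvgy_saddle R b); exact.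
have r0 : 0 < r n by exact: powR_gt0.
have yh0 : 0 < y n `^ 2^-1 by exact: powR_gt0.
have yh2 : y n `^ 2^-1 ^+ 2 = y n by rewrite -powR_mulrn ?powR_ge0// -powRrM mulVf// powRr1// ltW.
have DE : n%:R - r n ^+ m - pmean (proper_divisors m) (r n) = D n.
  rewrite saddle_rootXm// /pmean /D; congr (_ - _).
  by apply: eq_bigr => d _; rewrite saddle_rootX.
have VE : pvar (proper_divisors m) (r n) = V n.
  by apply: eq_bigr => d _; rewrite saddle_rootX.
have rL : L <= r n ^+ m by rewrite saddle_rootXm.
have h := hloc (r n) n r0 rL; rewrite /= DE VE saddle_rootXm// in h.
rewrite distrC; apply: le_trans (h _) _.
  have d1 : `|D n * y n `^ (- 2^-1)| <= 1 / 2.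
    rewrite -normrN -sub0r; near: n.
    by apply: (cvgr_dist_le _ _ cvg_saddle_dev); rewrite divr_gt0.
  rewrite powRN normrM (gtr0_norm (_ : 0 < (y n `^ 2^-1)^-1)) ?invr_gt0// in d1.
  rewrite ler_pdivrMr// in d1; apply: le_trans d1 _.
  rewrite mulrC div1r ler_pM2r ?invr_gt0//.
  by apply: ler1_powR; [exact: le_trans L1 yL | lra].
have gn : `|g n| <= e / 2.
  by rewrite -normrN -sub0r; near: n; apply: (cvgr_dist_le _ _ glim); rewrite divr_gt0.
apply: (@le_trans _ _ (e / 2 + g n)); last first.
  have := ler_norm (g n); lra.
rewrite -addrA lerD2l /g lerD//.
  rewrite ler_pM2l// mulrDl lerD2r mulrACA -expr2 powRN -invfM -expr2 yh2.
  by [].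
rewrite ler_pM2l// powRN -powR12_sqrt ?powR_ge0// /r -powRrM.
by [].
Unshelve. all: by end_near. Qed.

(** Logarithm of the asymptotic number of permutations of order dividing m. It is expressed through
    [n!] instead of a power of n, since [growth] is. *)
Definition ln_torsion_growth n : R :=
  (1 - m%:R^-1) * ln n`!%:R + ((2 * m%:R)^-1 - 2^-1) * (ln (2 * pi) + ln n%:R)
  - ln m%:R / 2
  + \sum_(d <- proper_divisors m) n%:R `^ (d%:R / m%:R) / d%:R
  - b%:R / (2 * m%:R).

Lemma ntorsion_asymp :
  (ntorsion m n)%:R * expR (- ln_torsion_growth n) @[n --> \oo] --> (1 : R).
Proof.
pose S n := \sum_(d <- proper_divisors m)
  (y n `^ (d%:R / m%:R) - n%:R `^ (d%:R / m%:R)) / d%:R.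
(* The discrepancy between the exponent of [tilted] and [ln_torsion_growth]. Three constants cancel
   in the limit: b / (2 m) from the entropy, b / (2 m) from the correction in [ln_torsion_growth],
   and - b / m from [cvg_saddle_diff]. *)
pose A n : R := m%:R^-1 * stirling_err R n
  + m%:R^-1 * (n%:R * ln n%:R - n%:R - n%:R * ln (y n) + y n)
  + b%:R / (2 * m%:R) + S n + (ln n%:R - ln (y n)) * 2^-1.
have Alim : A n @[n --> \oo] --> (m%:R^-1 * 0 + m%:R^-1 * (b%:R / 2)
   + b%:R / (2 * m%:R) + (- (b%:R / m%:R)) + 0 * 2^-1 : R).
  apply: cvgD; last by apply: cvgM; [exact: cvg_ln_saddle | exact: cvg_cst].
  apply: cvgD; last exact: cvg_saddle_diff.
  apply: cvgD; last exact: cvg_cst.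
  apply: cvgD; apply: cvgM; try exact: cvg_cst; first exact: cvg_stirling_err.
  exact: cvg_saddle_entropy.
rewrite [X in _ --> X](_ : _ = 0) in Alim; last by rewrite invfM; lra.
have Elim : expR (A n) @[n --> \oo] --> expR (0 : R).
  by apply: continuous_cvg => //; exact: continuous_expR.
have lim : (m%:R * (Num.sqrt (2 * pi * (y n / m%:R)) * tilted m (r n) n)) * expR (A n)
    @[n --> \oo] --> (m%:R * m%:R^-1 * expR 0 : R).
  by apply: cvgM => //; apply: cvgM; [exact: cvg_cst | exact: cvg_tilted].
rewrite divff ?gt_eqF// expR0 mulr1 in lim.
apply: near_cvg lim; near=> n.
have n4 : (4 <= n)%N by near: n; exact: nbhs_infty_ge.
have y0 := saddle_gt0 n4.
have N0 : 0 < n%:R :> R by rewrite ltr0n (leq_trans _ n4).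
have F0 : 0 < n`!%:R :> R by rewrite ltr0n fact_gt0.
have p0 := pi_gt0 R.
have r0 : 0 < r n by exact: powR_gt0.
have Pe : expsum (r n) (divisors m) =
    \sum_(d <- proper_divisors m) y n `^ (d%:R / m%:R) / d%:R + y n / m%:R.
  rewrite /expsum (perm_big _ (proper_divisors_perm m1)) big_cat big_seq1 /=.
  by rewrite saddle_rootXm//; congr (_ + _); apply: eq_bigr => d _; rewrite saddle_rootX.
have SE : S n = \sum_(d <- proper_divisors m) y n `^ (d%:R / m%:R) / d%:R
    - \sum_(d <- proper_divisors m) n%:R `^ (d%:R / m%:R) / d%:R.
  by rewrite /S -sumrB; apply: eq_bigr => d _; rewrite mulrBl.
have -> : Num.sqrt (2 * pi * (y n / m%:R)) =
    expR ((ln (2 * pi) + ln (y n) - ln m%:R) / 2).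
  have z0 : 0 < 2 * pi * (y n / m%:R) by rewrite !mulr_gt0 ?invr_gt0.
  rewrite -powR12_sqrt ?(ltW z0)// -[LHS]lnK ?posrE ?powR_gt0// ln_powR.
  have -> : ln (2 * pi * (y n / m%:R)) = ln (2 * pi) + (ln (y n) - ln m%:R).
    by rewrite [LHS]lnM ?posrE ?mulr_gt0 ?invr_gt0// ln_div.
  by congr expR; lra.
have -> : tilted m (r n) n = (ntorsion m n)%:R *
    expR (- ln n`!%:R + n%:R * (m%:R^-1 * ln (y n)) - expsum (r n) (divisors m)).
  rewrite /tilted !expRD (expRN (ln _)) lnK ?posrE// !mulrA; congr (_ * _ * _).
  rewrite -[r n ^+ n]lnK ?posrE ?exprn_gt0// lnXn// /r ln_powR.
  by congr expR; rewrite -mulrA mulr_natl.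
have E (T x u v w : R) : x * (u * (T * v)) * w = T * (x * u * v * w) by lra.
rewrite E; congr (_ * _); rewrite -{1}(@lnK R m%:R) ?posrE// -!expRD; congr expR.
rewrite /A SE Pe /ln_torsion_growth /stirling_err /stirling_rem !invfM; lra.
Unshelve. all: by end_near. Qed.

End TorsionAsymptotics.

(** * Bounds on torsion numbers that are uniform in all parameters *)

Section TorsionBounds.
Variable R : realType.
Variable m : nat.
Hypothesis m1 : (1 < m)%N.
Let T n : R := (ntorsion m n)%:R.
Let u : R := 1 - m%:R^-1.
Let M0 : 0 < m%:R :> R. Proof. by rewrite ltr0n (ltn_trans _ m1). Qed.

Lemma ntorsion_gt0 k n : (0 < ntorsion k n)%N.
Proof.
by rewrite /ntorsion card_gt0; apply/finset.set0Pn; exists 1%g; rewrite torsionT expg1n.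
Qed.

Let T0 n : 0 < T n. Proof. by rewrite ltr0n ntorsion_gt0. Qed.

(** A convergent sequence is bounded, which turns the asymptotics into an estimate for every n. *)
Lemma ln_torsion_err_bounded :
  exists2 B : R, 0 <= B & forall n, `|ln (T n) - ln_torsion_growth R m n| <= B.
Proof.
have h : ln (T n * expR (- ln_torsion_growth R m n)) @[n --> \oo] --> ln (1 : R).
  apply: continuous_cvg; first exact: continuous_ln.
  exact: (@ntorsion_asymp R m m1).
have hc : cvgn (fun n => ln (T n * expR (- ln_torsion_growth R m n))) by apply/cvg_ex; exists (ln 1).
have [B hB] := cvg_has_ub hc.
have hB' n : `|ln (T n) - ln_torsion_growth R m n| <= B.
  have := hB `|ln (T n * expR (- ln_torsion_growth R m n))| (ex_intro2 _ _ n I erefl).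
  by rewrite lnM ?posrE ?expR_gt0// expRK.
by exists B => //; exact: le_trans (normr_ge0 _) (hB' 0%N).
Qed.

Let S n : R := \sum_(d <- proper_divisors m) n%:R `^ (d%:R / m%:R) / d%:R.

Let ln_torsion_growthE n : ln_torsion_growth R m n = u * ln n`!%:R
  - (u / 2) * (ln (2 * pi) + ln n%:R) + S n - (ln m%:R / 2 + (2 %| m)%:R / (2 * m%:R)).
Proof. by rewrite /ln_torsion_growth /u invfM -/(S n); lra. Qed.

Let S_mono a b : (a <= b)%N -> S a <= S b.
Proof.
move=> ab; apply: ler_sum => d _; rewrite ler_wpM2r ?invr_ge0//.
by apply: ge0_ler_powR; rewrite ?nnegrE ?divr_ge0// ler_nat.
Qed.

Let size_pd : R := (size (proper_divisors m))%:R.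

Let S_sqrt n : (0 < n)%N -> S n <= size_pd * Num.sqrt n%:R.
Proof.
move=> n0; have -> : size_pd * Num.sqrt n%:R = \sum_(d <- proper_divisors m) Num.sqrt n%:R.
  by rewrite big_const_seq count_predT iter_addr_0 mulr_natl.
rewrite /S big_seq [leRHS]big_seq; apply: ler_sum => d /(proper_divisorsP m1)[d0 dm].
have N1 : 1 <= n%:R :> R by rewrite ler1n.
apply: (@le_trans _ _ (n%:R `^ (d%:R / m%:R))).
  by rewrite ler_pdivrMr ?ltr0n// ler_peMr ?powR_ge0// ler1n.
rewrite -powR12_sqrt//; apply: ler_powR => //.
rewrite ler_pdivrMr// ler_pdivlMl//.
by rewrite -natrM ler_nat; case/orP: dm => [/eqP <-|]; lia.
Qed.

Let u01 : 0 < u < 1.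
Proof.
rewrite /u; apply/andP; split; last by rewrite ltrBlDr ltrDl invr_gt0.
by rewrite subr_gt0 invf_lt1// ltr1n.
Qed.

Let c0 : R := ln m%:R / 2 + (2 %| m)%:R / (2 * m%:R).

Let c0_ge0 : 0 <= c0.
Proof.
by rewrite addr_ge0// divr_ge0 ?ln_ge0 ?ler1n ?(ltnW m1)// mulr_ge0// ltW.
Qed.

Let ln2pi : 0 <= ln (2 * pi) :> R.
Proof. by rewrite ln_ge0//; have := @pi_ge2 R; lra. Qed.

Let ln_nat_ge0 n : 0 <= ln n%:R :> R.
Proof. by case: n => [|n]; [rewrite ln0 | rewrite ln_ge0// ler1n]. Qed.

Let S_ge0 n : 0 <= S n.
Proof. by apply: sumr_ge0 => d _; rewrite divr_ge0// powR_ge0. Qed.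

Lemma ln_torsion_upper : exists2 K : R, 0 <= K &
  forall n, ln (T n) <= K * n%:R + u * ln n`!%:R.
Proof.
have [B B0 hB] := ln_torsion_err_bounded.
exists (B + size_pd); first by rewrite addr_ge0.
case=> [|n]; first by rewrite /T ntorsion0 fact0 ln1 !mulr0 addr0.
have N1 : 1 <= n.+1%:R :> R by rewrite ler1n.
have := hB n.+1; rewrite ler_norml ln_torsion_growthE -/c0 => /andP[_ h].
have h1 := S_sqrt (ltn0Sn n).
have h2 : Num.sqrt n.+1%:R <= n.+1%:R :> R.
  by rewrite -powR12_sqrt//; apply: ler1_powR; lra.
have h3 : size_pd * Num.sqrt n.+1%:R <= size_pd * n.+1%:R by rewrite ler_wpM2l// ler0n.
have h4 : 0 <= (u / 2) * (ln (2 * pi) + ln n.+1%:R).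
  by rewrite mulr_ge0 ?addr_ge0//; case/andP: u01 => *; lra.
have h5 : B <= B * n.+1%:R by rewrite ler_peMr.
have := c0_ge0; lra.
Qed.

(** The factorials are the leading terms. The sum [S] is monotone and so has the favourable sign,
    [ln n - ln (n - b)] is at most b, and bounded errors are absorbed by [K * b] once [b >= 1]. *)
Lemma ln_torsion_ratio : exists2 K : R, 0 <= K & forall n b, (b <= n)%N ->
  ln (T (n - b)) - ln (T n) <= K * b%:R + u * (ln (n - b)`!%:R - ln n`!%:R).
Proof.
have [B B0 hB] := ln_torsion_err_bounded; case/andP: u01 => u0 u1.
exists (2 * B + u / 2 * (ln (2 * pi) + 1) + c0).
  have uh : 0 <= u / 2 by lra.
  have := mulr_ge0 uh (addr_ge0 ln2pi ler01).
  by have := c0_ge0; lra.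
move=> n b bn; have [->|b0] := posnP b; first by rewrite subn0 !subrr !mulr0 addr0.
have B1 : 1 <= b%:R :> R by rewrite ler1n.
have N0 : 0 < n%:R :> R by rewrite ltr0n (leq_trans b0).
have n1 := hB n; rewrite ler_norml ln_torsion_growthE -/c0 in n1.
have c00 := c0_ge0; have l2 := ln2pi; have Sn0 := S_ge0 n.
(* The bound on [ln n - ln (n - b)] needs [n - b > 0]; for [b = n] the torsion number of the empty
   set is 1 and [ln n <= n - 1] suffices. *)
move: (bn); rewrite leq_eqVlt => /orP[/eqP bE|bn'].
  subst b; rewrite subnn /T ntorsion0 fact0 ln1 !sub0r -/(T n).
  have ln1' := ln_le_subr1 N0.
  have : c0 <= c0 * n%:R by rewrite ler_peMr.
  have : B <= B * n%:R by rewrite ler_peMr.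
  have : u / 2 * ln (2 * pi) <= u / 2 * ln (2 * pi) * n%:R.
    by rewrite ler_peMr// mulr_ge0//; lra.
  have : u / 2 * ln n%:R <= u / 2 * (n%:R - 1) by rewrite ler_wpM2l//; lra.
  case/andP: n1 => n1 _; nra.
have k0 : (0 < n - b)%N by rewrite subn_gt0.
have K0 : 0 < (n - b)%N%:R :> R by rewrite ltr0n.
have k1 := hB (n - b)%N; rewrite ler_norml ln_torsion_growthE -/c0 in k1.
have Smon := S_mono (leq_subr b n).
have lnn : ln n%:R - ln (n - b)%N%:R <= b%:R :> R.
  rewrite -ln_div ?posrE//; apply: le_trans (ln_le_subr1 _) _; first by rewrite divr_gt0.
  have -> : n%:R / (n - b)%N%:R - 1 = b%:R / (n - b)%N%:R :> R.
    by rewrite -{1}(subnK bn) natrD mulrDl divff ?gt_eqF// addrAC subrr add0r.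
  by rewrite ler_pdivrMr// ler_peMr// ler1n.
have h1 : u / 2 * (ln n%:R - ln (n - b)%N%:R) <= u / 2 * b%:R by rewrite ler_wpM2l//; lra.
have h2 : 2 * B <= 2 * B * b%:R by rewrite ler_peMr//; lra.
have h3 : 0 <= (u / 2 * ln (2 * pi) + c0) * b%:R by rewrite mulr_ge0 ?addr_ge0 ?mulr_ge0//; lra.
case/andP: n1 => n1 _; case/andP: k1 => _ k1; lra.
Qed.

(** The factorials combine to a binomial coefficient. Of the sums [S], the one at n - b is dominated
    by the one at n, and the one at b costs a multiple of sqrt b. *)
Lemma ln_torsion_product : exists2 K : R, 0 <= K & forall n b, (0 < b)%N -> (b < n)%N ->
  ln (T b) + ln (T (n - b)) - ln (T n)
    <= K * (1 + Num.sqrt b%:R) - u * ln 'C(n, b)%:R.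
Proof.
have [B B0 hB] := ln_torsion_err_bounded; case/andP: u01 => u0 u1.
have sp0 : 0 <= size_pd by exact: ler0n.
exists (3 * B + 1 + size_pd); first by rewrite !addr_ge0// mulr_ge0.
move=> n b b0 bn.
have k0 : (0 < n - b)%N by rewrite subn_gt0.
have N0 : 0 < n%:R :> R by rewrite ltr0n (ltn_trans b0).
have Bp : 0 < b%:R :> R by rewrite ltr0n.
have K0 : 0 < (n - b)%N%:R :> R by rewrite ltr0n.
have n1 := hB n; have b1 := hB b; have k1 := hB (n - b)%N.
rewrite !ler_norml !ln_torsion_growthE -/c0 in n1 b1 k1.
have c00 := c0_ge0; have l2 := ln2pi.
have Smon := S_mono (leq_subr b n).
have Sb := S_sqrt b0.
have fE : ln n`!%:R = ln 'C(n, b)%:R + ln b`!%:R + ln (n - b)`!%:R :> R.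
  rewrite -(bin_fact (ltnW bn)) !natrM.
  by rewrite lnM ?posrE ?ltr0n ?muln_gt0 ?fact_gt0 ?bin_gt0 ?(ltnW bn)// lnM ?posrE ?addrA// ltr0n fact_gt0.
have q : - 1 <= ln b%:R + ln (n - b)%N%:R - ln n%:R :> R.
  have h : n%:R / 2 <= b%:R * (n - b)%N%:R :> R.
    rewrite ler_pdivrMr// -!natrM ler_nat -{1}(subnK (ltnW bn)) muln2 -addnn.
    by rewrite leq_add// ?leq_pmull// leq_pmulr.
  have : ln (n%:R / 2) <= ln (b%:R * (n - b)%N%:R) :> R.
    by rewrite ler_ln ?posrE ?mulr_gt0 ?invr_gt0.
  rewrite ln_div ?posrE// lnM ?posrE//.
  have := @ln_le_subr1 R 2 (ltr0n R 2); lra.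
have h1 : u / 2 * (- 1) <= u / 2 * (ln b%:R + ln (n - b)%N%:R - ln n%:R).
  by rewrite ler_wpM2l//; lra.
have h2 : 0 <= u / 2 * ln (2 * pi) by rewrite mulr_ge0//; lra.
have s0 : 0 <= (3 * B + 1) * Num.sqrt b%:R :> R by rewrite mulr_ge0 ?sqrtr_ge0//; lra.
case/andP: n1 => n1 _; case/andP: b1 => _ b1; case/andP: k1 => _ k1.
have := congr1 (fun z => u * z) fE; lra.
Qed.

End TorsionBounds.

(** * Roots of nontrivial permutations *)

Section FallingFactorials.
Local Open Scope nat_scope.

Lemma ffactnD n j k : n ^_ (j + k) = n ^_ j * (n - j) ^_ k.
Proof.
by elim: k => [|k IH]; rewrite ?addn0 ?ffactn0 ?muln1// addnS !ffactnSr IH subnDA mulnA.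
Qed.

Lemma leq_ffactl a b k : a <= b -> a ^_ k <= b ^_ k.
Proof. by move=> ab; elim: k => // k IH; rewrite !ffactnSr leq_mul// leq_sub2r. Qed.

Lemma leq_ffact2 n j k : j <= k -> k <= n -> n ^_ j <= n ^_ k.
Proof.
move=> jk kn; rewrite -(subnKC jk) ffactnD leq_pmulr// ffact_gt0; lia.
Qed.

Lemma leq_expn_ffact n h : h.*2 <= n.+2 -> n ^ h <= 2 ^ h * n ^_ h.
Proof.
elim: h => [|h IH] hn; first by rewrite ffactn0.
rewrite ffactnSr !expnSr mulnACA leq_mul//; first by apply: IH; lia.
by rewrite mulnC; lia.
Qed.

(** The last N of the b factors of [n ^_ b] have product at least [N!], and among the b - N others
    the first half are at least n / 2. By [leq_4uphalf] the exponent is at least b / 4. *)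
Lemma fact_ffact_bound n b N : 2 * N <= b -> b <= n ->
  N`! * n ^ (uphalf (b - N)) <= 2 ^ (uphalf (b - N)) * n ^_ b.
Proof.
move=> Nb bn; set h := uphalf (b - N).
have hE : h <= b - N /\ h.*2 <= (b - N).+1.
  rewrite /h uphalf_half -addnn; have := odd_double_half (b - N); rewrite -addnn.
  by case: (odd _) => /=; lia.
have h1 : n ^ h <= 2 ^ h * n ^_ (b - N).
  apply: leq_trans (leq_expn_ffact (n := n) (h := h) _) _; first lia.
  by rewrite leq_mul2l leq_ffact2 ?orbT//; lia.
have h2 : N`! * n ^_ (b - N) <= n ^_ b.
  rewrite -{2}(subnK (_ : N <= b)); last lia.
  rewrite ffactnD mulnC leq_mul2l; apply/orP; right.
  rewrite -ffactnn; apply: (@leq_trans ((n - (b - N)) ^_ N)) => //.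
  by apply: leq_ffactl; lia.
apply: leq_trans (leq_mul (leqnn N`!) h1) _.
by rewrite mulnCA leq_mul2l h2 orbT.
Qed.

Lemma leq_4uphalf b N : 2 * N <= b -> b <= 4 * uphalf (b - N).
Proof.
rewrite uphalf_half; have := odd_double_half (b - N); rewrite -addnn.
by case: (odd _) => /=; lia.
Qed.

Lemma leq_double b N : 2 * N <= b -> N <= b.
Proof. by apply: leq_trans; rewrite leq_pmull. Qed.

End FallingFactorials.

Section RootSums.
Variable R : realType.
Variables (m : nat) (q : R).
Hypothesis m1 : (1 < m)%N.
Let u : R := 1 - m%:R^-1.
Hypothesis qu : 1 < q * u.
Let T n : R := (ntorsion m n)%:R.
Let T0 n : 0 < T n. Proof. by rewrite ltr0n ntorsion_gt0. Qed.
Let delta : R := q * u - 1.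

Let u01 : 0 < u < 1.
Proof.
rewrite /u; apply/andP; split; last by rewrite ltrBlDr ltrDl invr_gt0 ltr0n (ltn_trans _ m1).
by rewrite subr_gt0 invf_lt1 ?ltr1n// ltr0n (ltn_trans _ m1).
Qed.

Let q_gt0 : 0 < q.
Proof.
have /andP[u0 _] := u01; rewrite -(pmulr_lgt0 q u0).
exact: lt_trans qu.
Qed.

(** By [card_supp_cycles] this bounds, up to [b * ln 2], the logarithm of the number of permutations
    moving b points in N cycles. *)
Definition ln_class_weight n b N : R := ln (n ^_ b)%:R - ln N`!%:R.

(** In [leq_nroots] the factor on the fixed points, divided by [T n], gives the power [- u] of
    [n ^_ b], and the factor on the cycles gives the power [u] of [N!]. The q-th power turns [u]
    into [q * u = 1 + delta]. *)
Lemma root_ratio_bound : exists2 K : R, 0 <= K & forall n (z : {perm 'I_n}),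
  ((nroots m z)%:R / T n) `^ q <= expR (K * #|supp z|%:R
     - (1 + delta) * ln_class_weight n #|supp z| #|suppcycles z|).
Proof.
have [K1 K10 hK1] := ln_torsion_ratio R m1.
have [K2 K20 hK2] := ln_torsion_upper R m1.
have l2 : 0 <= ln 2 :> R by rewrite ln_ge0// ler1n.
exists (q * (K1 + K2 + ln 2)); first by rewrite mulr_ge0 ?addr_ge0// ltW.
move=> n z; set b := #|supp z|; set N := #|suppcycles z|.
have [->|r0] := posnP (nroots m z).
  by rewrite mul0r powR0 ?gt_eqF// expR_ge0.
have R0 : 0 < (nroots m z)%:R :> R by rewrite ltr0n.
have x0 : 0 < (nroots m z)%:R / T n by rewrite divr_gt0.
rewrite -[leLHS]lnK ?posrE ?powR_gt0// ler_expR ln_powR ln_div ?posrE//.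
have bn : (b <= n)%N by rewrite -[X in (_ <= X)%N](card_ord n) max_card.
have Nb : (N <= b)%N by exact: leq_double (card_suppcycles z).
have h1 : ln (nroots m z)%:R <= ln (T (n - b)) + (ln (T N) + b%:R * ln 2).
  have := leq_nroots m z; rewrite card_ord -(ler_nat R) !natrM natrX -/b -/N => h.
  apply: (@le_trans _ _ (ln (T (n - b) * (T N * 2 ^+ b)))).
    by rewrite ler_ln ?posrE ?mulr_gt0 ?exprn_gt0.
  rewrite lnM ?posrE ?mulr_gt0 ?exprn_gt0// lnM ?posrE ?exprn_gt0// lnXn//.
  by rewrite mulr_natl.
have h2 := hK1 n b bn; have h3 := hK2 N; rewrite -/(T _) -/(T _) in h2 h3.
have h4 : K2 * N%:R <= K2 * b%:R by rewrite ler_wpM2l// ler_nat.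
have fE : ln n`!%:R = ln (n ^_ b)%:R + ln (n - b)`!%:R :> R.
  by rewrite -(ffact_fact bn) natrM lnM ?posrE// ltr0n ?ffact_gt0 ?fact_gt0.
have h5 : ln (nroots m z)%:R - ln (T n) <=
    (K1 + K2 + ln 2) * b%:R - u * ln_class_weight n b N.
  rewrite /ln_class_weight; have := congr1 (fun z => u * z) fE; rewrite -/u in h2 h3; lra.
have := ler_wpM2l (ltW q_gt0) h5; rewrite /delta; lra.
Qed.

Let geometric_le (x : R) n : 0 <= x -> x <= 1 / 2 -> \sum_(b < n) x ^+ b <= 2.
Proof.
move=> x0 xh; have := subrX1 x n; set s := \sum_(b < n) _ => e.
have xn : 0 <= x ^+ n by rewrite exprn_ge0.
have s0 : 0 <= s by apply: sumr_ge0 => i _; rewrite exprn_ge0.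
have : 0 <= s * (1 / 2 - x) by rewrite mulr_ge0// subr_ge0.
lra.
Qed.

(** The number of permutations with given b and N uses up one power of the class weight. What
    remains is the power [- delta], at most a constant to the b times [(n / 2) ^ (- delta * b / 4)]:
    a geometric series over b >= 1 with ratio tending to 0. *)
Lemma cvg_root_sum : (\sum_(z : {perm 'I_n} | z != 1%g)
   ((nroots m z)%:R / T n) `^ q) @[n --> \oo] --> (0 : R).
Proof.
have [K K0 hK] := root_ratio_bound.
have d0 : 0 < delta by rewrite subr_gt0.
have l2 : 0 <= ln 2 :> R by rewrite ln_ge0// ler1n.
(* One [ln 2] comes from the factor [2 ^ b] in the class count, the other pays for the at most b + 1
   values of N, and the last term comes from n / 2 in place of n. *)
pose c : R := K + 2 * ln 2 + delta / 4 * ln 2.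
pose x n : R := expR c * n%:R `^ (- (delta / 4)).
have xlim : 2 * x n @[n --> \oo] --> (2 * (expR c * 0) : R).
  apply: cvgM; first exact: cvg_cst.
  apply: cvgM; first exact: cvg_cst.
  by apply: cvg_powRN; [rewrite divr_gt0 | exact: cvgr_idn].
rewrite !mulr0 in xlim; apply: (cvg0_le _ xlim); near=> n.
have n2 : (2 <= n)%N by near: n; exact: nbhs_infty_ge.
have N0 : 0 < n%:R :> R by rewrite ltr0n (ltn_trans _ n2).
have x0 : 0 <= x n by rewrite mulr_ge0 ?expR_ge0 ?powR_ge0.
have xh : x n <= 1 / 2.
  have : `|0 - 2 * x n| <= 1 by near: n; apply: (cvgr_dist_le _ _ xlim).
  by rewrite sub0r normrN ger0_norm ?mulr_ge0//; lra.
have l2n : ln 2 <= ln n%:R :> R by rewrite ler_ln ?posrE// (ler_nat R 2).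
have xE : x n = expR (K + 2 * ln 2 - delta / 4 * (ln n%:R - ln 2)).
  rewrite /x -[_ `^ _]lnK ?posrE ?powR_gt0// ln_powR -expRD; congr expR.
  by rewrite /c; lra.
rewrite ger0_norm; last by apply: sumr_ge0 => z _; exact: powR_ge0.
pose w b N := expR (K * b%:R - (1 + delta) * ln_class_weight n b N).
apply: (@le_trans _ _ (\sum_(z : {perm 'I_n} | z != 1%g) w #|supp z| #|suppcycles z|)).
  by apply: ler_sum => z _; exact: hK.
pose key (z : {perm 'I_n}) : 'I_n.+1 * 'I_n.+1 := (inord #|supp z|, inord #|suppcycles z|).
have bn (z : {perm 'I_n}) : (#|supp z| < n.+1)%N.
  by rewrite ltnS -[X in (_ <= X)%N](card_ord n) max_card.
have Nn (z : {perm 'I_n}) : (#|suppcycles z| < n.+1)%N.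
  by rewrite (leq_ltn_trans (leq_double (card_suppcycles z))).
have keyE z : ((key z).1 = #|supp z| :> nat) * ((key z).2 = #|suppcycles z| :> nat).
  by rewrite /key /= !inordK.
rewrite (partition_big key (fun p : 'I_n.+1 * 'I_n.+1 => (0 < p.1)%N && (2 * p.2 <= p.1)%N)) /=;
  last first.
  move=> z z1; rewrite !keyE card_suppcycles andbT card_gt0.
  apply: contraNneq z1 => s0; apply/eqP/permP => v; rewrite perm1.
  have : v \notin supp z by rewrite s0 finset.inE.
  by rewrite finset.inE negbK => /eqP.
have bound (b N : 'I_n.+1) : (2 * N <= b)%N ->
  \sum_(z : {perm 'I_n} | (z != 1%g) && (key z == (b, N))) w #|supp z| #|suppcycles z|
   <= (x n / 2) ^+ b.
  move=> Nb; have bn' : (b <= n)%N by rewrite -ltnS.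
  apply: (@le_trans _ _ (\sum_(z in [set z : {perm 'I_n} | (#|supp z| == b) && (#|suppcycles z| == N)]%SET) w b N)).
    rewrite big_mkcond [leRHS]big_mkcond /=; apply: ler_sum => z _.
    rewrite finset.inE; case: ifPn => [/andP[_ /eqP kz]|_].
      have := keyE z; rewrite kz /= => -[e1 e2].
      by rewrite -e1 -e2 !eqxx /=.
    by case: ifP => // _; exact: expR_ge0.
  rewrite sumr_const -[leLHS]mulr_natl.
  have f0 : 0 < (n ^_ b)%:R :> R by rewrite ltr0n ffact_gt0.
  have g0 : 0 < N`!%:R :> R by rewrite ltr0n fact_gt0.
  have := card_supp_cycles 'I_n b N; rewrite card_ord.
  set cnt := #|(_ : {set {perm 'I_n}})| => hc.
  have w0 : 0 <= w b N by exact: expR_ge0.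
  have hc' : cnt%:R <= expR (b%:R * ln 2 + ln_class_weight n b N).
    rewrite /ln_class_weight addrA expRD expRN lnK ?posrE//.
    rewrite ler_pdivlMr// expRD [expR (ln _)]lnK ?posrE// expRM_natl lnK ?posrE//.
    by rewrite -natrX -!natrM ler_nat (mulnC (2 ^ _)%N).
  apply: (le_trans (ler_wpM2r w0 hc')).
  rewrite /w -expRD (_ : x n / 2 = expR (K + ln 2 - delta / 4 * (ln n%:R - ln 2))); last first.
    have -> : x n = expR (K + ln 2 - delta / 4 * (ln n%:R - ln 2) + ln 2).
      by rewrite xE; congr expR; lra.
    by rewrite expRD (@lnK R 2) ?posrE// mulfK.
  rewrite -expRM_natl ler_expR.
  set h := uphalf (b - N).
  have hb : (b <= 4 * h)%N by exact: leq_4uphalf.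
  have := fact_ffact_bound Nb bn'; rewrite -/h -(ler_nat R) !natrM !natrX => hf.
  have hl : ln N`!%:R + h%:R * ln n%:R <= h%:R * ln 2 + ln (n ^_ b)%:R :> R.
    rewrite !mulr_natl -!lnXn// -lnM ?posrE ?exprn_gt0// -lnM ?posrE ?exprn_gt0//.
    by rewrite ler_ln ?posrE ?mulr_gt0 ?exprn_gt0.
  have hb' : b%:R <= 4 * h%:R :> R by rewrite -natrM ler_nat.
  have h1 : b%:R * (ln n%:R - ln 2) <= 4 * h%:R * (ln n%:R - ln 2) :> R.
    by rewrite ler_wpM2r// subr_ge0.
  have h2 : b%:R * (ln n%:R - ln 2) / 4 <= ln_class_weight n b N by rewrite /ln_class_weight; lra.
  have := ler_wpM2l (ltW d0) h2; lra.
apply: (@le_trans _ _ (\sum_(p : 'I_n.+1 * 'I_n.+1 | (0 < p.1)%N && (2 * p.2 <= p.1)%N) (x n / 2) ^+ p.1)).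
  by apply: ler_sum => -[b N] /= /andP[_ Nb]; exact: bound.
rewrite -(pair_big_dep (fun b : 'I_n.+1 => (0 < b)%N) (fun b N : 'I_n.+1 => (2 * N <= b)%N)
  (fun b N => (x n / 2) ^+ b)) /=.
apply: (@le_trans _ _ (\sum_(b < n.+1 | (0 < b)%N) x n ^+ b)).
  apply: ler_sum => b _.
  have xb : 0 <= (x n / 2) ^+ b by rewrite exprn_ge0// divr_ge0.
  apply: (@le_trans _ _ (\sum_(N < n.+1 | (N < b.+1)%N) (x n / 2) ^+ b)).
    rewrite big_mkcond [leRHS]big_mkcond /=; apply: ler_sum => N _.
    by case: ifPn => Nb; case: ifPn => //; rewrite ltnS leq_double.
  rewrite -(big_ord_widen n.+1 (fun=> (x n / 2) ^+ b)) ?ltn_ord// sumr_const card_ord.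
  rewrite -[leLHS]mulr_natl exprMn exprVn mulrCA ler_piMr ?exprn_ge0//.
  by rewrite ler_pdivrMr ?exprn_gt0// mul1r -natrX ler_nat ltn_expl.
rewrite big_mkcond big_ord_recl /= add0r.
rewrite (eq_bigr (fun b : 'I_n => x n * x n ^+ b)); last by move=> b _; rewrite exprS.
rewrite -big_distrr /= mulrC ler_wpM2r//; exact: geometric_le.
Unshelve. all: by end_near. Qed.

End RootSums.

(** * From root numbers to homomorphisms *)

Section Young.
Variable R : realType.

(** Each [F j] occurs in all products except the j-th, so its exponent in their weighted geometric
    mean is [1 - lam j]. The comparison with the arithmetic mean [A] is [ln (x / A) <= x / A - 1],
    averaged. *)
Lemma weighted_amgm s (lam F : 'I_s -> R) : (forall i, 0 <= lam i) ->
  \sum_i lam i = 1 -> (forall j, 0 < F j) ->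
  \prod_j F j `^ (1 - lam j) <= \sum_i lam i * \prod_(j | j != i) F j.
Proof.
move=> l0 l1 F0; pose x i := \prod_(j | j != i) F j.
have x0 i : 0 < x i by apply: prodr_gt0.
have lnx i : ln (x i) = \sum_j ln (F j) - ln (F i).
  rewrite [in RHS](bigD1 i) //= addrAC subrr add0r /x.
  have [] // : 0 < \prod_(j | j != i) F j /\ ln (\prod_(j | j != i) F j) = \sum_(j | j != i) ln (F j).
  elim/big_ind2: _ => [|a b c d [a0 <-] [c0 <-]|j _]; first by rewrite ln1.
    by rewrite mulr_gt0// lnM ?posrE.
  by [].
set A := \sum_i _.
have A0 : 0 < A.
  rewrite lt_def sumr_ge0 ?andbT => [|i _]; last exact: (mulr_ge0 (l0 i) (ltW (x0 i))).
  apply/eqP => A0; have : \sum_i lam i = 0.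
    rewrite big1// => i _; have := psumr_eq0P _ A0 => /(_ (fun i _ => mulr_ge0 (l0 i) (ltW (x0 i))) i isT) /eqP.
    by rewrite mulf_eq0 (gt_eqF (x0 i)) orbF => /eqP.
  by rewrite l1 => /eqP; rewrite oner_eq0.
have P0 : 0 < \prod_j F j `^ (1 - lam j) by apply: prodr_gt0 => j _; exact: powR_gt0.
rewrite -[leLHS]lnK ?posrE// -[leRHS]lnK ?posrE// ler_expR.
have -> : ln (\prod_j F j `^ (1 - lam j)) = \sum_i lam i * ln (x i).
  have [] // : 0 < \prod_j F j `^ (1 - lam j) /\ ln (\prod_j F j `^ (1 - lam j)) = \sum_j (1 - lam j) * ln (F j).
    elim/big_ind2: _ => [|a b c d [a0 <-] [c0 <-]|j _]; first by rewrite ln1.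
      by rewrite mulr_gt0// lnM ?posrE.
    by rewrite powR_gt0// ln_powR.
  move=> _ ->; under [RHS]eq_bigr do rewrite lnx mulrBr.
  rewrite sumrB -big_distrl /= l1 mul1r -sumrB; apply: eq_bigr => j _.
  by rewrite mulrBl mul1r.
have h i : ln (x i) <= ln A + (x i / A - 1).
  have := @ln_le_subr1 R (x i / A) (divr_gt0 (x0 i) A0); rewrite ln_div ?posrE//; lra.
apply: (@le_trans _ _ (\sum_i lam i * (ln A + (x i / A - 1)))).
  by apply: ler_sum => i _; rewrite ler_wpM2l.
rewrite (eq_bigr (fun i => lam i * (ln A - 1) + lam i * x i / A)); last by move=> i _; lra.
by rewrite big_split /= -!big_distrl /= l1 divff ?gt_eqF// mul1r subrK.
Qed.

Section ProductOne.
Variables (gT : finGroupType) (s : nat).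

Lemma prod_seq_inj (r : seq 'I_s) (i : 'I_s) (z z' : {ffun 'I_s -> gT}) : uniq r -> i \in r ->
  (forall j, j != i -> z j = z' j) ->
  (\prod_(j <- r) z j = \prod_(j <- r) z' j)%g -> z = z'.
Proof.
move=> ur ir zz'; case/splitPr: ir ur => r1 r2.
rewrite cat_uniq /= negb_or => /and4P[_ /andP[ir1 _] ir2 _].
have e t : i \notin t -> (\prod_(j <- t) z j = \prod_(j <- t) z' j)%g.
  move=> it; rewrite big_seq [RHS]big_seq; apply: eq_bigr => j jt; apply: zz'.
  by apply: contraNneq it => <-.
rewrite !big_cat !big_cons /= e// (e r2)// => /mulgI/mulIg zi.
by apply/ffunP => j; have [->|/zz'] := eqVneq j i.
Qed.

(** The relation determines [z i] from the other coordinates; dropping it leaves a free sum over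
    these, which factors. *)
Lemma young_sum (F : 'I_s -> gT -> R) (i : 'I_s) : (forall j g, 0 <= F j g) ->
  \sum_(z : {ffun 'I_s -> gT} | (\prod_(j < s) z j == 1)%g) \prod_(j | j != i) F j (z j)
    <= \prod_(j | j != i) \sum_g F j g.
Proof.
(* Coordinate [i] is frozen at 1, so that the free sum still ranges over functions on all of
   ['I_s]. *)
move=> F0; pose F' j g := if j == i then (g == 1%g)%:R else F j g.
have F'0 j g : 0 <= F' j g by rewrite /F'; case: ifP.
pose h (z : {ffun 'I_s -> gT}) : {ffun 'I_s -> gT} := [ffun j => if j == i then 1%g else z j].
pose P1 : {set {ffun 'I_s -> gT}} := [set z : {ffun 'I_s -> gT} | (\prod_(j < s) z j == 1)%g]%SET.
have -> : \prod_(j | j != i) \sum_g F j g = \prod_j \sum_g F' j g.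
  rewrite [RHS](bigD1 i) //= [X in X * _](_ : _ = 1).
    rewrite mul1r; apply: eq_bigr => j ji; apply: eq_bigr => g _.
    by rewrite /F' (negbTE ji).
  rewrite (bigD1 1%g) //= /F' !eqxx big1 ?addr0// => g g1.
  by rewrite (negbTE g1).
rewrite bigA_distr_bigA /=.
have -> : \sum_(z : {ffun 'I_s -> gT} | (\prod_(j < s) z j == 1)%g) \prod_(j | j != i) F j (z j)
   = \sum_(z in P1) \prod_j F' j (h z j).
  apply: eq_big => [z|z _]; first by rewrite finset.inE.
  rewrite [RHS](bigD1 i) //= /F' /h ffunE !eqxx mul1r.
  by apply: eq_bigr => j ji; rewrite ffunE (negbTE ji).
have hinj : {in P1 &, injective h}.
  move=> z z'; rewrite !finset.inE => /eqP z1 /eqP z1' /ffunP hz.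
  apply: (@prod_seq_inj (index_enum 'I_s) i); rewrite ?index_enum_uniq ?mem_index_enum//.
    by move=> j ji; have := hz j; rewrite !ffunE (negbTE ji).
  by rewrite z1 z1'.
rewrite -(big_imset (fun f : {ffun 'I_s -> gT} => \prod_j F' j (f j)) hinj) /=.
rewrite big_mkcond [leRHS]big_mkcond /=; apply: ler_sum => f _.
by case: ifP => // _; apply: prodr_ge0.
Qed.

End ProductOne.
End Young.

Section HomAsymptotics.
Variable R : realType.
Variables (s : nat) (e : 'I_s -> nat).
Hypothesis hs : (2 <= s)%N.
Hypothesis he : forall j, (2 <= e j)%N.
Hypothesis hsum : \sum_(j < s) (e j)%:R^-1 < 1 :> R.

Definition torsion_prod n : R := \prod_(j < s) (ntorsion (e j) n)%:R.

Lemma torsion_prod_gt0 n : 0 < torsion_prod n.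
Proof. by apply: prodr_gt0 => j _; rewrite ltr0n ntorsion_gt0. Qed.

Lemma nroots1 m n : nroots m (1%g : {perm 'I_n}) = ntorsion m n.
Proof. by apply: eq_card => x; rewrite torsionT finset.inE. Qed.

Lemma torsion_prod_le_nhom n : torsion_prod n <= (nhom e n)%:R.
Proof.
rewrite /torsion_prod -natr_prod ler_nat nhomE.
rewrite (bigD1 [ffun=> 1%g]) /=; last first.
  by rewrite finset.inE; apply/eqP; rewrite big1// => j _; rewrite ffunE.
set p := (X in (_ <= X + _)%N).
have -> : p = (\prod_(j < s) ntorsion (e j) n)%N.
  by apply: eq_bigr => j _; rewrite ffunE nroots1.
exact: leq_addr.
Qed.

Let S0 : 0 < s%:R :> R. Proof. by rewrite ltr0n ltnW. Qed.
Let gap : R := 1 - \sum_(j < s) (e j)%:R^-1.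
Let gap0 : 0 < gap. Proof. by rewrite subr_gt0. Qed.
(** The slack is shared equally, so that the weights add up to 1 and each exceeds [1 / e j]. *)
Let lam j : R := (e j)%:R^-1 + gap / s%:R.

Let lam_gt j : (e j)%:R^-1 < lam j.
Proof. by rewrite /lam ltrDl divr_gt0. Qed.

Let lam0 j : 0 < lam j.
Proof. by apply: lt_trans (lam_gt j); rewrite invr_gt0 ltr0n (ltn_trans _ (he j)). Qed.

Let lam_sum : \sum_j lam j = 1.
Proof.
rewrite big_split /= sumr_const card_ord -(mulr_natr (gap / s%:R)) divfK ?gt_eqF//.
by rewrite /gap addrC subrK.
Qed.

(** A second index carries positive weight, by [s >= 2]; thus the exponent [q j] is positive. *)
Let lam1 j : lam j < 1.
Proof.
rewrite -lam_sum (bigD1 j) //= ltrDl.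
have [k kj] : exists k, k != j.
  have h0 : (0 < s)%N by exact: ltnW.
  by case: (eqVneq (Ordinal h0) j) => [<-|]; [exists (Ordinal hs) | exists (Ordinal h0)].
by rewrite (bigD1 k)//= ltr_pwDl// sumr_ge0// => i _; exact: ltW.
Qed.

Let q j : R := (1 - lam j)^-1.
Let f j n (z : {perm 'I_n}) : R := (nroots (e j) z)%:R / (ntorsion (e j) n)%:R.
Let X j n : R := \sum_(z : {perm 'I_n} | z != 1%g) f j z `^ q j.

Let T0 j n : 0 < (ntorsion (e j) n)%:R :> R.
Proof. by rewrite ltr0n ntorsion_gt0. Qed.

Let X_cvg j : X j n @[n --> \oo] --> (0 : R).
Proof.
apply: cvg_root_sum; first exact: he.
have l1 : 0 < 1 - lam j by rewrite subr_gt0.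
by rewrite mulrC -[ltLHS](divff (lt0r_neq0 l1)) ltr_pM2r ?invr_gt0// ltrD2l ltrN2.
Qed.

Lemma nhom_ratio_le n : (nhom e n)%:R / torsion_prod n
   <= \sum_i lam i * \prod_(j | j != i) (1 + X j n).
Proof.
have f0 j (z : {perm 'I_n}) : 0 <= f j z by rewrite divr_ge0.
pose F j (z : {perm 'I_n}) : R := f j z `^ q j.
have FX j : \sum_z F j z = 1 + X j n.
  by rewrite (bigD1 1%g) //= /F /f nroots1 divff ?gt_eqF// powR1.
have -> : (nhom e n)%:R / torsion_prod n =
   \sum_(z : {ffun 'I_s -> {perm 'I_n}} | (\prod_(j < s) z j == 1)%g) \prod_j f j (z j).
  rewrite nhomE natr_sum big_distrl /=; apply: eq_big => [z|z _]; first by rewrite finset.inE.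
  by rewrite natr_prod /torsion_prod -prodf_div.
apply: (@le_trans _ _ (\sum_(z : {ffun 'I_s -> {perm 'I_n}} | (\prod_(j < s) z j == 1)%g)
    \sum_i lam i * \prod_(j | j != i) F j (z j))).
  apply: ler_sum => z _.
  (* The inequality of means is proved by logarithms, for positive factors; if one of them vanishes
     the left side is 0. *)
  have [/forallP zp|] := boolP [forall j, 0 < f j (z j)]; last first.
    rewrite negb_forall => /existsP[j]; rewrite -leNgt => fj.
    rewrite (bigD1 j) //= (_ : f j (z j) = 0) ?mul0r; last by apply/eqP; rewrite eq_le fj f0.
    apply: sumr_ge0 => i _; rewrite mulr_ge0 ?(ltW (lam0 i))//.
    by apply: prodr_ge0 => k _; exact: powR_ge0.
  apply: le_trans (weighted_amgm (fun i => ltW (lam0 i)) lam_sum (F := fun j => F j (z j)) _).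
    rewrite le_eqVlt; apply/orP; left; apply/eqP; apply: eq_bigr => j _.
    by rewrite /F -powRrM /q mulVf ?powRr1// subr_eq0 gt_eqF.
  by move=> j; exact: powR_gt0.
rewrite exchange_big /=; apply: ler_sum => i _.
rewrite -big_distrr /= ler_wpM2l ?(ltW (lam0 i))//.
apply: le_trans (young_sum _ _) _ => [j z|]; first exact: powR_ge0.
by rewrite (eq_bigr (fun j => 1 + X j n)).
Qed.

Lemma cvg_prod_cond (I : finType) (P : pred I) (g : I -> nat -> R) (l : I -> R) :
  (forall i, g i @ \oo --> l i) ->
  (fun n => \prod_(i | P i) g i n) @ \oo --> \prod_(i | P i) l i.
Proof.
move=> gl; elim: (index_enum I) => [|i r IH].
  rewrite big_nil; apply: (@near_cvg R (fun=> 1)); last exact: cvg_cst.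
  by apply: nearW => n; rewrite big_nil.
rewrite big_cons; case Pi: (P i).
  apply: (@near_cvg R (fun n => g i n * \prod_(j <- r | P j) g j n)).
    by apply: nearW => n; rewrite big_cons Pi.
  by apply: cvgM.
by apply: near_cvg IH; apply: nearW => n; rewrite big_cons Pi.
Qed.

(** The tuple of trivial powers alone gives the lower bound 1, and the upper bound tends to the sum
    of the weights. *)
Lemma cvg_nhom : (nhom e n)%:R / torsion_prod n @[n --> \oo] --> (1 : R).
Proof.
have up : \sum_i lam i * \prod_(j | j != i) (1 + X j n) @[n --> \oo]
    --> (\sum_i lam i * \prod_(j | j != i) (1 + 0) : R).
  apply: (@cvg_sum_seq R _ (index_enum 'I_s) (fun i n => lam i * \prod_(j | j != i) (1 + X j n))) => i _.
  apply: cvgM; first exact: cvg_cst.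
  by apply: cvg_prod_cond => j; apply: cvgD; [exact: cvg_cst | exact: X_cvg].
rewrite [X in _ --> X](_ : _ = 1) in up; last first.
  rewrite -[RHS]lam_sum; apply: eq_bigr => i _.
  by rewrite addr0 big1 ?mulr1.
apply: (@squeeze_cvgr _ _ _ _ (fun=> 1) _ _ _ _ (cvg_cst (1 : R)) up); apply: nearW => n.
rewrite nhom_ratio_le andbT ler_pdivlMr ?torsion_prod_gt0// mul1r.
exact: torsion_prod_le_nhom.
Qed.

End HomAsymptotics.

(** * Tuples that are not transitive are negligible *)

Section BinomialBounds.
Local Open Scope nat_scope.

(** This bound will give the decay in n, and [leq_exp2_bin] the summability over k. *)
Lemma leq_bin_self n k : 0 < k -> k < n -> n <= 'C(n, k).
Proof.
case: k => // k _; elim: n k => // n IH k; rewrite ltnS leq_eqVlt => /orP[/eqP <-|kn].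
  by rewrite binSn.
rewrite binS -addn1 leq_add ?IH//.
by rewrite bin_gt0 (leq_trans (leqnSn k)) // ltnW.
Qed.

Lemma leq_exp2_bin n k : 2 * k <= n -> 2 ^ k <= 'C(n, k).
Proof.
elim: k n => [|k IH] n kn; first by rewrite bin0.
case: n kn => [|n] kn; first by lia.
have h : 2 * k <= n by lia.
rewrite -(leq_pmul2l (ltn0Sn k)) -mul_bin_diag expnS mulnA leq_mul ?IH//.
by rewrite mulnC.
Qed.

End BinomialBounds.

Section IntransitiveNegligible.
Variable R : realType.
Variables (s : nat) (e : 'I_s -> nat).
Hypothesis hs : (2 <= s)%N.
Hypothesis he : forall j, (2 <= e j)%N.
Hypothesis hsum : \sum_(j < s) (e j)%:R^-1 < 1 :> R.
Let gap : R := 1 - \sum_(j < s) (e j)%:R^-1.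
Let gap0 : 0 < gap. Proof. by rewrite subr_gt0. Qed.
Let W n : R := torsion_prod R e n.
Let h n : R := (nhom e n)%:R.
Let W0 n : 0 < W n. Proof. exact: torsion_prod_gt0. Qed.
Let h0 n : 0 < h n. Proof. exact: lt_le_trans (W0 n) (torsion_prod_le_nhom R e n). Qed.

Lemma nhom_le_torsion_prod : exists2 C : R, 0 < C & forall n, h n <= C * W n.
Proof.
have hc : cvgn (fun n => h n / W n) by apply/cvg_ex; exists 1; exact: cvg_nhom.
have [C hC] := cvg_has_ub hc.
have hC' n : h n <= C * W n.
  rewrite -ler_pdivrMr//; apply: le_trans (ler_norm _) _.
  exact: (hC _ (ex_intro2 _ _ n I erefl)).
exists C => //; have := hC' 0%N; rewrite -(pmulr_lgt0 C (W0 0%N)).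
by apply: lt_le_trans.
Qed.

(** Over all j, [ln_torsion_product] saves the power [s - 1 + gap] of the binomial coefficient. One
    power offsets the binomial factor, and by [s >= 2] at least [gap] remains. *)
Lemma torsion_prod_ratio : exists2 K : R, 0 <= K & forall n k, (0 < k)%N -> (k < n)%N ->
  'C(n, k)%:R * (W k * W (n - k)) / W n
   <= expR (K * (1 + Num.sqrt k%:R) - gap * ln 'C(n, k)%:R).
Proof.
pose K j := projT1 (cid2 (ln_torsion_product R (he j))).
have K0 j : 0 <= K j by rewrite /K; case: cid2.
have hK j n k : (0 < k)%N -> (k < n)%N -> ln (ntorsion (e j) k)%:R
    + ln (ntorsion (e j) (n - k))%:R - ln (ntorsion (e j) n)%:R
    <= K j * (1 + Num.sqrt k%:R) - (1 - (e j)%:R^-1) * ln 'C(n, k)%:R.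
  by rewrite /K; case: cid2 => //= x x0; apply.
exists (\sum_j K j); first by rewrite sumr_ge0.
move=> n k k0 kn.
have c0 : 0 < 'C(n, k)%:R :> R by rewrite ltr0n bin_gt0 ltnW.
have lnW i : ln (W i) = \sum_j ln (ntorsion (e j) i)%:R.
  have [] // : 0 < W i /\ ln (W i) = \sum_j ln (ntorsion (e j) i)%:R.
  rewrite /W /torsion_prod; elim/big_ind2: _ => [|a b c d [a0 <-] [d0 <-]|j _].
  - by rewrite ln1.
  - by rewrite mulr_gt0// lnM ?posrE.
  - by rewrite ltr0n ntorsion_gt0.
have x0 : 0 < 'C(n, k)%:R * (W k * W (n - k)) / W n by rewrite divr_gt0 ?mulr_gt0.
rewrite -[leLHS]lnK ?posrE// ler_expR ln_div ?posrE ?mulr_gt0//.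
rewrite lnM ?posrE ?mulr_gt0// lnM ?posrE// !lnW.
have : \sum_j (ln (ntorsion (e j) k)%:R + ln (ntorsion (e j) (n - k))%:R
      - ln (ntorsion (e j) n)%:R) <=
    \sum_j (K j * (1 + Num.sqrt k%:R) - (1 - (e j)%:R^-1) * ln 'C(n, k)%:R).
  by apply: ler_sum => j _; exact: hK.
rewrite !sumrB big_split /= -!big_distrl /= sumrB sumr_const card_ord.
set A := \sum_j K j; set B := \sum_j ln _; set C := \sum_j ln _; set D := \sum_j ln _.
have l0 : 0 <= ln 'C(n, k)%:R :> R by rewrite ln_ge0// ler1n bin_gt0 ltnW.
have : 2 <= s%:R :> R by rewrite (ler_nat R 2).
move=> s2 H; have h2 : 0 <= (s%:R - 2) * ln 'C(n, k)%:R :> R by rewrite mulr_ge0// subr_ge0.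
move: H; rewrite /gap; lra.
Qed.

Lemma cvg_intransitive :
  (\sum_(1 <= k < n) 'C(n, k)%:R * (h k * h (n - k)%N)) / h n @[n --> \oo] --> (0 : R).
Proof.
have [C C0 hC] := nhom_le_torsion_prod.
have [K K0 hK] := torsion_prod_ratio.
have l2 : 0 < ln 2 :> R by rewrite ln_gt0// ltr1n.
(* Half of [gap * ln 'C(n, k)] is spent on the power of n. The other half is at least [2 * a * k]:
   one [a * k] absorbs [K * sqrt k], up to the constant [K ^+ 2 / (4 * a)], and the other is the
   decay [rho ^+ k]. *)
pose a : R := gap * ln 2 / 4.
have a0 : 0 < a by rewrite !mulr_gt0.
pose rho := expR (- a).
have rho0 : 0 < rho by exact: expR_gt0.
have rho1 : rho < 1 by rewrite expR_lt1 oppr_lt0.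
pose D := C ^+ 2 * expR (K + K ^+ 2 / (4 * a)).
have D0 : 0 < D by rewrite mulr_gt0 ?exprn_gt0 ?expR_gt0.
pose t n k := 'C(n, k)%:R * (h k * h (n - k)%N) / h n.
have half n k : (0 < k)%N -> (k < n)%N -> (2 * k <= n)%N ->
    t n k <= D * n%:R `^ (- (gap / 2)) * rho ^+ k.
  move=> k0 kn k2.
  have c0 : 0 < 'C(n, k)%:R :> R by rewrite ltr0n bin_gt0 ltnW.
  have N0 : 0 < n%:R :> R by rewrite ltr0n (ltn_trans k0).
  apply: (@le_trans _ _ (C ^+ 2 * ('C(n, k)%:R * (W k * W (n - k)) / W n))).
    have hh : h k * h (n - k)%N <= C ^+ 2 * (W k * W (n - k)).
      have -> : C ^+ 2 * (W k * W (n - k)) = C * W k * (C * W (n - k)%N) by lra.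
      by rewrite ler_pM// ltW.
    have hi : (h n)^-1 <= (W n)^-1.
      by rewrite lef_pV2 ?posrE//; exact: torsion_prod_le_nhom.
    have -> : C ^+ 2 * ('C(n, k)%:R * (W k * W (n - k)) / W n) =
      'C(n, k)%:R * (C ^+ 2 * (W k * W (n - k))) / W n by lra.
    apply: ler_pM => //; last by rewrite ler_wpM2l// ltW.
      exact: (mulr_ge0 (ltW c0) (mulr_ge0 (ltW (h0 k)) (ltW (h0 (n - k)%N)))).
    by rewrite invr_ge0 ltW.
  have := hK n k k0 kn => H.
  apply: le_trans (ler_wpM2l (sqr_ge0 C) H) _.
  rewrite /D -2!(mulrA (C ^+ 2)) ler_pM2l ?exprn_gt0//.
  rewrite -[_ `^ _]lnK ?posrE ?powR_gt0// ln_powR /rho -expRM_natr -!expRD ler_expR.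
  have b1 : ln n%:R <= ln 'C(n, k)%:R :> R.
    by rewrite ler_ln ?posrE// ler_nat leq_bin_self.
  have b2 : k%:R * ln 2 <= ln 'C(n, k)%:R :> R.
    rewrite mulr_natl -lnXn// ler_ln ?posrE ?exprn_gt0// -natrX ler_nat.
    exact: leq_exp2_bin.
  set q := Num.sqrt k%:R.
  have q2 : q ^+ 2 = k%:R by rewrite sqr_sqrtr.
  have b3 : K * q <= a * k%:R + K ^+ 2 / (4 * a).
    rewrite -q2 invfM; have := divff (lt0r_neq0 a0); set i := a^-1 => ai.
    have i0 : 0 <= i by rewrite invr_ge0 ltW.
    have := mulr_ge0 i0 (sqr_ge0 (2 * a * q - K)).
    have e1 := congr1 (fun z => z * (a * q ^+ 2)) ai.
    have e2 := congr1 (fun z => z * (q * K)) ai.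
    rewrite /= in e1 e2.
    lra.
  have b4 := ler_wpM2l (ltW gap0) b1; have b5 := ler_wpM2l (ltW gap0) b2.
  have aE : a * k%:R = gap * (k%:R * ln 2) / 4 by rewrite /a; lra.
  rewrite -/q; lra.
(* The exponential lower bound on the binomial coefficient requires [2 * k <= n]; the remaining k
   are reached by symmetry. *)
have tsym n k : (k <= n)%N -> t n k = t n (n - k)%N.
  by move=> kn; rewrite /t bin_sub// subKn// (mulrC (h k)).
have bnd n : \sum_(1 <= k < n) t n k <= 2 * (D * n%:R `^ (- (gap / 2)) / (1 - rho)).
  have P0 : 0 <= D * n%:R `^ (- (gap / 2)) by rewrite mulr_ge0 ?powR_ge0 ?ltW.
  apply: (@le_trans _ _ (\sum_(1 <= k < n) (D * n%:R `^ (- (gap / 2)) * rho ^+ k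
      + D * n%:R `^ (- (gap / 2)) * rho ^+ (n - k)))).
    rewrite big_nat_cond [leRHS]big_nat_cond; apply: ler_sum => k.
    rewrite andbT => /andP[k0 kn].
    have r1 : 0 <= D * n%:R `^ (- (gap / 2)) * rho ^+ k by rewrite (mulr_ge0 P0)// exprn_ge0// ltW.
    have r2 : 0 <= D * n%:R `^ (- (gap / 2)) * rho ^+ (n - k) by rewrite (mulr_ge0 P0)// exprn_ge0// ltW.
    have [k2|k2] := leqP (2 * k) n.
      by apply: le_trans (half n k k0 kn k2) _; rewrite lerDl.
    rewrite tsym 1?ltnW//; apply: le_trans (half n (n - k)%N _ _ _) _.
    - by rewrite subn_gt0.
    - by rewrite ltn_subrL k0 (ltn_trans k0).
    - by rewrite mulnBr leq_subLR mul2n -addnn leq_add2r ltnW.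
    by rewrite lerDr.
  have geo N : \sum_(k < N) rho ^+ k <= (1 - rho)^-1.
    have r1 : 0 < 1 - rho by rewrite subr_gt0.
    rewrite -[leRHS]mul1r ler_pdivlMr//.
    have := subrX1 rho N; set S := \sum_(k < N) _.
    have : 0 <= rho ^+ N by rewrite exprn_ge0 ?ltW.
    lra.
  have geo1 : \sum_(1 <= k < n) rho ^+ k <= (1 - rho)^-1.
    apply: le_trans (geo n); case: n {P0} => [|n]; first by rewrite big_geq// big_ord0.
    by rewrite -(big_mkord xpredT (fun k => rho ^+ k)) [leRHS]big_nat_recl//= expr0 big_add1 lerDr.
  have rev : \sum_(1 <= k < n) rho ^+ (n - k) = \sum_(1 <= k < n) rho ^+ k.
    by rewrite [RHS]big_nat_rev; apply: eq_bigr => k _; rewrite add1n subSS.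
  rewrite big_split /= -!big_distrr /= rev mulr_natl mulr2n.
  by apply: lerD; apply: ler_wpM2l.
pose g n : R := 2 * (D * n%:R `^ (- (gap / 2)) / (1 - rho)).
have glim : g n @[n --> \oo] --> (2 * (D * 0 / (1 - rho)) : R).
  apply: cvgM; first exact: cvg_cst.
  apply: cvgM; last exact: cvg_cst.
  apply: cvgM; first exact: cvg_cst.
  by apply: cvg_powRN; [rewrite divr_gt0 | exact: cvgr_idn].
rewrite mulr0 mul0r mulr0 in glim; apply: (cvg0_le _ glim); apply: nearW => n.
have -> : (\sum_(1 <= k < n) 'C(n, k)%:R * (h k * h (n - k)%N)) / h n = \sum_(1 <= k < n) t n k.
  by rewrite big_distrl.
rewrite ger0_norm; first exact: bnd.
by apply: sumr_ge0 => k _; rewrite divr_ge0 ?mulr_ge0// ltW.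
Qed.

End IntransitiveNegligible.

(** * Assembly of the growth formula *)

Section Assembly.
Variable R : realType.
Variables (s : nat) (e : 'I_s -> nat).
Hypothesis hs : (2 <= s)%N.
Hypothesis he : forall j, (2 <= e j)%N.
Hypothesis hsum : \sum_(j < s) (e j)%:R^-1 < 1 :> R.

Let h0 n : 0 < (nhom e n)%:R :> R.
Proof. exact: lt_le_trans (torsion_prod_gt0 R e n) (torsion_prod_le_nhom R e n). Qed.

Lemma leq_ntrans_nhom n : (ntrans e n <= nhom e n)%N.
Proof.
by apply/subset_leq_card/fintype.subsetP => x; rewrite finset.inE => /andP[].
Qed.

Lemma cvg_ntrans : (ntrans e n)%:R / (nhom e n)%:R @[n --> \oo] --> (1 : R).
Proof.
have lo : 1 - (\sum_(1 <= k < n) 'C(n, k)%:R * ((nhom e k)%:R * (nhom e (n - k)%N)%:R))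
    / (nhom e n)%:R @[n --> \oo] --> (1 - 0 : R).
  by apply: cvgB; [exact: cvg_cst | exact: cvg_intransitive].
rewrite subr0 in lo.
apply: (@squeeze_cvgr _ _ _ _ _ (fun=> 1) _ _ _ lo (cvg_cst (1 : R))); apply: nearW => n.
apply/andP; split; last by rewrite ler_pdivrMr// mul1r ler_nat leq_ntrans_nhom.
rewrite ler_pdivlMr// mulrBl mul1r divfK ?gt_eqF// lerBlDr.
have := leq_nhom_trans e n; rewrite -(ler_nat R) natrD natr_sum.
by under eq_bigr do rewrite !natrM.
Qed.

Lemma cvg_torsion_prod :
  torsion_prod R e n * expR (- \sum_(j < s) ln_torsion_growth R (e j) n) @[n --> \oo]
    --> (1 : R).
Proof.
have := @cvg_prod_cond R _ predT (fun j n => (ntorsion (e j) n)%:R *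
   expR (- ln_torsion_growth R (e j) n)) (fun=> 1) (fun j => @ntorsion_asymp R (e j) (he j)).
rewrite big1//; apply: near_cvg; apply: nearW => n /=.
by rewrite big_split /= -sumrN expR_sum.
Qed.

(** An exact identity, obtained by comparing coefficients. The factor [(n - 1)! = n! / n] supplies
    the missing power of [n!] and removes one [ln n]; the rest of [growth], including the constant,
    is a sum over j. *)
Lemma ln_growth n : (0 < n)%N ->
  n.-1`!%:R * growth e R n = expR (\sum_(j < s) ln_torsion_growth R (e j) n).
Proof.
move=> n0; have N0 : 0 < n%:R :> R by rewrite ltr0n.
have E0 j : 0 < (e j)%:R :> R by rewrite ltr0n (ltn_trans _ (he j)).
have F0 k : 0 < k`!%:R :> R by rewrite ltr0n fact_gt0.
have P0 : 0 < \prod_(j < s) (e j)%:R :> R by apply: prodr_gt0.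
have p2 : 0 < 2 * pi :> R by rewrite mulr_gt0 ?pi_gt0.
have lnP : ln (\prod_(j < s) (e j)%:R) = \sum_(j < s) ln (e j)%:R :> R.
  have [] // : 0 < \prod_(j < s) (e j)%:R :> R /\ ln (\prod_(j < s) (e j)%:R) = \sum_(j < s) ln (e j)%:R :> R.
  elim/big_ind2: _ => [|a b c d [a0 <-] [d0 <-]|j _]; first by rewrite ln1.
    by rewrite mulr_gt0// lnM ?posrE.
  by [].
have powE (a b : R) : 0 < a -> a `^ b = expR (b * ln a).
  by move=> a0; rewrite -[LHS]lnK ?posrE ?powR_gt0// ln_powR.
rewrite /growth /Kconst -powR12_sqrt ?(ltW P0)// !powE// lnP.
rewrite -[n.-1`!%:R]lnK ?posrE// invfM -!expRN -!expRD; congr expR.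
have fE : ln n`!%:R = ln n%:R + ln n.-1`!%:R :> R.
  by rewrite -{1}(prednK n0) factS natrM prednK// lnM ?posrE.
pose sg : R := \sum_(j < s) (e j)%:R^-1.
have aE : alpha e R = - 2 + 2 * sg by rewrite /alpha -big_distrr.
rewrite aE /mu.
have -> : \sum_(j < s | (2 %| e j)%N) (2 * (e j)%:R)^-1 =
    \sum_(j < s) (2 %| e j)%:R / (2 * (e j)%:R) :> R.
  rewrite big_mkcond; apply: eq_bigr => j _.
  by case: ifP => _; rewrite ?mul1r ?mul0r.
rewrite /ln_torsion_growth big_split /= big_split /= big_split /= big_split /=.
rewrite !sumrN -!big_distrl /= !sumrB !sumr_const !card_ord -/sg.
have -> : \sum_(j < s) (2 * (e j)%:R)^-1 = sg / 2.
  by rewrite /sg big_distrl /=; apply: eq_bigr => j _; rewrite invfM mulrC.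
have -> : \sum_(j < s) \sum_(nu <- divisors (e j) | (nu < e j)%N)
      n%:R `^ (nu%:R / (e j)%:R) / nu%:R =
    \sum_(j < s) \sum_(d <- proper_divisors (e j)) n%:R `^ (d%:R / (e j)%:R) / d%:R :> R.
  by apply: eq_bigr => j _; rewrite /proper_divisors big_filter.
rewrite -[1 *+ s]/(s%:R) -[2^-1 *+ s]mulr_natl fE.
lra.
Qed.

Lemma cvg_subgroup_number :
  (subgroup_number (Gamma e) n)%:R / growth e R n @[n --> \oo] --> (1 : R).
Proof.
have lim : (ntrans e n)%:R / (nhom e n)%:R * ((nhom e n)%:R / torsion_prod R e n)
   * (torsion_prod R e n * expR (- \sum_(j < s) ln_torsion_growth R (e j) n)) @[n --> \oo]
   --> (1 * 1 * 1 : R).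
  apply: cvgM; last exact: cvg_torsion_prod.
  by apply: cvgM; [exact: cvg_ntrans | exact: cvg_nhom].
rewrite !mulr1 in lim; apply: near_cvg lim; near=> n.
have n0 : (0 < n)%N by near: n; exact: nbhs_infty_gt.
have F0 : n.-1`!%:R != 0 :> R by rewrite pnatr_eq0 -lt0n fact_gt0.
have E (a b c d : R) : b != 0 -> c != 0 -> a / b * (b / c) * (c * d) = a * d.
  by move=> b0 c0; rewrite mulrA [a / b * _]mulrA divfK// divfK.
rewrite expRN -ln_growth// E ?lt0r_neq0// ?torsion_prod_gt0//.
rewrite -{1}(prednK n0) ntrans_subgroup_number prednK// natrM invfM mulrA.
by rewrite (mulrC n.-1`!%:R) mulfK.
Unshelve. all: by end_near. Qed.

End Assembly.

Theorem theoremD (R : realType) (s : nat) (e : 'I_s -> nat)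
    (hs : (2 <= s)%N) (he : forall j, (2 <= e j)%N)
    (halpha : alpha e R < 0) :
  (fun n => (subgroup_number (Gamma e) n)%:R : R^o) ~_\oo (growth e R : nat -> R^o).
Proof.
(* The sum in [alpha] is twice the sum of the inverses, so negativity of [alpha] is exactly this
   inequality. *)
have hsum : \sum_(j < s) (e j)%:R^-1 < 1 :> R.
  by move: halpha; rewrite /alpha -big_distrr /=; lra.
apply/eqaddoP => eps eps0.
near=> n.
have n0 : (0 < n)%N by near: n; exact: nbhs_infty_gt.
have g0 : 0 < growth e R n.
  have := expR_gt0 (\sum_(j < s) ln_torsion_growth R (e j) n).
  by rewrite -ln_growth// pmulr_rgt0// ltr0n fact_gt0.
have : `|1 - (subgroup_number (Gamma e) n)%:R / growth e R n| <= eps.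
  by near: n; apply: (cvgr_dist_le _ _ (cvg_subgroup_number hs he hsum)).
rewrite /= -ler_pdivrMr ?normr_gt0 ?gt_eqF// -normf_div distrC.
by rewrite mulrBl divff ?gt_eqF.
Unshelve. all: by end_near. Qed.
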